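(* Let $E=\bigcup_{j=1}^{\ell}[b_{2j-1},b_{2j}]$ with real $b_1<b_2<\cdots<b_{2\ell}$, and let $G_E$ denote the single-valued branch on $\mathbb{C}\setminus[b_1,\infty)$ of the complex Green's function of $\widehat{\mathbb{C}}\setminus E$ with $G_E(b_1)=0$. Then $$G_E^{\pm}(x):=\lim_{z\to x,\ z\in\mathbb{H}^{\pm}}G_E(z)=\mp\mathrm{i}\pi\,\mu_E([b_1,x]),\qquad x\in E,$$ or, equivalently, since the support of $\mu_E$ is contained in $E$, $$G_E^{\pm}(x)=\mp\mathrm{i}\pi\sum_{k=1}^{j-1}\mu_E([b_{2k-1},b_{2k}])\mp\mathrm{i}\pi\,\mu_E([b_{2j-1},x]),\qquad x\in[b_{2j-1},b_{2j}],$$ for $j=1,\ldots,\ell$. In particular, the density of the equilibrium measure of $E$ can be represented by $$\frac{\mathrm{d}\mu_E(x)}{\mathrm{d}x}=\frac{1}{\pi\mathrm{i}}\frac{\mathrm{d}G_E^-}{\mathrm{d}x}(x)=-\frac{1}{\pi\mathrm{i}}\frac{\mathrm{d}G_E^+}{\mathrm{d}x}(x),\qquad x\in E.$$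
   Context: $g_E$ is the (real) Green's function of $E^{\mathrm c}=\widehat{\mathbb{C}}\setminus E$ with pole at infinity (it extends continuously by $0$ to $E$). The complex Green's function is the multi-valued analytic function $G_E=g_E+\mathrm{i}h_E$ on $\mathbb{C}\setminus E$, where $h_E$ is a (multi-valued) harmonic conjugate of $g_E$; it is unique up to an additive imaginary constant. On the simply connected domain $\mathbb{C}\setminus[b_1,\infty)$ it has a unique single-valued analytic branch with $G_E(b_1):=\lim_{x\to b_1,\,x<b_1}G_E(x)=0$ (and $\operatorname{Re}G_E=g_E$). $\mu_E$ is the equilibrium measure of $E$. $\mathbb{H}^{\pm}$ are the open upper and lower half-planes.
   Formalization: The density formula is stated for x in the interior of E rather than for all x in E: at the endpoints b_1,…,b_{2ℓ} the density is infinite and the derivatives of G_E^± do not exist (e.g. E=[-1,1], x=±1). *)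

(* Defs.v *)
From HB Require Import structures.
From mathcomp Require Import all_boot all_order all_algebra.
From mathcomp Require Import complex.
From mathcomp Require Import all_classical all_reals all_analysis.

Set Implicit Arguments.
Unset Strict Implicit.
Unset Printing Implicit Defensive.

Import Order.TTheory GRing.Theory Num.Theory.
Import numFieldNormedType.Exports.

Local Open Scope classical_set_scope.
Local Open Scope ring_scope.
Local Open Scope complex_scope.

(* R[i] with its usual topology, as a normed space over itself: derivatives of
   maps R[i] -> R[i] are therefore complex derivatives. *)
HB.instance Definition _ (R : realType) := NormedModule.copy R[i] R[i]^o.

Section Plane.
Context {R : realType}.
Local Notation C := R[i].

(* The norm `|z| of z : R[i] is itself of type R[i]; this is its real value. *)
Definition modulus (z : C) : R := complex.Re `|z|.

Definition upper_half_plane : set C := [set z | 0 < complex.Im z].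
Definition lower_half_plane : set C := [set z | complex.Im z < 0].

Definition real_set (A : set R) : set C := [set x%:C | x in A].

Definition holomorphic_on (U : set C) (f : C -> C) : Prop :=
  forall z, U z -> derivable f z 1.

Definition C1_on (D : set (R * R)) (v : R * R -> R) : Prop :=
  forall p, D p ->
    [/\ derivable v p (1, 0), derivable v p (0, 1),
        {for p, continuous ('D_(1, 0) v)} & {for p, continuous ('D_(0, 1) v)}].

(* Twice continuously differentiable in (x, y), with u_xx + u_yy = 0; meant for
   open U. *)
Definition harmonic_on (U : set C) (u : C -> R) : Prop :=
  let D := [set p : R * R | U (p.1 +i* p.2)] in
  let v := fun p : R * R => u (p.1 +i* p.2) in
  [/\ C1_on D v, C1_on D ('D_(1, 0) v), C1_on D ('D_(0, 1) v) &
      forall p, D p ->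
        'D_(1, 0) ('D_(1, 0) v) p + 'D_(0, 1) ('D_(0, 1) v) p = 0].

(* Green's function, with pole at infinity, of the complement of a compact set
   K at all of whose points it extends continuously by 0. *)
Definition is_green_function (K : set C) (g : C -> R) : Prop :=
  [/\ harmonic_on (~` K) g,
      exists M r : R, forall z, r < modulus z ->
        `|g z - ln (modulus z)| <= M,
      continuous g
    & forall z, K z -> g z = 0].

(* The branch on the slit plane C \ [a, +oo[ of the complex Green's function
   g + i h (h a harmonic conjugate of g) that tends to 0 at a from the left. *)
Definition is_complex_green_branch (a : R) (g : C -> R) (G : C -> C) : Prop :=
  let slit_plane := ~` real_set `[a, +oo[ in
  [/\ holomorphic_on slit_plane G,
      forall z, slit_plane z -> complex.Re (G z) = g z
    & G x%:C @[x --> a^'-] --> 0].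

Definition boundary_value (H : set C) (G : C -> C) (x : R) : C :=
  lim (G z @[z --> within H (nbhs x%:C)]).

(* Derivatives of C-valued functions of a real variable; the library's derive1
   does not apply because R[i] is a normed space over R[i], not over R. *)
Definition real_diff_quotient (F : R -> C) (x h : R) : C :=
  (F (x + h) - F x) / h%:C.

Definition real_derivable (F : R -> C) (x : R) : Prop :=
  cvg (real_diff_quotient F x h @[h --> 0^']).

Definition real_derive (F : R -> C) (x : R) : C :=
  lim (real_diff_quotient F x h @[h --> 0^']).

End Plane.

Section Measures.
Context {R : realType}.

(* The kernel log (1 / |x - y|) is +oo on the diagonal, since lne 0 = -oo. *)
Definition log_energy (nu : probability (measurableTypeR R) R) : \bar R :=
  (\int[nu]_x \int[nu]_y - lne (`|x - y|%:E))%E.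

(* Minimiser of the logarithmic energy among the probability measures on E;
   as E is a subset of the real line, these are measures on R giving E mass 1. *)
Definition is_equilibrium_measure (E : set R)
    (mu : probability (measurableTypeR R) R) : Prop :=
  mu E = 1%E /\
  forall nu : probability (measurableTypeR R) R,
    nu E = 1%E -> (log_energy mu <= log_energy nu)%E.

Definition is_density (f : R -> R)
    (mu : probability (measurableTypeR R) R) : Prop :=
  [/\ measurable_fun setT f, forall x, 0 <= f x &
      forall A : set R, measurable A ->
        mu A = (\int[lebesgue_measure]_(x in A) (f x)%:E)%E].

Definition interval_union (l : nat) (b : nat -> R) : set R :=
  \bigcup_(j in [set j | (1 <= j <= l)%N]) `[b (2 * j - 1)%N, b (2 * j)%N]%classic.

End Measures.

(* Main.v *)
(* Write u(x, y) = g(x + iy) and let h = Im G in the upper half-plane. By moving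
   planes u increases with |y|, so h is nonincreasing in x; it is also bounded.
   Near every point of E other than an endpoint the gradient of u stays bounded
   up to the real axis, so h has boundary values there, and these define a Stieltjes
   measure nu on E. By Phragmen-Lindelof h is the Poisson-type integral of arg
   against nu, minus pi, hence u = V + (the logarithmic potential of nu).
   Letting y tend to 0 on E shows that the potential of nu equals - V on all of
   E and that nu has no atoms. The energies of (mu, nu) and (nu, nu) therefore
   coincide, and positive definiteness of the logarithmic kernel, a
   superposition of the kernels max(r - |x - y|, 0), forces the minimiser mu to be
   nu. The boundary values of h are then - pi mu(]-oo, x]), and reflection in the real
   axis gives the lower half-plane. In the interior of E the boundary value of h
   is differentiable with locally Lipschitz derivative, which yields the
   density. *)

Require Import Defs.
From HB Require Import structures.
From mathcomp Require Import all_boot all_order all_algebra.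
From mathcomp Require Import complex.
From mathcomp Require Import all_classical all_reals all_analysis.
From mathcomp Require Import measurable_realfun.
From mathcomp Require Import ring lra zify.

Set Implicit Arguments.
Unset Strict Implicit.
Unset Printing Implicit Defensive.

Import Order.TTheory GRing.Theory Num.Theory.
Import numFieldNormedType.Exports.

Local Open Scope classical_set_scope.
Local Open Scope ring_scope.
Local Open Scope complex_scope.

(** * Derivatives of real functions *)

Section MeanValue.
Context {R : realType}.
Implicit Types (f df : R -> R) (a b c t : R).

(** The endpoints of E shape the proof. The gradient of u is controlled off E and inside E, but no
    bound is at hand at an endpoint, so nothing is known at first about h there. Endpoints are
    carried along as a finite list [s] of exceptional points: Phragmen-Lindelof tolerates them
    thanks to a logarithmic barrier, while the boundary measure might still charge them. Their atoms
    are excluded only afterwards, because the potential is finite at every point of E; the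
    representation of h then yields boundary values at the endpoints too. All harmonic estimates,
    gradient bounds included, come from one maximum principle and explicit quadratic or logarithmic
    comparison functions. Energies may be infinite, so the energy of mu - nu is never formed: the
    kernel is truncated to a nonnegative one, and I(mu, mu) + I(nu, nu) >= 2 I(mu, nu) + defect is
    proved by additions only. With I(mu, mu) <= I(nu, nu) = I(mu, nu) finite, the defect vanishes.
    It compares mu and nu on windows of one single length, larger than the diameter of E, and this
    already determines the distribution functions. *)

Lemma mean_value f df a b : a <= b ->
  (forall t, a <= t <= b -> is_derive t 1 f (df t)) ->
  exists2 c, a <= c <= b & f b - f a = df c * (b - a).
Proof.
move=> ab fd; have [|x xab|c] := @MVT_segment R f df a b ab.
- move=> x; rewrite in_itv/= => /andP[ax xb]; apply: fd; lra.
- apply: derivable_within_continuous => t; rewrite in_itv/= => tab.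
  by have := fd _ tab => -[].
by rewrite in_itv/= => cab ->; exists c.
Qed.

Lemma mean_value_bound f df a b K :
  (forall t, a <= t <= b \/ b <= t <= a -> is_derive t 1 f (df t)) ->
  (forall t, a <= t <= b \/ b <= t <= a -> `|df t| <= K) ->
  `|f b - f a| <= K * `|b - a|.
Proof.
wlog ab : a b / a <= b => [H|].
  have [ab|/ltW ab] := leP a b; first exact: (H _ _ ab).
  move=> fd fK; rewrite distrC (distrC b); apply: (H _ _ ab) => t t_ab.
    by apply: fd; case: t_ab; [right|left].
  by apply: fK; case: t_ab; [right|left].
move=> fd fK.
have [c cab ->] := mean_value ab (fun t tab => fd t (or_introl tab)).
by rewrite normrM ler_wpM2r // fK //; left.
Qed.

Lemma mean_value_eq f df a b :
  (forall t, a <= t <= b \/ b <= t <= a -> is_derive t 1 f (df t)) ->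
  (forall t, a <= t <= b \/ b <= t <= a -> df t = 0) -> f b = f a.
Proof.
move=> fd f0; apply/eqP; rewrite -subr_eq0 -normr_le0.
rewrite -(mul0r `|b - a|); apply: mean_value_bound fd _ => t /f0 ->.
by rewrite normr0.
Qed.

(** A division-free form that also covers [s = 0]; it is the shape in which the explicit estimates
    below produce and consume derivatives. *)
Lemma is_deriveP f t c : is_derive t 1 f c <->
  forall e, 0 < e -> exists2 d, 0 < d &
    forall s, `|s| < d -> `|f (t + s) - f t - c * s| <= e * `|s|.
Proof.
have quotE s : s != 0 ->
    s^-1 *: (f (s *: (1 : R) + t) - f t) - c = (f (t + s) - f t - c * s) / s.
  move=> s0; have -> : s *: (1 : R) = s by rewrite /GRing.scale /= mulr1.
  by rewrite (addrC s) mulrBl mulfK // mulrC.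
split=> [[df <-]|H].
  move=> e e0; have := df => /cvg_ex [l /= fl].
  have -> : 'D_1 f t = l by exact/cvg_lim.
  have {}fl : s^-1 *: (f (s *: (1 : R) + t) - f t) @[s --> 0^'] --> l by [].
  move/cvgrPdist_le : fl => /(_ _ e0) /nbhs_ballP [d /= d0 fd].
  exists d => // s sd; have [->|s0] := eqVneq s 0.
    by rewrite !addr0 subrr !mulr0 subrr !normr0 mulr0.
  have := fd s; rewrite /ball /= sub0r normrN => /(_ sd s0).
  rewrite distrC (_ : _ - l = (f (t + s) - f t - l * s) / s).
    by rewrite normrM normfV ler_pdivrMr ?normr_gt0.
  have -> : s *: (1 : R) = s by rewrite /GRing.scale /= mulr1.
  by rewrite (addrC s) mulrBl mulfK // mulrC.
have fc : s^-1 *: (f (s *: (1 : R) + t) - f t) @[s --> 0^'] --> c.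
  apply/cvgrPdist_le => e e0; have [d d0 fd] := H e e0.
  apply/nbhs_ballP; exists d => //= s; rewrite /ball /= sub0r normrN => sd s0.
  by rewrite distrC quotE // normrM normfV ler_pdivrMr ?normr_gt0 // fd.
by apply: DeriveDef; [apply/cvg_ex; exists c|exact/cvg_lim].
Qed.

Lemma derive_bound f c t K d : 0 < d -> is_derive t 1 f c ->
  (forall s, 0 < s < d -> `|f (t + s) - f t| <= K * s) -> `|c| <= K.
Proof.
move=> d0 /is_deriveP fc fK; apply/ler_addgt0Pr => e e0.
have [d' d'0 fd] := fc e e0; pose s := Num.min d d' / 2.
have m0 : 0 < Num.min d d' by rewrite lt_min d0.
have s0 : 0 < s by rewrite divr_gt0.
have sm : s < Num.min d d' by rewrite /s; lra.
move: (sm); rewrite lt_min => /andP[sd sd'].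
have := fd s; rewrite gtr0_norm // => /(_ sd').
have := fK s; rewrite s0 sd => /(_ isT) H1 H2.
rewrite -(ler_pM2r s0) -{1}(gtr0_norm s0) -normrM mulrDl.
have := ler_normB (f (t + s) - f t) (f (t + s) - f t - c * s).
by rewrite opprB addrC subrK; lra.
Qed.

(** Reflection arguments compare the values at [t - s] and [t + s] with each other, never with
    [f t]; their difference is [2 c s + o(s)]. *)
Lemma derive_ge0_symm f c t d : 0 < d -> is_derive t 1 f c ->
  (forall s, 0 < s < d -> f (t - s) <= f (t + s)) -> 0 <= c.
Proof.
move=> d0 /is_deriveP fc fK; rewrite leNgt; apply/negP => c0.
have e0 : 0 < - c / 2 by lra.
have [d' d'0 fd] := fc _ e0; pose s := Num.min d d' / 2.
have m0 : 0 < Num.min d d' by rewrite lt_min d0.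
have s0 : 0 < s by rewrite divr_gt0.
have sm : s < Num.min d d' by rewrite /s; lra.
move: (sm); rewrite lt_min => /andP[sd sd'].
have := fd s; have := fd (- s); rewrite normrN gtr0_norm // => /(_ sd') + /(_ sd').
have := fK s; rewrite s0 sd => /(_ isT).
rewrite !ler_norml => H /andP[H1 H2] /andP[H3 H4].
have : 0 < - c * s by rewrite mulr_gt0 // oppr_gt0.
lra.
Qed.

Lemma is_derive_fD f g t a b : is_derive t 1 f a -> is_derive t 1 g b ->
  is_derive t 1 (fun s => f s + g s) (a + b).
Proof. by move=> fa gb; exact: is_deriveD. Qed.

Lemma is_derive_fB f g t a b : is_derive t 1 f a -> is_derive t 1 g b ->
  is_derive t 1 (fun s => f s - g s) (a - b).
Proof. by move=> fa gb; exact: is_deriveB. Qed.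

Lemma is_derive_fM f g t a b : is_derive t 1 f a -> is_derive t 1 g b ->
  is_derive t 1 (fun s => f s * g s) (f t * b + g t * a).
Proof. by move=> fa gb; have := is_deriveM fa gb. Qed.

Lemma is_derive_affine a k t : is_derive t 1 (fun s => a + k * s) k.
Proof.
apply/is_deriveP => e e0; exists 1 => // s _.
by rewrite (_ : _ - _ = 0) ?normr0 ?mulr_ge0 ?(ltW e0) //; ring.
Qed.

Lemma is_derive_comp_affine f c a k t : is_derive (a + k * t) 1 f c ->
  is_derive t 1 (fun s => f (a + k * s)) (k * c).
Proof.
move=> fc; have h := is_derive_affine a k t.
have := @is_derive1_comp _ f (fun s => a + k * s) t c k fc h.
by rewrite /GRing.scale /= mulrC.
Qed.

Lemma is_derive_shift f c a t : is_derive (a + t) 1 f c ->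
  is_derive t 1 (fun s => f (a + s)) c.
Proof.
move=> fc; have := @is_derive_comp_affine f c a 1 t; rewrite !mul1r => /(_ fc).
by rewrite (_ : (fun s => f (a + 1 * s)) = fun s => f (a + s)) //;
  apply/funext => s; rewrite mul1r.
Qed.

Lemma is_derive_reflect f c a t : is_derive (a - t) 1 f c ->
  is_derive t 1 (fun s => f (a - s)) (- c).
Proof.
move=> fc; have := @is_derive_comp_affine f c a (- 1) t; rewrite !mulN1r => /(_ fc).
by rewrite (_ : (fun s => f (a + -1 * s)) = fun s => f (a - s)) //;
  apply/funext => s; rewrite mulN1r.
Qed.

End MeanValue.

(** * Harmonic functions of two real variables *)

Section SymmetricSecondDerivative.
Context {R : realType}.
Implicit Types (f : R -> R) (c : R).

(** The symmetric (Schwarz) second derivative of [f] at 0. It is invariant under [s -> - s], so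
    reflected functions inherit it, and it makes sense without a first derivative. *)
Definition sym2_derive f c := forall e, 0 < e -> exists2 d, 0 < d &
  forall s, 0 < s < d -> `|f s + f (- s) - f 0 *+ 2 - c * s ^+ 2| <= e * s ^+ 2.

Lemma sym2_deriveD f1 f2 c1 c2 : sym2_derive f1 c1 -> sym2_derive f2 c2 ->
  sym2_derive (fun s => f1 s + f2 s) (c1 + c2).
Proof.
move=> H1 H2 e e0; have e20 : 0 < e / 2 by lra.
have [d1 d10 {}H1] := H1 _ e20; have [d2 d20 {}H2] := H2 _ e20.
exists (Num.min d1 d2); first by rewrite lt_min d10.
move=> s; rewrite lt_min => /and3P[s0 s1 s2].
have := H1 s; have := H2 s; rewrite s0 s1 s2 => /(_ isT) + /(_ isT).
rewrite /= !ler_norml => /andP[? ?] /andP[? ?].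
by apply/andP; split; lra.
Qed.

Lemma sym2_deriveZ f c k : sym2_derive f c ->
  sym2_derive (fun s => k * f s) (k * c).
Proof.
move=> H e e0; have k0 : 0 < `|k| + 1 by have := normr_ge0 k; lra.
have [d d0 {}H] := H (e / (`|k| + 1)) (divr_gt0 e0 k0).
exists d => // s sd; have := H s sd.
set w := f s + _ - _ - _ => Hw.
rewrite (_ : _ - _ = k * w); last by rewrite /w; ring.
rewrite normrM; apply: (@le_trans _ _ (`|k| * (e / (`|k| + 1) * s ^+ 2))).
  by rewrite ler_wpM2l.
rewrite mulrA ler_wpM2r ?sqr_ge0 // mulrA ler_pdivrMr //.
by have := normr_ge0 k; nra.
Qed.

Lemma sym2_derive_sqr a k : sym2_derive (fun s => k * (a + s) ^+ 2) (k *+ 2).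
Proof.
move=> e e0; exists 1 => // s _.
rewrite (_ : _ - _ = 0); last by ring.
by rewrite normr0 mulr_ge0 ?sqr_ge0 // ltW.
Qed.

Lemma sym2_derive_affine a k : sym2_derive (fun s => a + k * s) 0.
Proof.
move=> e e0; exists 1 => // s _.
rewrite (_ : _ - _ = 0); last by ring.
by rewrite normr0 mulr_ge0 ?sqr_ge0 // ltW.
Qed.

Lemma sym2_deriveN f c : sym2_derive f c -> sym2_derive (fun s => f (- s)) c.
Proof.
move=> H e e0; have [d d0 {}H] := H _ e0.
by exists d => // s sd; rewrite opprK oppr0 (addrC (f (- s))); exact: H.
Qed.

Lemma eq_sym2_derive f1 f2 c : (exists2 d, 0 < d & forall s, `|s| < d -> f1 s = f2 s) ->
  sym2_derive f1 c -> sym2_derive f2 c.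
Proof.
move=> [d d0 f12] H e e0; have [d' d'0 {}H] := H _ e0.
exists (Num.min d d'); first by rewrite lt_min d0.
move=> s; rewrite lt_min => /and3P[s0 s1 s2].
have [e1 e2] : f1 s = f2 s /\ f1 (- s) = f2 (- s).
  by split; apply: f12; rewrite ?normrN gtr0_norm.
have e3 : f1 0 = f2 0 by apply: f12; rewrite normr0.
by rewrite -e1 -e2 -e3; apply: H; rewrite s0.
Qed.

Lemma sym2_derive_le0 f c d : 0 < d ->
  (forall s, `|s| < d -> f s <= f 0) -> sym2_derive f c -> c <= 0.
Proof.
move=> d0 fm H; rewrite leNgt; apply/negP => c0.
have c20 : 0 < c / 2 by lra.
have [d' d'0 {}H] := H _ c20; pose s := Num.min d d' / 2.
have m0 : 0 < Num.min d d' by rewrite lt_min d0.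
have s0 : 0 < s by rewrite divr_gt0.
have sm : s < Num.min d d' by rewrite /s; lra.
move: (sm); rewrite lt_min => /andP[sd sd'].
have := H s; rewrite s0 sd' => /(_ isT); rewrite ler_norml => /andP[Hs _].
have := fm s; have := fm (- s); rewrite normrN gtr0_norm // => /(_ sd) + /(_ sd).
have : 0 < c * s ^+ 2 by rewrite mulr_gt0 // exprn_gt0.
lra.
Qed.

(** The mean value theorem for [f (t + s) + f (t - s) - c s ^+ 2] leaves
    [df (t + r) - df (t - r) - 2 c r], which is [o(r)] by differentiability of [df] at the single
    point [t]. *)
Lemma sym2_derive_derive2 f (df : R -> R) c (d t : R) : 0 < d ->
  (forall s, `|s - t| < d -> is_derive s 1 f (df s)) -> is_derive t 1 df c ->
  sym2_derive (fun s => f (t + s)) c.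
Proof.
move=> d0 fd /is_deriveP dfd e e0; have e20 : 0 < e / 2 by lra.
have [d' d'0 {}dfd] := dfd _ e20.
exists (Num.min d d'); first by rewrite lt_min d0.
move=> s; rewrite lt_min => /and3P[s0 s1 s2].
pose phi s := f (t + s) + f (t - s) - c * s ^+ 2.
pose dphi s := df (t + s) - df (t - s) - c * s *+ 2.
have phid r : 0 <= r <= s -> is_derive r 1 phi (dphi r).
  move=> rs; have rd : `|r| < d by rewrite ger0_norm; lra.
  have h1 : is_derive (t + r) 1 f (df (t + r)) by apply: fd; rewrite addrC addKr.
  have h2 : is_derive (t - r) 1 f (df (t - r)).
    by apply: fd; rewrite addrC addKr normrN.
  have h3 : is_derive r 1 (fun r => f (t + r)) (df (t + r)).
    exact: is_derive_shift.
  have h4 : is_derive r 1 (fun r => f (t - r)) (- df (t - r)).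
    exact: is_derive_reflect.
  have h5 : is_derive r 1 (fun r => c * r ^+ 2) (c * r *+ 2).
    have -> : (fun r => c * r ^+ 2) = (fun r : R => r * (0 + c * r)).
      by apply/funext => z; ring.
    have := is_derive_fM (is_derive_affine 0 1 r) (is_derive_affine 0 c r).
    have -> : (fun s => (0 + 1 * s) * (0 + c * s)) = (fun r : R => r * (0 + c * r)).
      by apply/funext => z; ring.
    by move=> h; apply: is_derive_eq h _; ring.
  exact: is_derive_fB (is_derive_fD h3 h4) h5.
have s0' := ltW s0.
have [r rs] := mean_value s0' phid.
rewrite (_ : phi s - phi 0 = f (t + s) + f (t - s) - f (t + 0) *+ 2 - c * s ^+ 2);
  last by rewrite /phi subr0 addr0; ring.
move=> ->; rewrite subr0 normrM (gtr0_norm s0) expr2 mulrA ler_pM2r //.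
have r0 : `|r| = r by apply: ger0_norm; lra.
have := dfd r; have := dfd (- r); rewrite normrN r0 => h1 h2.
have rd' : r < d' by lra.
move: (h1 rd') (h2 rd'); rewrite /dphi !ler_norml => /andP[? ?] /andP[? ?].
have : e * r <= e * s by rewrite ler_pM2l //; lra.
by move=> ?; apply/andP; split; lra.
Qed.

End SymmetricSecondDerivative.

Section Harmonic.
Context {R : realType}.
Implicit Types (u v : R * R -> R) (p q : R * R).

(* A pointwise notion of harmonicity, weak enough to be checked by hand and
   still strong enough for the maximum principle. *)
Definition harm u p := exists c,
  sym2_derive (fun s => u (p.1 + s, p.2)) c /\
  sym2_derive (fun s => u (p.1, p.2 + s)) (- c).

Lemma harmD u v p : harm u p -> harm v p -> harm (fun q => u q + v q) p.
Proof.
move=> [c [c1 c2]] [d [d1 d2]]; exists (c + d); split.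
  exact: sym2_deriveD c1 d1.
by rewrite opprD; exact: sym2_deriveD c2 d2.
Qed.

Lemma harmZ k u p : harm u p -> harm (fun q => k * u q) p.
Proof.
move=> [c [c1 c2]]; exists (k * c); split; first exact: sym2_deriveZ c1.
by rewrite -mulrN; exact: sym2_deriveZ c2.
Qed.

Lemma harmN u p : harm u p -> harm (fun q => - u q) p.
Proof.
by move=> /(harmZ (- 1)) [c [c1 c2]]; exists c; split;
  [move: c1|move: c2]; apply: eq_sym2_derive; exists 1 => // s _; rewrite mulN1r.
Qed.

Lemma harmB u v p : harm u p -> harm v p -> harm (fun q => u q - v q) p.
Proof. by move=> hu /harmN; exact: harmD. Qed.

Lemma harm_cst k p : harm (fun=> k) p.
Proof.
exists 0; rewrite oppr0; split; apply: eq_sym2_derive (sym2_derive_affine k 0);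
  by exists 1 => // s _; rewrite mul0r addr0.
Qed.

Lemma harm_sum (I : Type) (r : seq I) (f : I -> R * R -> R) p :
  (forall i, harm (f i) p) -> harm (fun q => \sum_(i <- r) f i q) p.
Proof.
move=> fp; elim: r => [|i r IH].
  under [X in harm X]eq_fun do rewrite big_nil; exact: harm_cst.
by under [X in harm X]eq_fun do rewrite big_cons; exact: harmD.
Qed.

Lemma harm_swap u p : harm u (p.2, p.1) -> harm (fun q => u (q.2, q.1)) p.
Proof. by move=> [c [c1 c2]]; exists (- c); rewrite opprK. Qed.

Lemma harm_shift u a p : harm u (p.1 + a, p.2) -> harm (fun q => u (q.1 + a, q.2)) p.
Proof.
move=> [c [c1 c2]]; exists c; split => //.
by apply: eq_sym2_derive c1; exists 1 => //= s _; rewrite addrAC.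
Qed.

End Harmonic.

(** * Maximum principles on bounded and unbounded open sets *)

Section MaximumPrinciple.
Context {R : realType}.
Implicit Types (u v B : R * R -> R) (p q : R * R) (U : set (R * R)).

Lemma nbhs_pairP p (P : set (R * R)) : nbhs p P <-> exists2 d, 0 < d &
  forall x y, `|x - p.1| < d -> `|y - p.2| < d -> P (x, y).
Proof.
split=> [/nbhs_ballP [d /= d0 dP]|[d d0 dP]].
  exists d => // x y xd yd; apply: dP; split; rewrite /ball /= distrC //.
by apply/nbhs_ballP; exists d => // -[x y] [/= ]; rewrite /ball /= => xd yd;
  apply: dP; rewrite distrC.
Qed.

Lemma continuous_pairP u p : {for p, continuous u} <->
  forall e, 0 < e -> exists2 d, 0 < d &
  forall x y, `|x - p.1| < d -> `|y - p.2| < d -> `|u (x, y) - u p| < e.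
Proof.
split=> [/cvgrPdist_lt H e e0|H].
  have /nbhs_pairP [d d0 {}H] := H _ e0.
  by exists d => // x y xd yd; rewrite distrC; exact: H.
apply/cvgrPdist_lt => e e0; have [d d0 {}H] := H _ e0.
by apply/nbhs_pairP; exists d => // x y xd yd; rewrite distrC; exact: H.
Qed.

Definition sqnorm p : R := p.1 ^+ 2 + p.2 ^+ 2.

Lemma continuous_sqnorm : continuous sqnorm.
Proof.
move=> p; rewrite /sqnorm /continuous_at; under [X in X @ _ --> _]eq_fun do rewrite !expr2.
by apply: cvgD; apply: cvgM; (exact: cvg_fst || exact: cvg_snd).
Qed.

(* Adding a small multiple of [sqnorm] makes both symmetric second derivatives
   sum to something positive, which is impossible at an interior maximum. *)
Lemma max_principle U u N : open U ->
  (forall p, U p -> `|p.1| <= N /\ `|p.2| <= N) ->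
  (forall p, U p -> {for p, continuous u}) ->
  (forall p, U p -> harm u p) ->
  (forall q, ~ U q -> forall e, 0 < e -> \forall p \near q, U p -> u p <= e) ->
  forall p, U p -> u p <= 0.
Proof.
move=> oU bU cu hu bd p0 Up0; rewrite leNgt; apply/negP => u0.
have N0 : 0 <= N by have [/(le_trans (normr_ge0 _))] := bU _ Up0.
have NN0 : 0 < N ^+ 2 + 1 by have := sqr_ge0 N; lra.
(* [sqnorm] is at most [2 N ^+ 2] on [U], so this [d] keeps the perturbation below [u p0 / 2]. *)
pose d := u p0 / 4 / (N ^+ 2 + 1); have d0 : 0 < d by rewrite !divr_gt0.
have dU p : U p -> d * sqnorm p <= u p0 / 2.
  move=> /bU [p1 p2]; have /le_trans -> // : d * sqnorm p <= d * (N ^+ 2 *+ 2).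
    rewrite ler_pM2l // mulr2n lerD // -real_normK ?num_real //;
    by rewrite ler_sqr ?nnegrE.
  have : d * (N ^+ 2 + 1) = u p0 / 4 by rewrite /d divfK // gt_eqF.
  by lra.
pose w p := u p + d * sqnorm p.
have cw p : U p -> {for p, continuous w}.
  move=> Up; apply: (@continuousD _ _ _ u (fun p => d * sqnorm p)); first exact: cu.
  by apply: (@continuousM _ _ (fun=> d) sqnorm); [exact: cst_continuous|exact: continuous_sqnorm].
(* On [K] the function [u] is at least [u p0 / 2], whereas near a point outside [U] it is at most
   [u p0 / 4]. Hence [K] is closed in the whole plane, so compact, and the maximum of [w] is
   attained inside [U]. *)
pose K := [set p | U p /\ w p0 <= w p].
have cK : closed K.
  move=> q clq; have Uq : U q.
    apply: contrapT => nUq; have u40 : 0 < u p0 / 4 by lra.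
    have [p [[Up wp]]] := clq _ (bd q nUq _ u40).
    move=> /(_ Up); move: wp; rewrite /w; have := dU _ Up.
    have : 0 <= d * sqnorm p0 by rewrite mulr_ge0 ?(ltW d0) // addr_ge0 ?sqr_ge0.
    lra.
  split=> //; rewrite leNgt; apply/negP => wq.
  have := cw q Uq => /cvgrPdist_lt /(_ (w p0 - w q)); rewrite subr_gt0 => /(_ wq).
  move/clq => [p [[Up wp]]] /=; rewrite ltr_norml => /andP[]; lra.
have KN : K `<=` `[- N, N]%classic `*` `[- N, N]%classic.
  move=> p [/bU [p1 p2] _]; split; rewrite /= in_itv/=;
  by rewrite -ler_norml.
have compK : compact K.
  apply: subclosed_compact cK _ KN.
  by apply: compact_setX; exact: segment_compact.
have [|p /set_mem [Up wp] pmax] := compact_EVT_max (ex_intro _ p0 (conj Up0 (lexx _)) : K !=set0) compK (f := w).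
  apply: continuous_in_subspaceT => p /set_mem [Up _]; exact: cw.
have {}pmax q : U q -> w q <= w p.
  move=> Uq; have [wq|wq] := leP (w p0) (w q).
    by apply: pmax; apply/mem_set.
  by rewrite (le_trans (ltW wq)).
have [c [c1 c2]] := hu p Up.
have /nbhs_pairP [r r0 rU] : nbhs p U by exact: open_nbhs_nbhs.
have w1 : sym2_derive (fun s => w (p.1 + s, p.2)) (c + d *+ 2).
  have := sym2_deriveD (sym2_deriveD c1 (sym2_derive_sqr p.1 d)) (sym2_derive_affine (d * p.2 ^+ 2) 0).
  rewrite addr0; apply: eq_sym2_derive; exists 1 => // s _ /=.
  by rewrite /w /sqnorm /=; ring.
have w2 : sym2_derive (fun s => w (p.1, p.2 + s)) (- c + d *+ 2).
  have := sym2_deriveD (sym2_deriveD c2 (sym2_derive_sqr p.2 d)) (sym2_derive_affine (d * p.1 ^+ 2) 0).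
  rewrite addr0; apply: eq_sym2_derive; exists 1 => // s _ /=.
  by rewrite /w /sqnorm /=; ring.
have l1 : c + d *+ 2 <= 0.
  apply: (sym2_derive_le0 r0) w1 => s sr; rewrite addr0 -surjective_pairing.
  by apply: pmax; apply: rU; rewrite ?subrr ?normr0 // addrC addKr.
have l2 : - c + d *+ 2 <= 0.
  apply: (sym2_derive_le0 r0) w2 => s sr; rewrite addr0 -surjective_pairing.
  by apply: pmax; apply: rU; rewrite ?subrr ?normr0 // addrC addKr.
by lra.
Qed.

(** [max_principle] is applied to [u - e * B] on [U] cut down to a large square, and [e] tends to 0
    at a fixed point. The barrier [B] absorbs infinity and exceptional boundary points, where [u]
    itself is not controlled. *)
Lemma max_principle_barrier U u B : open U ->
  (forall p, U p -> {for p, continuous u} /\ {for p, continuous B}) ->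
  (forall p, U p -> harm u p /\ harm B p) ->
  (forall e, 0 < e -> exists N, forall p, U p -> N < `|p.1| \/ N < `|p.2| ->
    u p <= e * B p) ->
  (forall q, ~ U q -> forall e e', 0 < e -> 0 < e' ->
    \forall p \near q, U p -> u p <= e * B p + e') ->
  forall p, U p -> u p <= 0.
Proof.
move=> oU cuB huB inf bd p Up.
suff H e : 0 < e -> u p <= e * B p.
  rewrite leNgt; apply/negP => u0.
  have B0 : 0 < `|B p| + 1 by have := normr_ge0 (B p); lra.
  have e0 : 0 < u p / 2 / (`|B p| + 1) by rewrite !divr_gt0.
  have := H _ e0; apply/negP; rewrite -ltNge.
  apply: (@le_lt_trans _ _ (u p / 2 / (`|B p| + 1) * (`|B p| + 1))).
    by rewrite ler_pM2l // (le_trans (ler_norm _)) // lerDl.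
  by rewrite divfK ?gt_eqF //; lra.
move=> e0; have [N {}inf] := inf e e0.
(* The first margin 1 ensures that points within distance 1 of the sides of the square still have a
   coordinate beyond [N]; the second puts [p] inside the square. *)
pose M := Num.max (`|N| + 1) (Num.max `|p.1| `|p.2| + 1).
pose V := U `&` ((fst @^-1` `]- M, M[%classic) `&` (snd @^-1` `]- M, M[%classic)) : set (R * R).
rewrite -subr_le0; apply: (@max_principle V (fun p => u p - e * B p) M).
- apply: openI => //; apply: openI; apply: open_comp => //=.
  + by move=> q _; exact: cvg_fst.
  + by move=> q _; exact: cvg_snd.
- by move=> q [_ /= []]; rewrite !in_itv/= => q1 q2; rewrite !ler_norml; split; lra.
- move=> q [Uq _]; have [cu cB] := cuB q Uq.
  apply: (@continuousB _ _ _ u (fun q => e * B q)) => //.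
  by apply: (@continuousM _ _ (fun=> e) B) => //; exact: cst_continuous.
- by move=> q [Uq _]; have [hu hB] := huB q Uq; apply: harmB => //; exact: harmZ.
- move=> q nVq e' e'0; have [Uq|nUq] := pselect (U q); last first.
    near=> z => -[Uz _]; rewrite lerBlDl; move: Uz; near: z; exact: bd.
  have big : M <= `|q.1| \/ M <= `|q.2|.
    apply: contrapT => /not_orP [/negP + /negP]; rewrite -!ltNge => q1 q2.
    by apply: nVq; split=> //; split; rewrite /= in_itv/= -ltr_norml.
  have NM : N + 1 <= M.
    by rewrite (@le_trans _ _ (`|N| + 1)) ?lerD2r ?ler_norm // /M le_max lexx.
  apply/nbhs_pairP; exists 1 => // x y x1 y1 [Uz _].
  rewrite (@le_trans _ _ 0) ?(ltW e'0) // subr_le0; apply: inf => //=.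
  have t1 := ler_normD (q.1 - x) x; have t2 := ler_normD (q.2 - y) y.
  move: t1 t2; rewrite !subrK distrC (distrC _ y) => t1 t2.
  by case: big => big; [left|right]; lra.
- split=> //; have m1 : `|p.1| < M /\ `|p.2| < M.
    have h : Num.max `|p.1| `|p.2| < M by rewrite /M lt_max ltrDl ltr01 orbT.
    by move: h; rewrite gt_max => /andP.
  by split; rewrite /= in_itv/= -ltr_norml; case: m1.
Unshelve. all: by end_near.
Qed.

End MaximumPrinciple.

(** * Interior and boundary gradient estimates *)

Section GradientEstimates.
Context {R : realType}.
Implicit Types (u v : R * R -> R) (p q : R * R).

Lemma near_le_cont u q (k e : R) : {for q, continuous u} -> u q <= k -> 0 < e ->
  \forall p \near q, u p <= k + e.
Proof.
move=> /continuous_pairP cu uq e0; apply/nbhs_pairP.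
have [d d0 H] := cu _ e0; exists d => // x y xd yd.
by have := H _ _ xd yd; rewrite ltr_norml => /andP[]; lra.
Qed.

Lemma open_rect (a b c d : R) : open [set p : R * R | a < p.1 < b /\ c < p.2 < d].
Proof.
rewrite (_ : [set p | _] = (fst @^-1` `]a, b[%classic) `&` (snd @^-1` `]c, d[%classic)).
  by apply: openI; apply: open_comp => //= q _; [exact: cvg_fst|exact: cvg_snd].
by apply/seteqP; split=> p /=; rewrite !in_itv.
Qed.

Lemma closed_rect (a b c d : R) :
  closed [set p : R * R | a <= p.1 <= b /\ c <= p.2 <= d].
Proof.
rewrite (_ : [set p | _] = (fst @^-1` `[a, b]%classic) `&` (snd @^-1` `[c, d]%classic)).
  apply: closedI; apply: preimage_closed;
    [|exact: interval_closed| |exact: interval_closed].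
    by apply: in1W => q; exact: cvg_fst.
  by apply: in1W => q; exact: cvg_snd.
by apply/seteqP; split=> p /=; rewrite !in_itv.
Qed.

Lemma max_principle_rect u (a b c d : R) :
  (forall p, a <= p.1 <= b -> c <= p.2 <= d -> {for p, continuous u}) ->
  (forall p, a < p.1 < b -> c < p.2 < d -> harm u p) ->
  (forall p, a <= p.1 <= b -> c <= p.2 <= d ->
    [\/ p.1 = a, p.1 = b, p.2 = c | p.2 = d] -> u p <= 0) ->
  forall p, a <= p.1 <= b -> c <= p.2 <= d -> u p <= 0.
Proof.
move=> cu hu bd p pab pcd.
pose U := [set p : R * R | a < p.1 < b /\ c < p.2 < d].
have UE q : a <= q.1 <= b -> c <= q.2 <= d -> ~ U q -> u q <= 0.
  move=> qab qcd nUq; apply: bd => //.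
  have [?|?] := eqVneq q.1 a; first by constructor 1.
  have [?|?] := eqVneq q.1 b; first by constructor 2.
  have [?|?] := eqVneq q.2 c; first by constructor 3.
  have [?|?] := eqVneq q.2 d; first by constructor 4.
  exfalso; apply: nUq; split; rewrite !lt_neqAle; apply/andP; split;
    apply/andP; split; by [rewrite // eq_sym|case/andP: qab|case/andP: qcd].
have [Up|nUp] := pselect (U p); last exact: UE.
apply: (@max_principle _ U u (`|a| + `|b| + (`|c| + `|d|))) Up.
- exact: open_rect.
- move=> q [/andP[? ?] /andP[? ?]].
  have := ler_norm b; have := ler_norm d; have := ler_norm (- a); have := ler_norm (- c).
  have := normr_ge0 a; have := normr_ge0 b; have := normr_ge0 c; have := normr_ge0 d.
  by rewrite !normrN => *; split; rewrite ler_norml; apply/andP; split; lra.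
- by move=> q [? ?]; apply: cu; lra.
- by move=> q [? ?]; apply: hu.
- move=> q nUq e e0.
  have [[qab qcd]|qout] := pselect (a <= q.1 <= b /\ c <= q.2 <= d).
    have := near_le_cont (cu q qab qcd) (UE q qab qcd nUq) e0.
    by rewrite add0r; apply: filterS.
  have := @closed_rect a b c d; rewrite -openC => oC.
  have := open_nbhs_nbhs (conj oC qout); apply: filterS => z + [z1 z2].
  by case; split; lra.
Qed.

Lemma continuous_quadratic (k x0 r : R) : continuous (fun p : R * R =>
  k * ((p.1 - x0) ^+ 2 + (r * p.2 *+ 2 - p.2 ^+ 2))).
Proof.
move=> p; rewrite /continuous_at; under [X in X @ _ --> _]eq_fun do rewrite !expr2.
apply: cvgM; first exact: cvg_cst.
apply: cvgD.
  by apply: cvgM; (apply: cvgB; [exact: cvg_fst|exact: cvg_cst]).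
apply: cvgB; last by apply: cvgM; exact: cvg_snd.
by apply: cvgMn; apply: cvgM; [exact: cvg_cst|exact: cvg_snd].
Qed.

(** The comparison function [M / r ^+ 2 * ((x - x0) ^+ 2 + 2 r y - y ^+ 2)] is harmonic, nonnegative
    on the base, at least [M] on the other three sides of the rectangle, and at most [2 M y / r] on
    the vertical line through [x0]. *)
Lemma boundary_linear_bound u (x0 r M : R) : 0 < r ->
  (forall p, `|p.1 - x0| <= r -> 0 <= p.2 <= r -> {for p, continuous u}) ->
  (forall p, `|p.1 - x0| <= r -> 0 < p.2 <= r -> harm u p) ->
  (forall x, `|x - x0| <= r -> u (x, 0) = 0) ->
  (forall p, `|p.1 - x0| <= r -> 0 <= p.2 <= r -> `|u p| <= M) ->
  forall y, 0 <= y <= r -> `|u (x0, y)| <= M *+ 2 / r * y.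
Proof.
move=> r0 cu hu u0 uM.
have M0 : 0 <= M.
  by apply: le_trans (uM (x0, 0) _ _); rewrite //= ?subrr ?normr0 ?lexx ?ltW.
have rangeE x : x0 - r <= x <= x0 + r -> `|x - x0| <= r.
  by move=> ?; rewrite ler_norml; lra.
pose b p : R := (M / r ^+ 2) * ((p.1 - x0) ^+ 2 + (r * p.2 *+ 2 - p.2 ^+ 2)).
have k0 : 0 <= M / r ^+ 2 by rewrite divr_ge0 ?sqr_ge0.
have kM : M / r ^+ 2 * r ^+ 2 = M by rewrite divfK // expf_neq0 // gt_eqF.
have cb : continuous b by exact: continuous_quadratic.
have hb p : harm b p.
  exists (M / r ^+ 2 *+ 2); split.
    have := sym2_deriveD (sym2_derive_sqr (p.1 - x0) (M / r ^+ 2))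
      (sym2_derive_affine (M / r ^+ 2 * (r * p.2 *+ 2 - p.2 ^+ 2)) 0).
    rewrite addr0; apply: eq_sym2_derive; exists 1 => // s _.
    by rewrite /b /=; ring.
  have := sym2_deriveD (sym2_derive_sqr p.2 (- (M / r ^+ 2)))
    (sym2_derive_affine (M / r ^+ 2 * ((p.1 - x0) ^+ 2 + r * p.2 *+ 2)) (M / r ^+ 2 * r *+ 2)).
  rewrite addr0 mulNrn; apply: eq_sym2_derive; exists 1 => // s _.
  by rewrite /b /=; ring.
have key v : (forall p, `|p.1 - x0| <= r -> 0 <= p.2 <= r -> {for p, continuous v}) ->
    (forall p, `|p.1 - x0| <= r -> 0 < p.2 <= r -> harm v p) ->
    (forall x, `|x - x0| <= r -> v (x, 0) = 0) ->
    (forall p, `|p.1 - x0| <= r -> 0 <= p.2 <= r -> v p <= M) ->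
    forall y, 0 <= y <= r -> v (x0, y) <= M *+ 2 / r * y.
  move=> cv hv v0 vM y yr; apply: (@le_trans _ _ (b (x0, y))); last first.
    rewrite /b /= subrr expr0n /= add0r.
    apply: (@le_trans _ _ (M / r ^+ 2 * (r * y *+ 2))).
      by rewrite ler_wpM2l // gerBl sqr_ge0.
    rewrite le_eqVlt; apply/orP; left; apply/eqP.
    by field; rewrite gt_eqF.
  rewrite -subr_le0; apply: (@max_principle_rect (fun p => v p - b p) (x0 - r) (x0 + r) 0 r) => //=.
  - by move=> p /rangeE p1 p2; apply: continuousB (cb p); exact: cv.
  - move=> p p1 p2; apply: harmB (hb p); apply: hv; last by lra.
    by apply: rangeE; lra.
  - move=> q q1 q2; have {}q1 := rangeE _ q1.
    have sq := sqr_ge0 (q.1 - x0); have vq := vM q q1 q2.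
    rewrite subr_le0 => -[q1r|q1r|q2r|q2r].
    + by apply: le_trans vq _; rewrite -{1}kM /b ler_wpM2l // q1r; nra.
    + by apply: le_trans vq _; rewrite -{1}kM /b ler_wpM2l // q1r; nra.
    + rewrite [q]surjective_pairing q2r v0 // /b /= mulr_ge0 //.
      by rewrite mulr0 mul0rn expr0n /= !subr0 addr0.
    + by apply: le_trans vq _; rewrite -{1}kM /b ler_wpM2l // q2r; nra.
  - by lra.
move=> y yr; rewrite ler_norml -lerNl; apply/andP; split.
  apply: (key (fun p => - u p)) yr.
  - by move=> p p1 p2; apply: continuousN; exact: cu.
  - by move=> p p1 p2; apply: harmN; exact: hu.
  - by move=> x /u0 ->; rewrite oppr0.
  - by move=> p p1 p2; rewrite (le_trans (ler_norm _)) // normrN uM.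
by apply: (key u) yr => // p p1 p2; rewrite (le_trans (ler_norm _)) // uM.
Qed.

(** The odd part [u (x0 + s, y) - u (x0 - s, y)] is harmonic, vanishes on the line [s = 0] and is
    bounded by [2 M], so [boundary_linear_bound] makes it at most [4 M s / r] at height [y0]; its
    derivative in [s] at 0 is [2 c]. The constant [k] cancels in the difference. *)
Lemma gradient_bound_x u (x0 y0 r M k c : R) : 0 < r ->
  (forall p, `|p.1 - x0| <= r -> `|p.2 - y0| <= r ->
    [/\ {for p, continuous u}, harm u p & `|u p - k| <= M]) ->
  is_derive x0 1 (fun x => u (x, y0)) c -> `|c| <= M *+ 2 / r.
Proof.
move=> r0 H uc.
pose w p := u (x0 + p.2, y0 + p.1) - u (x0 - p.2, y0 + p.1).
have W (p : R * R) : `|p.1 - 0| <= r -> 0 <= p.2 <= r ->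
    let q1 := (x0 + p.2, y0 + p.1) in let q2 := (x0 - p.2, y0 + p.1) in
    [/\ {for q1, continuous u}, harm u q1 & `|u q1 - k| <= M] /\
    [/\ {for q2, continuous u}, harm u q2 & `|u q2 - k| <= M].
  rewrite subr0 => p1 p2 q1 q2; split; apply: H; rewrite /= addrC addKr ?normrN //;
  by rewrite ger0_norm; lra.
have cw p : `|p.1 - 0| <= r -> 0 <= p.2 <= r -> {for p, continuous w}.
  move=> p1 p2; have [[c1 _ _] [c2 _ _]] := W p p1 p2.
  apply/continuous_pairP => e e0; have e20 : 0 < e / 2 by lra.
  move/continuous_pairP: c1 => /(_ _ e20) [d1 d10 c1].
  move/continuous_pairP: c2 => /(_ _ e20) [d2 d20 c2].
  exists (Num.min d1 d2); first by rewrite lt_min d10.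
  move=> x y; rewrite !lt_min => /andP[xd1 xd2] /andP[yd1 yd2].
  have := c1 (x0 + y) (y0 + x); have := c2 (x0 - y) (y0 + x).
  have -> : x0 + y - (x0 + p.2, y0 + p.1).1 = y - p.2 by rewrite /=; ring.
  have -> : y0 + x - (x0 + p.2, y0 + p.1).2 = x - p.1 by rewrite /=; ring.
  have -> : x0 - y - (x0 - p.2, y0 + p.1).1 = p.2 - y by rewrite /=; ring.
  rewrite (distrC p.2) => /(_ yd2 xd2) + /(_ yd1 xd1).
  by rewrite /w /= !ltr_norml => /andP[? ?] /andP[? ?]; apply/andP; split; lra.
have hw p : `|p.1 - 0| <= r -> 0 < p.2 <= r -> harm w p.
  move=> p1 p2; have p2' : 0 <= p.2 <= r by lra.
  have [[_ [a1 [a1x a1y]] _] [_ [a2 [a2x a2y]] _]] := W p p1 p2'.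
  have hB (f g : R -> R) a b : sym2_derive f a -> sym2_derive g b ->
      sym2_derive (fun s => f s - g s) (a - b).
    move=> fa /(sym2_deriveZ (- 1)); rewrite mulN1r => /(sym2_deriveD fa).
    by apply: eq_sym2_derive; exists 1 => // s _; rewrite mulN1r.
  exists (- a1 - - a2); split.
    have := hB _ _ _ _ a1y a2y; apply: eq_sym2_derive; exists 1 => // s _.
    by rewrite /w /= !addrA.
  have -> : - (- a1 - - a2) = a1 - a2 by ring.
  have := hB _ _ _ _ a1x (sym2_deriveN a2x).
  apply: eq_sym2_derive; exists 1 => // s _.
  by rewrite /w /= opprD !addrA.
have wB s : 0 <= s <= r -> `|w (0, s)| <= M *+ 2 *+ 2 / r * s.
  apply: (boundary_linear_bound r0 cw hw) => [x xr|p p1 p2].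
    by rewrite /w /= subr0 addr0 subrr.
  have [[_ _ b1] [_ _ b2]] := W p p1 p2.
  rewrite /w (le_trans _ (lerD b1 b2)) //.
  by rewrite (le_trans _ (ler_normB _ _)) // opprB addrA subrK.
have wd : is_derive (0 : R) 1 (fun s : R => w (0, s)) (c - - c).
  have uc0 : is_derive (x0 + 0) 1 (fun x => u (x, y0)) c by rewrite addr0.
  have uc1 : is_derive (x0 - 0) 1 (fun x => u (x, y0)) c by rewrite subr0.
  have := is_derive_fB (is_derive_shift uc0) (is_derive_reflect uc1).
  by rewrite /w /= addr0.
have : `|c - - c| <= M *+ 2 *+ 2 / r.
  apply: (derive_bound r0 wd) => s /andP[s0 sr].
  rewrite add0r {2}/w /= subr0 addr0 subrr subr0.
  by apply: wB; lra.
by rewrite opprK -mulr2n normrMn => h; lra.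
Qed.

Lemma gradient_bound_y u (x0 y0 r M k c : R) : 0 < r ->
  (forall p, `|p.1 - x0| <= r -> `|p.2 - y0| <= r ->
    [/\ {for p, continuous u}, harm u p & `|u p - k| <= M]) ->
  is_derive y0 1 (fun y => u (x0, y)) c -> `|c| <= M *+ 2 / r.
Proof.
move=> r0 H uc.
apply: (@gradient_bound_x (fun p => u (p.2, p.1)) y0 x0 r M k c) => // p p1 p2.
have [cu hu uM] := H (p.2, p.1) p2 p1; split=> //; last first.
  exact: harm_swap.
apply/continuous_pairP => e e0; move/continuous_pairP: cu => /(_ _ e0) [d d0 cu].
by exists d => // x y xd yd; exact: cu.
Qed.

(* Near a boundary segment on which u vanishes, u is O(y), so the interior
   estimate on a square of size y/2 stays bounded as y tends to 0. *)
Lemma gradient_bound_boundary u (x0 r M : R) : 0 < r ->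
  (forall p, `|p.1 - x0| <= r *+ 2 -> 0 <= p.2 <= r -> {for p, continuous u}) ->
  (forall p, `|p.1 - x0| <= r *+ 2 -> 0 < p.2 <= r -> harm u p) ->
  (forall x, `|x - x0| <= r *+ 2 -> u (x, 0) = 0) ->
  (forall p, `|p.1 - x0| <= r *+ 2 -> 0 <= p.2 <= r -> `|u p| <= M) ->
  forall x y, `|x - x0| <= r / 2 -> 0 < y <= r / 2 ->
  (forall c, is_derive x 1 (fun x => u (x, y)) c -> `|c| <= M *+ 12 / r) /\
  (forall c, is_derive y 1 (fun y => u (x, y)) c -> `|c| <= M *+ 12 / r).
Proof.
move=> r0 cu hu u0 uM x y xr yr.
have M0 : 0 <= M.
  by apply: le_trans (uM (x0, 0) _ _); rewrite //= ?subrr ?normr0; lra.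
have sub (a b k : R) : `|a - b| <= k <-> b - k <= a <= b + k.
  rewrite ler_norml; split=> /andP[? ?]; apply/andP; split; lra.
have lin x' y' : `|x' - x0| <= r -> 0 <= y' <= r -> `|u (x', y')| <= M *+ 2 / r * y'.
  move=> /sub x'r; apply: (boundary_linear_bound r0) => [p /sub p1|p /sub p1|z /sub p1|p /sub p1].
  - by apply: cu; apply/sub; lra.
  - by apply: hu; apply/sub; lra.
  - by apply: u0; apply/sub; lra.
  - by apply: uM; apply/sub; lra.
have y20 : 0 < y / 2 by lra.
have Q (p : R * R) : `|p.1 - x| <= y / 2 -> `|p.2 - y| <= y / 2 ->
    [/\ {for p, continuous u}, harm u p & `|u p - 0| <= M *+ 3 / r * y].
  move/sub : xr => xr; move=> /sub p1 /sub p2; split.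
  - by apply: cu; [apply/sub; lra|lra].
  - by apply: hu; [apply/sub; lra|lra].
  rewrite subr0 [p]surjective_pairing (le_trans (lin _ _ _ _)) //; [apply/sub; lra|lra|].
  have k0 : 0 <= M / r by rewrite divr_ge0 // ltW.
  have : M / r * (p.2 *+ 2) <= M / r * (y *+ 3) by rewrite ler_wpM2l //; lra.
  by move=> h; lra.
(* On the square of half-side [y / 2] the height is at most [3 y / 2], so the linear bound gives
   [|u| <= 3 M y / r]; the interior estimate multiplies this by [2 / (y / 2)]. *)
have E : M *+ 3 / r * y *+ 2 / (y / 2) = M *+ 12 / r.
  by field; rewrite !gt_eqF //; lra.
split=> c uc; rewrite -E; [exact: gradient_bound_x y20 Q uc|exact: gradient_bound_y y20 Q uc].
Qed.

End GradientEstimates.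

(** * Limits and derivatives in [R[i]] through real and imaginary parts *)

Section ComplexPlane.
Context {R : realType}.
Local Notation C := R[i].
Implicit Types (z : C) (x y : R).

Lemma Re_norm_lt z (e : R) : `|z| < e%:C -> `|complex.Re z| < e /\ `|complex.Im z| < e.
Proof.
case: z => x y /=; rewrite ltcE /= => /andP[_ ze].
by split; apply: le_lt_trans ze; rewrite -sqrtr_sqr ler_wsqrtr // ?lerDl ?lerDr sqr_ge0.
Qed.

Lemma norm_lt_Re z (e : R) : 0 < e ->
  `|complex.Re z| < e / 2 -> `|complex.Im z| < e / 2 -> `|z| < e%:C.
Proof.
case: z => x y /= e0 xe ye; rewrite ltcE /= eqxx /=.
rewrite -(gtr0_norm e0) -sqrtr_sqr ltr_sqrt ?exprn_gt0 //.
rewrite -(real_normK (num_real x)) -(real_normK (num_real y)).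
have := normr_ge0 x; have := normr_ge0 y; nra.
Qed.

Lemma dist_lt_Re z w (e : R) : 0 < e ->
  `|complex.Re z - complex.Re w| < e / 2 -> `|complex.Im z - complex.Im w| < e / 2 ->
  `|z - w| < e%:C.
Proof. by case: z w => [a b] [c d] /= e0 h1 h2; exact: norm_lt_Re. Qed.

Lemma complex_gt0P (e : C) : 0 < e -> exists2 d : R, 0 < d & e = d%:C.
Proof.
by case: e => a b; rewrite ltcE /= => /andP[/eqP -> a0]; exists a.
Qed.

Lemma nbhs_complexP x y (P : set C) : nbhs (x +i* y) P <-> exists2 d, 0 < d &
  forall x' y', `|x' - x| < d -> `|y' - y| < d -> P (x' +i* y').
Proof.
split=> [/nbhs_normP [e /= /complex_gt0P [d d0 ->] dP]|[d d0 dP]].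
  exists (d / 2); first by rewrite divr_gt0.
  move=> x' y' xd yd; apply: dP => /=; rewrite distrC.
  by apply: norm_lt_Re.
apply/nbhs_normP; exists d%:C; first by rewrite /= ltcR.
case=> x' y' /=; rewrite distrC => /Re_norm_lt [/= xd yd]; exact: dP.
Qed.

Lemma cvg_within_complex (H : set C) (G : C -> C) x (L : C) :
  (forall e, 0 < e -> exists2 d, 0 < d & forall x' y', `|x' - x| < d -> `|y'| < d ->
    H (x' +i* y') -> `|complex.Re (G (x' +i* y')) - complex.Re L| < e /\
                     `|complex.Im (G (x' +i* y')) - complex.Im L| < e) ->
  G z @[z --> within H (nbhs x%:C)] --> L.
Proof.
move=> HG; apply/cvgrPdist_lt => e /complex_gt0P [d d0 ->].
have [r r0 {}HG] := HG (d / 2) (divr_gt0 d0 (ltr0n R 2)).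
rewrite /prop_near1 /nbhs /= /within /=; apply/nbhs_complexP; exists r => // x' y' xr.
rewrite subr0 => yr Hz; have [h1 h2] := HG x' y' xr yr Hz.
rewrite distrC; exact: dist_lt_Re.
Qed.

Lemma cvg_complexP (T : Type) (F : set_system T) {FF : Filter F} (f : T -> C) (L : C) :
  f @ F --> L <-> forall e, 0 < e -> \forall t \near F,
    `|complex.Re (f t) - complex.Re L| < e /\ `|complex.Im (f t) - complex.Im L| < e.
Proof.
split=> [/cvgrPdist_lt H e e0|H].
  have : 0 < e%:C by rewrite ltcR.
  move/H; apply: filterS => t; rewrite distrC => /Re_norm_lt.
  by move: (f t) => [? ?]; case: {H} L => ? ?.
apply/cvgrPdist_lt => e /complex_gt0P [d d0 ->].
have := H (d / 2) (divr_gt0 d0 (ltr0n R 2)); apply: filterS => t [h1 h2].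
by rewrite distrC; exact: dist_lt_Re.
Qed.

Lemma cauchy_riemann (G : C -> C) x y : derivable G (x +i* y) 1 -> exists a b : R,
  [/\ is_derive x 1 (fun t => complex.Re (G (t +i* y))) a,
      is_derive x 1 (fun t => complex.Im (G (t +i* y))) b,
      is_derive y 1 (fun t => complex.Re (G (x +i* t))) (- b) &
      is_derive y 1 (fun t => complex.Im (G (x +i* t))) a].
Proof.
move=> /cvg_ex [[a b] /= /cvgrPdist_lt H].
have {}H (e : R) : 0 < e -> exists2 d : R, 0 < d & forall h : C,
    `|h| < d%:C -> `|G (x +i* y + h) - G (x +i* y) - (a +i* b) * h| <= e%:C * `|h|.
  move=> e0; have : 0 < e%:C by rewrite ltcR.
  move/H => /nbhs_normP [r /= /complex_gt0P [d d0 ->] H2]; exists d => // h hd.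
  have [->|h0] := eqVneq h 0; first by rewrite addr0 subrr mulr0 subrr !normr0 mulr0.
  have := H2 h; rewrite /= sub0r normrN => /(_ hd h0).
  have -> : h *: (1 : C) = h by rewrite /GRing.scale /= mulr1.
  rewrite distrC (addrC h) => /ltW.
  rewrite -(@ler_pM2r _ `|h|) ?normr_gt0 // -normrM mulrBl.
  by rewrite /GRing.scale /= mulrAC mulVf // mul1r.
have normC (t : R) : `|t%:C| = `|t|%:C by rewrite normc_def /= expr0n addr0 sqrtr_sqr.
have normi (t : R) : `|0 +i* t| = `|t|%:C by rewrite normc_def /= expr0n add0r sqrtr_sqr.
have part (z w : C) : `|z| <= w -> `|complex.Re z| <= complex.Re w /\ `|complex.Im z| <= complex.Re w.
  case: z => p q; rewrite lecE /= => /andP[_ ze].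
  by split; apply: le_trans ze; rewrite -sqrtr_sqr ler_wsqrtr // ?lerDl ?lerDr sqr_ge0.
exists a, b; split; apply/is_deriveP => e e0; have [d d0 {}H] := H e e0; exists d => // t td.
- have := H t%:C; rewrite normC ltcR => /(_ td); rewrite -rmorphM => /part [/= + _].
  have -> : x +i* y + t%:C = (x + t) +i* y by apply/eqP; rewrite eq_complex /= addr0 !eqxx.
  by case: (G _) (G _) => ? ? [? ?] /=; rewrite mulr0 subr0.
- have := H t%:C; rewrite normC ltcR => /(_ td); rewrite -rmorphM => /part [/= _].
  have -> : x +i* y + t%:C = (x + t) +i* y by apply/eqP; rewrite eq_complex /= addr0 !eqxx.
  by case: (G _) (G _) => ? ? [? ?] /=; rewrite mulr0 add0r.
- have := H (0 +i* t); rewrite normi ltcR => /(_ td); rewrite -rmorphM => /part [/= + _].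
  have -> : x +i* y + (0 +i* t) = x +i* (y + t) by apply/eqP; rewrite eq_complex /= addr0 !eqxx.
  by case: (G _) (G _) => ? ? [? ?] /=; rewrite mulr0 sub0r mulNr.
- have := H (0 +i* t); rewrite normi ltcR => /(_ td); rewrite -rmorphM => /part [/= _].
  have -> : x +i* y + (0 +i* t) = x +i* (y + t) by apply/eqP; rewrite eq_complex /= addr0 !eqxx.
  by case: (G _) (G _) => ? ? [? ?] /=; rewrite mulr0 addr0.
Qed.

End ComplexPlane.

(** * Harmonic functions with partial derivatives *)

Section HarmonicFunctions.
Context {R : realType}.
Local Notation C := R[i].
Implicit Types (u v : R * R -> R) (p q : R * R).

Lemma derivable_pair1 u p : derivable u p (1, 0) ->
  is_derive p.1 1 (fun t => u (t, p.2)) ('D_(1, 0) u p).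
Proof.
have E : (fun h : R => h^-1 *: (u (h *: (1 : R) + p.1, p.2) - u (p.1, p.2))) =
    (fun h => h^-1 *: (u (h *: ((1, 0) : R * R) + p) - u p)).
  apply/funext => h; rewrite -surjective_pairing.
  by congr (_ *: (u _ - _)); case: p => a b; congr pair; rewrite /= scaler0 add0r.
by move=> du; split; rewrite /derivable /derive /= E.
Qed.

Lemma derivable_pair2 u p : derivable u p (0, 1) ->
  is_derive p.2 1 (fun t => u (p.1, t)) ('D_(0, 1) u p).
Proof.
have E : (fun h : R => h^-1 *: (u (p.1, h *: (1 : R) + p.2) - u (p.1, p.2))) =
    (fun h => h^-1 *: (u (h *: ((0, 1) : R * R) + p) - u p)).
  apply/funext => h; rewrite -surjective_pairing.
  by congr (_ *: (u _ - _)); case: p => a b; congr pair; rewrite /= scaler0 add0r.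
by move=> du; split; rewrite /derivable /derive /= E.
Qed.

Lemma dist_le_halves (a b c e : R) : `|c - a| < e / 2 -> `|c - b| < e / 2 -> `|b - a| <= e.
Proof.
rewrite !ltr_norml ler_norml => /andP[? ?] /andP[? ?].
by apply/andP; split; lra.
Qed.

(** The second difference of [u] over a small square of side [s] with corner [p], evaluated by the
    mean value theorem in both orders, is [s ^+ 2] times a nearby value of either mixed derivative.
    The definition of [harmonic_on] gives both as continuous functions without identifying them. *)
Lemma schwarz u (ux uy uxy uyx : R * R -> R) p :
  nbhs p [set q : R * R |
    [/\ is_derive q.1 1 (fun t => u (t, q.2)) (ux q),
        is_derive q.2 1 (fun t => u (q.1, t)) (uy q),
        is_derive q.2 1 (fun t => ux (q.1, t)) (uxy q) &
        is_derive q.1 1 (fun t => uy (t, q.2)) (uyx q)]] ->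
  {for p, continuous uxy} -> {for p, continuous uyx} -> uxy p = uyx p.
Proof.
case: p => x y /nbhs_pairP [/= d d0 H] /continuous_pairP cxy /continuous_pairP cyx.
apply/eqP; rewrite -subr_eq0 -normr_le0; apply/ler_addgt0Pr => e e0; rewrite add0r.
have e20 : 0 < e / 2 by lra.
have [d1 d10 {}cxy] := cxy _ e20; have [d2 d20 {}cyx] := cyx _ e20.
pose m := Num.min d (Num.min d1 d2); pose s := m / 2.
have m0 : 0 < m by rewrite !lt_min d0 d10.
have [s0 sm] : 0 < s /\ s < m by split; rewrite /s; lra.
have sd r a : a <= r <= a + s -> [/\ `|r - a| < d, `|r - a| < d1 & `|r - a| < d2].
  have : s < m by [].
  rewrite !lt_min => /and3P[? ? ?] ?.
  by rewrite ger0_norm; [split|]; lra.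
have H' a b : x <= a <= x + s -> y <= b <= y + s ->
    [/\ is_derive a 1 (fun t => u (t, b)) (ux (a, b)),
        is_derive b 1 (fun t => u (a, t)) (uy (a, b)),
        is_derive b 1 (fun t => ux (a, t)) (uxy (a, b)) &
        is_derive a 1 (fun t => uy (t, b)) (uyx (a, b))].
  by move=> /sd[? _ _] /sd[? _ _]; exact: (H a b).
have xs : x <= x + s by lra. have ys : y <= y + s by lra.
have x0 : x <= x <= x + s by lra. have x1 : x <= x + s <= x + s by lra.
have y0 : y <= y <= y + s by lra. have y1 : y <= y + s <= y + s by lra.
pose D := u (x + s, y + s) - u (x + s, y) - (u (x, y + s) - u (x, y)).
have [a axs [b bys Dxy]] : exists2 a, x <= a <= x + s &
    exists2 b, y <= b <= y + s & D = uxy (a, b) * s ^+ 2.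
  have [a axs E] := @mean_value _ (fun t => u (t, y + s) - u (t, y))
    (fun t => ux (t, y + s) - ux (t, y)) _ _ xs (fun t tx =>
      is_derive_fB (let: And4 h _ _ _ := H' t (y + s) tx y1 in h)
                   (let: And4 h _ _ _ := H' t y tx y0 in h)).
  have [b bys E2] := @mean_value _ (fun t => ux (a, t)) (fun t => uxy (a, t)) _ _ ys
    (fun t ty => let: And4 _ _ h _ := H' a t axs ty in h).
  by exists a => //; exists b => //; rewrite /D E E2; ring.
have [a' axs' [b' bys' Dyx]] : exists2 a, x <= a <= x + s &
    exists2 b, y <= b <= y + s & D = uyx (a, b) * s ^+ 2.
  have [b' bys' E] := @mean_value _ (fun t => u (x + s, t) - u (x, t))
    (fun t => uy (x + s, t) - uy (x, t)) _ _ ys (fun t ty =>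
      is_derive_fB (let: And4 _ h _ _ := H' (x + s) t x1 ty in h)
                   (let: And4 _ h _ _ := H' x t x0 ty in h)).
  have [a' axs' E2] := @mean_value _ (fun t => uy (t, b')) (fun t => uyx (t, b')) _ _ xs
    (fun t tx => let: And4 _ _ _ h := H' t b' tx bys' in h).
  exists a' => //; exists b' => //.
  have -> : D = u (x + s, y + s) - u (x, y + s) - (u (x + s, y) - u (x, y)).
    by rewrite /D; ring.
  by rewrite E E2; ring.
have E : uxy (a, b) = uyx (a', b').
  by apply: (mulIf (_ : s ^+ 2 != 0)); rewrite -?Dxy -?Dyx // expf_neq0 // gt_eqF.
have [_ h1 _] := sd _ _ axs; have [_ h2 _] := sd _ _ bys.
have [_ _ h3] := sd _ _ axs'; have [_ _ h4] := sd _ _ bys'.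
have := cxy _ _ h1 h2; have := cyx _ _ h3 h4; rewrite E.
exact: dist_le_halves.
Qed.

(* [ux], [uy] are the partial derivatives of a twice differentiable harmonic u,
   whose Hessian is (uxx, uxy; uxy, - uxx). *)
Definition smooth_harmonic (D : set (R * R)) u (ux uy : R * R -> R) :=
  exists uxx uxy, forall p, D p ->
    [/\ [/\ is_derive p.1 1 (fun t => u (t, p.2)) (ux p),
            is_derive p.2 1 (fun t => u (p.1, t)) (uy p),
            {for p, continuous ux} & {for p, continuous uy}],
        is_derive p.1 1 (fun t => ux (t, p.2)) (uxx p),
        is_derive p.2 1 (fun t => ux (p.1, t)) (uxy p),
        is_derive p.1 1 (fun t => uy (t, p.2)) (uxy p) &
        is_derive p.2 1 (fun t => uy (p.1, t)) (- uxx p)].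

Lemma harmonic_on_smooth (U : set C) (g : C -> R) :
  open [set p : R * R | U (p.1 +i* p.2)] -> harmonic_on U g ->
  exists ux uy, smooth_harmonic [set p : R * R | U (p.1 +i* p.2)]
    (fun p => g (p.1 +i* p.2)) ux uy.
Proof.
set D := [set p : R * R | _]; set v := (fun p : R * R => _) => oD [H0 H1 H2 H3].
exists ('D_(1, 0) v), ('D_(0, 1) v).
exists ('D_(1, 0) ('D_(1, 0) v)), ('D_(0, 1) ('D_(1, 0) v)) => p Dp.
have [d1 d2 c1 c2] := H0 p Dp.
have [d11 d12 _ c12] := H1 p Dp; have [d21 d22 c21 _] := H2 p Dp.
have E : 'D_(0, 1) ('D_(1, 0) v) p = 'D_(1, 0) ('D_(0, 1) v) p.
  apply: (@schwarz v ('D_(1, 0) v) ('D_(0, 1) v) ('D_(0, 1) ('D_(1, 0) v))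
    ('D_(1, 0) ('D_(0, 1) v)) p _ c12 c21).
  have : \forall q \near p, D q by exact: open_nbhs_nbhs.
  apply: filterS => q Dq; have [e1 e2 _ _] := H0 q Dq.
  have [_ e12 _ _] := H1 q Dq; have [e21 _ _ _] := H2 q Dq.
  split; [exact: derivable_pair1 e1|exact: derivable_pair2 e2
         |exact: derivable_pair2 e12|exact: derivable_pair1 e21].
split; first by split; [exact: derivable_pair1 d1|exact: derivable_pair2 d2|exact: c1|exact: c2].
- exact: derivable_pair1 d11.
- exact: derivable_pair2 d12.
- by rewrite E; exact: derivable_pair1 d21.
- have -> : - 'D_(1, 0) ('D_(1, 0) v) p = 'D_(0, 1) ('D_(0, 1) v) p.
    by apply/eqP; rewrite eq_sym -addr_eq0 addrC H3.
  exact: derivable_pair2 d22.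
Qed.

Lemma smooth_harmonic_harm (D : set (R * R)) u ux uy : open D ->
  smooth_harmonic D u ux uy -> forall p, D p -> harm u p.
Proof.
move=> oD [uxx [uxy H]] p Dp; exists (uxx p).
have /nbhs_pairP [d d0 dD] : \forall q \near p, D q by exact: open_nbhs_nbhs.
have [_ d1 _ _ d2] := H p Dp; split.
  apply: (@sym2_derive_derive2 _ (fun t => u (t, p.2)) (fun t => ux (t, p.2)) _ d) => // s sd.
  have Dq : D (s, p.2) by apply: dD; rewrite ?subrr ?normr0.
  by have [[]] := H _ Dq.
apply: (@sym2_derive_derive2 _ (fun t => u (p.1, t)) (fun t => uy (p.1, t)) _ d) => // s sd.
have Dq : D (p.1, s) by apply: dD; rewrite ?subrr ?normr0.
by have [[]] := H _ Dq.
Qed.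

(** The gradient of [h] is [(- uy, ux)], so its Hessian is [(- uxy, uxx; uxx, uxy)]: symmetric and
    trace free because that of [u] is. *)
Lemma conjugate_harm (D : set (R * R)) u ux uy h : open D ->
  smooth_harmonic D u ux uy ->
  (forall p, D p -> is_derive p.1 1 (fun t => h (t, p.2)) (- uy p) /\
                    is_derive p.2 1 (fun t => h (p.1, t)) (ux p)) ->
  forall p, D p -> harm h p.
Proof.
move=> oD [uxx [uxy H]] hd; apply: (@smooth_harmonic_harm D h (fun p => - uy p) ux) => //.
exists (fun p => - uxy p), uxx => p Dp; have [h1 h2] := hd p Dp.
have [[_ _ c1 c2] d1 d2 d3 d4] := H p Dp.
split; last by rewrite opprK.
- by split => //; exact: continuousN.
- exact: is_deriveN.
- by rewrite -(opprK (uxx p)); exact: is_deriveN.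
- exact: d1.
Qed.

Lemma continuous_of_bounded_partials u (ux uy : R * R -> R) p (K d : R) : 0 < d ->
  (forall q, `|q.1 - p.1| < d -> `|q.2 - p.2| < d ->
     [/\ is_derive q.1 1 (fun t => u (t, q.2)) (ux q),
         is_derive q.2 1 (fun t => u (q.1, t)) (uy q),
         `|ux q| <= K & `|uy q| <= K]) ->
  {for p, continuous u}.
Proof.
move=> d0 H; apply/continuous_pairP => e e0.
have K0 : 0 <= K.
  by have [||_ _ + _] := H p; rewrite ?subrr ?normr0 //; exact: le_trans.
have K1 : 0 < K *+ 2 + 1 by lra.
exists (Num.min d (e / (K *+ 2 + 1))); first by rewrite lt_min d0 divr_gt0.
move=> x y; rewrite !lt_min => /andP[xd xe] /andP[yd ye].
have b1 : `|u (x, y) - u (p.1, y)| <= K * `|x - p.1|.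
  apply: (@mean_value_bound _ (fun t => u (t, y)) (fun t => ux (t, y))) => t tx;
    have td : `|t - p.1| < d by move: xd; rewrite !ltr_norml => /andP[? ?]; apply/andP; split; lra.
    by have [] := H (t, y) td yd.
  by have [] := H (t, y) td yd.
have b2 : `|u (p.1, y) - u (p.1, p.2)| <= K * `|y - p.2|.
  have pd : `|p.1 - p.1| < d by rewrite subrr normr0.
  apply: (@mean_value_bound _ (fun t => u (p.1, t)) (fun t => uy (p.1, t))) => t tx;
    have td : `|t - p.2| < d by move: yd; rewrite !ltr_norml => /andP[? ?]; apply/andP; split; lra.
    by have [] := H (p.1, t) pd td.
  by have [] := H (p.1, t) pd td.
rewrite [X in _ - u X]surjective_pairing.
have := ler_normD (u (x, y) - u (p.1, y)) (u (p.1, y) - u (p.1, p.2)).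
rewrite addrA subrK => b3.
have : (K *+ 2 + 1) * (e / (K *+ 2 + 1)) = e by rewrite mulrC divfK // gt_eqF.
set k := e / _ in xe ye *; move=> ke.
have k0 : 0 < k by rewrite divr_gt0.
have : K * `|x - p.1| <= K * k by rewrite ler_wpM2l // ltW.
have : K * `|y - p.2| <= K * k by rewrite ler_wpM2l // ltW.
by lra.
Qed.

End HarmonicFunctions.

(** * The Green function in the plane *)

Section GreenFunction.
Context {R : realType}.
Implicit Types (u : R * R -> R) (p q : R * R) (E : set R).

Definition slit E : set (R * R) := [set p | p.2 = 0 /\ E p.1].

(** Harmonicity is asked only in the pointwise sense [harm], so that the notion passes to the
    reflected function at once. *)
Definition green_fun E u := [/\ continuous u,
  forall p, ~ slit E p -> harm u p,
  forall p, slit E p -> u p = 0 &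
  exists M r : R, forall p, r < Num.sqrt (sqnorm p) ->
    `|u p - ln (Num.sqrt (sqnorm p))| <= M].

Lemma closed_slit E : closed E -> closed (slit E).
Proof.
move=> cE; rewrite (_ : slit E = (snd @^-1` [set 0]) `&` (fst @^-1` E)) //.
apply: closedI; apply: preimage_closed => //.
- by apply: in1W => q; exact: cvg_snd.
- by apply: in1W => q; exact: cvg_fst.
Qed.

Lemma is_derive_unique (f : R -> R) (t a b : R) :
  is_derive t 1 f a -> is_derive t 1 f b -> a = b.
Proof. by move=> [_ <-] [_ <-]. Qed.

Lemma sqrt_sqnorm_ge p (N : R) : N < `|p.1| \/ N < `|p.2| -> N < Num.sqrt (sqnorm p).
Proof.
rewrite /sqnorm => -[|] /lt_le_trans; apply; rewrite -sqrtr_sqr ler_wsqrtr //.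
  by rewrite lerDl sqr_ge0.
by rewrite lerDr sqr_ge0.
Qed.

Lemma green_fun_infty E u (K : R) : green_fun E u ->
  exists N, forall p, N < `|p.1| \/ N < `|p.2| -> K <= u p.
Proof.
move=> [_ _ _ [M [r H]]]; exists (Num.max r (expR (K + M))) => p /sqrt_sqnorm_ge.
rewrite gt_max => /andP[/H + Ke]; rewrite ler_norml => /andP[+ _].
have : K + M <= ln (Num.sqrt (sqnorm p)).
  by rewrite -[leLHS]expRK ler_ln ?posrE ?expR_gt0 ?(ltW Ke) // (lt_trans _ Ke) ?expR_gt0.
lra.
Qed.

Lemma green_fun_flip E u : green_fun E u -> green_fun E (fun p => u (p.1, - p.2)).
Proof.
move=> [cu hu u0 [M [r uM]]]; split.
- move=> p; apply/continuous_pairP => e e0.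
  have /continuous_pairP /(_ _ e0) [d d0 H] := cu (p.1, - p.2).
  exists d => // x y xd yd; apply: H => //=.
  by rewrite (_ : _ - _ = - (y - p.2)) ?normrN //; ring.
- move=> p nsp; have /hu [c [c1 c2]] : ~ slit E (p.1, - p.2).
    by move=> [/= p2 Ep]; apply: nsp; split=> //; apply/eqP; rewrite -oppr_eq0 p2.
  exists c; split => //; apply: eq_sym2_derive (sym2_deriveN c2).
  by exists 1 => //= s _; rewrite opprD.
- by move=> p [p2 Ep]; apply: u0; split=> //=; rewrite p2 oppr0.
- by exists M, r => p; have := uM (p.1, - p.2); rewrite /sqnorm /= sqrrN.
Qed.

Context (E : set R) (u : R * R -> R).
Hypotheses (cE : closed E) (gu : green_fun E u).

Lemma green_fun_ge0 p : 0 <= u p.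
Proof.
have [cu hu u0 _] := gu; have [/u0 -> //|nsp] := pselect (slit E p).
(* The zero barrier suffices: [u] tends to infinity at infinity, so [- u] is already negative
   there. *)
rewrite -oppr_le0; apply: (@max_principle_barrier _ (~` slit E) (fun p => - u p) (fun=> 0)) nsp.
- by rewrite openC; exact: closed_slit.
- by move=> q _; split; [apply: continuousN; exact: cu|exact: cst_continuous].
- by move=> q nsq; split; [apply: harmN; exact: hu|exact: harm_cst].
- move=> e e0; have [N uN] := green_fun_infty 0 gu.
  by exists N => q _ /uN; rewrite mulr0 oppr_le0.
- move=> q /contrapT /u0 uq e e' e0 e'0.
  have cq : {for q, continuous (fun p => - u p)} by apply: continuousN; exact: cu.
  have q0 : - u q <= 0 by rewrite uq oppr0.
  by have := near_le_cont cq q0 e'0; rewrite mulr0; apply: filterS.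
Qed.

(* Moving planes. *)
Lemma green_fun_reflect (l : R) p : 0 <= l -> p.2 < l -> u p <= u (p.1, l *+ 2 - p.2).
Proof.
move=> l0 pl; have [cu hu u0 [M [r uM]]] := gu.
have [/u0 ->|nsp] := pselect (slit E p); first exact: green_fun_ge0.
pose v p := u (p.1, l *+ 2 - p.2).
have cv : continuous v.
  move=> q; apply/continuous_pairP => e e0.
  have /continuous_pairP /(_ _ e0) [d d0 H] := cu (q.1, l *+ 2 - q.2).
  exists d => // x y xd yd; apply: H => //=.
  by rewrite distrC (_ : _ - _ = y - q.2) //; ring.
have cd q : {for q, continuous (fun p => u p - v p)}.
  by apply: continuousB; [exact: cu|exact: cv].
(* The barrier is [u] itself. At infinity [u - v] is at most [2 M], since a point below the line is
   no farther from 0 than its mirror image, while [u] tends to infinity. On the slit [u = 0 <= v],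
   and on the line [u = v]. The mirror image of the domain lies above the real axis, where [u] is
   harmonic. *)
rewrite -subr_le0; apply: (@max_principle_barrier _ ([set p | p.2 < l] `&` ~` slit E) (fun p => u p - v p) u).
- apply: openI; last by rewrite openC; exact: closed_slit.
  rewrite (_ : [set p | _] = snd @^-1` `]-oo, l[%classic); last first.
    by apply/seteqP; split=> q /=; rewrite in_itv.
  by apply: open_comp => // q _; exact: cvg_snd.
- by move=> q _; split; [exact: cd|exact: cu].
- move=> q [/= ql nsq]; split; last exact: hu.
  apply: harmB; first exact: hu.
  have /hu [c [c1 c2]] : ~ slit E (q.1, l *+ 2 - q.2) by move=> [/= q2 _]; lra.
  exists c; split => //; apply: eq_sym2_derive (sym2_deriveN c2).
  by exists 1 => //= s _; rewrite /v /= opprD addrA.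
- move=> e e0; have [N uN] := green_fun_infty (M *+ 2 / e) gu.
  exists (Num.max N (Num.max r 0)) => q [/= ql _] H.
  have HN : N < `|q.1| \/ N < `|q.2|.
    by case: H; rewrite gt_max => /andP[? _]; [left|right].
  apply: (@le_trans _ _ (M *+ 2)); last first.
    by rewrite -ler_pdivrMl // mulrC; exact: uN.
  have /sqrt_sqnorm_ge : Num.max r 0 < `|q.1| \/ Num.max r 0 < `|q.2|.
    by case: H; rewrite gt_max => /andP[_ ?]; [left|right].
  rewrite gt_max => /andP[rq q0].
  have qq : Num.sqrt (sqnorm q) <= Num.sqrt (sqnorm (q.1, l *+ 2 - q.2)).
    by rewrite ler_wsqrtr // /sqnorm /= lerD2l; nra.
  have := uM _ rq; have := uM _ (lt_le_trans rq qq).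
  have : ln (Num.sqrt (sqnorm q)) <= ln (Num.sqrt (sqnorm (q.1, l *+ 2 - q.2))).
    by rewrite ler_ln // posrE (lt_le_trans q0).
  rewrite /v !ler_norml => ? /andP[? _] /andP[_ ?]; lra.
- move=> q nUq e e' e0 e'0.
  have [ql|ql] := ltP l q.2.
    apply/nbhs_pairP; exists (q.2 - l); first by rewrite subr_gt0.
    by move=> x y _; rewrite ltr_norml => /andP[? _] [/=]; lra.
  have dq : u q - v q <= 0.
    have [qe|qne] := eqVneq q.2 l.
      by rewrite /v [q]surjective_pairing qe /= mulr2n addrK subrr.
    have /u0 -> : slit E q.
      by apply: contrapT => nsq; apply: nUq; split=> //=; rewrite lt_neqAle qne.
    by rewrite sub0r oppr_le0; exact: green_fun_ge0.
  have := near_le_cont (cd q) dq e'0; apply: filterS => z Hz _.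
  apply: le_trans Hz _; rewrite add0r lerDr mulr_ge0 ?(ltW e0) //.
  exact: green_fun_ge0.
- by split.
Qed.

End GreenFunction.

(** Moving planes at level [l = 0], for [u] and for its flip, give the two opposite inequalities. *)
Lemma green_fun_symm {R : realType} (E : set R) (u : R * R -> R) p :
  closed E -> green_fun E u -> u (p.1, - p.2) = u p.
Proof.
move=> cE.
have key v q : green_fun E v -> q.2 < 0 -> v q = v (q.1, - q.2).
  move=> gv q0; apply/eqP; rewrite eq_le; apply/andP; split.
    by have := green_fun_reflect cE gv (lexx 0) q0; rewrite mul0rn sub0r.
  have := green_fun_reflect cE (green_fun_flip gv) (lexx 0) q0.
  by rewrite /= mul0rn sub0r opprK -surjective_pairing.
move=> gu; have [p0|p0|p0] := ltgtP p.2 0.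
- by rewrite [RHS]key.
- by rewrite [LHS]key //= ?opprK -?surjective_pairing // oppr_lt0.
- by rewrite p0 oppr0 -p0 -surjective_pairing.
Qed.

(** * Boundary values of the conjugate function *)

Section RightLimits.
Context {R : realType}.

Lemma half_between (d : R) : 0 < d -> 0 < d / 2 < d.
Proof. by lra. Qed.

Lemma right_cauchy_lim (f : R -> R) :
  (forall e, 0 < e -> exists2 d, 0 < d &
    forall y y', 0 < y < d -> 0 < y' < d -> `|f y - f y'| < e) ->
  exists c, forall e, 0 < e -> exists2 d, 0 < d & forall y, 0 < y < d -> `|f y - c| < e.
Proof.
move=> H; have : cvg (f y @[y --> 0^'+]).
  apply: cauchy_cvg; apply: cauchy_exP => e e0.
  have [d d0 {}H] := H e e0; exists (f (d / 2)).
  have d2 := half_between d0.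
  rewrite /nbhs /= /within /=; apply/nbhs_ballP; exists d => //= y.
  rewrite /ball /= sub0r normrN => yd y0; apply: H => //.
  by move: yd; rewrite gtr0_norm // y0.
move=> /cvg_ex [c /= fc]; exists c => e e0.
move/cvgrPdist_lt : fc => /(_ _ e0); rewrite /nbhs /= /within /= => /nbhs_ballP [d /= d0 fd].
exists d => // y /andP[y0 yd]; rewrite distrC; apply: fd => //.
by rewrite /ball /= sub0r normrN gtr0_norm.
Qed.

Lemma le_of_right_approx (a b : R) :
  (forall e, 0 < e -> exists2 d : R, 0 < d & forall y, 0 < y < d -> a <= b + e) -> a <= b.
Proof.
move=> H; apply/ler_addgt0Pr => e /H [d d0]; apply.
exact: half_between.
Qed.

End RightLimits.

Section ConjugateBoundary.
Context {R : realType}.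
Implicit Types (u : R * R -> R) (p q : R * R).

Definition boundary_lim (h : R * R -> R) x c := forall e, 0 < e ->
  exists2 d, 0 < d & forall x' y, `|x' - x| < d -> 0 < y < d -> `|h (x', y) - c| < e.

Lemma boundary_lim_unique h (x c c' : R) :
  boundary_lim h x c -> boundary_lim h x c' -> c = c'.
Proof.
move=> H H'; apply/eqP; rewrite -subr_eq0 -normr_le0.
apply/ler_addgt0Pr => e e0; rewrite add0r.
have e20 : 0 < e / 2 by lra.
have [d d0 {}H] := H _ e20; have [d' d'0 {}H'] := H' _ e20.
pose y := Num.min d d' / 2.
have m0 : 0 < Num.min d d' by rewrite lt_min d0.
have : y < Num.min d d' by rewrite /y; lra.
have y0 : 0 < y by rewrite divr_gt0.
rewrite lt_min => /andP[yd yd'].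
have := H x y; have := H' x y; rewrite subrr normr0 y0 yd yd' => /(_ d'0 isT) + /(_ d0 isT).
by rewrite -normrN opprB => + h1; apply: dist_le_halves; rewrite // opprB distrC.
Qed.

Definition conjugate_plus u (ux uy h : R * R -> R) := forall p, 0 < p.2 ->
  is_derive p.1 1 (fun t => h (t, p.2)) (- uy p) /\
  is_derive p.2 1 (fun t => h (p.1, t)) (ux p).

Context (u ux uy h : R * R -> R) (hd : conjugate_plus u ux uy h).

Lemma conj_horizontal (x x' y K : R) : 0 < y ->
  (forall t, x <= t <= x' \/ x' <= t <= x -> `|uy (t, y)| <= K) ->
  `|h (x', y) - h (x, y)| <= K * `|x' - x|.
Proof.
move=> y0 H; apply: (@mean_value_bound _ (fun t => h (t, y)) (fun t => - uy (t, y))) => t tx.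
  by have [] := hd (p := (t, y)) y0.
by rewrite normrN H.
Qed.

Lemma conj_vertical (x y y' K : R) : 0 < y -> 0 < y' ->
  (forall t, y <= t <= y' \/ y' <= t <= y -> `|ux (x, t)| <= K) ->
  `|h (x, y') - h (x, y)| <= K * `|y' - y|.
Proof.
move=> y0 y'0 H; apply: (@mean_value_bound _ (fun t => h (x, t)) (fun t => ux (x, t))) => t tx.
  have t0 : 0 < t by case: tx => /andP[? ?]; lra.
  by have [] := hd (p := (x, t)) t0.
exact: H.
Qed.

(** The criterion for [h] to extend to the boundary point [x]: it makes [h] Lipschitz in a box above
    [x]. It is verified off [E] and in the interior of [E]; the remaining points go into the
    exceptional list. *)
Definition bounded_gradient x := exists K d, 0 < d /\ forall p, `|p.1 - x| < d ->
  0 < p.2 < d -> `|ux p| <= K /\ `|uy p| <= K.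

Lemma bounded_gradient_lim x : bounded_gradient x -> exists c, boundary_lim h x c.
Proof.
move=> [K [d [d0 H]]].
have K0 : 0 <= K.
  have [||+ _] := H (x, d / 2); rewrite /= ?subrr ?normr0 //; last exact: le_trans.
  exact: half_between.
have lip x1 x2 y1 y2 : `|x1 - x| < d -> `|x2 - x| < d -> 0 < y1 < d -> 0 < y2 < d ->
    `|h (x2, y2) - h (x1, y1)| <= K * (`|x2 - x1| + `|y2 - y1|).
  move=> xd1 xd2 /andP[y10 y1d] /andP[y20 y2d].
  have b1 : `|h (x2, y1) - h (x1, y1)| <= K * `|x2 - x1|.
    apply: conj_horizontal => // t tx.
    have [] // := H (t, y1); rewrite ?y10 //=.
    by move: xd1 xd2; rewrite !ltr_norml => /andP[? ?] /andP[? ?]; apply/andP; split; lra.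
  have b2 : `|h (x2, y2) - h (x2, y1)| <= K * `|y2 - y1|.
    apply: conj_vertical => // t ty; have [] // := H (x2, t).
    by move=> /=; apply/andP; split; lra.
  rewrite (le_trans (ler_distD (h (x2, y1)) _ _)) // mulrDr addrC.
  exact: lerD.
have K1 : 0 < K *+ 2 + 1 by lra.
pose del e := Num.min d (e / (K *+ 2 + 1)).
have del0 e : 0 < e -> 0 < del e by move=> e0; rewrite lt_min d0 divr_gt0.
have delK e (a b : R) : 0 < e -> a < e / (K *+ 2 + 1) -> b < e / (K *+ 2 + 1) ->
    K * (a + b) < e.
  move=> e0 ae be; have : (K *+ 2 + 1) * (e / (K *+ 2 + 1)) = e.
    by rewrite mulrC divfK // gt_eqF.
  set k := e / _ in ae be *; move=> ke; have k0 : 0 < k by rewrite divr_gt0.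
  have : K * a <= K * k by rewrite ler_wpM2l // ltW.
  have : K * b <= K * k by rewrite ler_wpM2l // ltW.
  by lra.
have dist2 (y y' m : R) : 0 < y < m -> 0 < y' < m -> `|y - y'| < m.
  by move=> ? ?; rewrite ltr_norml; apply/andP; split; lra.
have [|c hc] := @right_cauchy_lim _ (fun y => h (x, y)).
  move=> e e0; exists (del e) => [|y y']; first exact: del0.
  rewrite !lt_min => /and3P[y0 yd ye] /and3P[y'0 y'd y'e].
  apply: le_lt_trans (lip x x y' y _ _ _ _) _; rewrite ?subrr ?normr0 ?y0 ?y'0 //.
  by apply: delK; rewrite ?divr_gt0 // dist2 // ?y0 ?y'0.
exists c => e e0; have e20 : 0 < e / 2 by lra.
have [d' d'0 {}hc] := hc _ e20; exists (Num.min d' (del (e / 2))).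
  by rewrite lt_min d'0 del0.
move=> x' y; rewrite !lt_min => /and3P[_ xd xe] /and4P[y0 yd' yd ye].
have l1 : `|h (x', y) - h (x, y)| < e / 2.
  apply: le_lt_trans (lip x x' y y _ _ _ _) _; rewrite ?subrr ?normr0 ?y0 ?yd //.
  by apply: delK; rewrite ?divr_gt0.
have l2 : `|h (x, y) - c| < e / 2 by apply: hc; rewrite y0.
by have := ler_distD (h (x, y)) (h (x', y)) c; lra.
Qed.

End ConjugateBoundary.

Section GreenConjugate.
Context {R : realType} (E : set R) (al be : R) (u ux uy h : R * R -> R).
Hypotheses (cE : closed E) (bE : forall x, E x -> al <= x <= be)
  (gu : green_fun E u) (su : smooth_harmonic (~` slit E) u ux uy)
  (hd : conjugate_plus u ux uy h)
  (hl : forall x, x < al -> boundary_lim h x 0).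
Implicit Types (x y : R) (p q : R * R).

Lemma upper_not_slit p : 0 < p.2 -> ~ slit E p.
Proof. by move=> p0 [p2 _]; rewrite p2 ltxx in p0. Qed.

Lemma off_not_slit p : ~ E p.1 -> ~ slit E p.
Proof. by move=> nE [_]. Qed.

Lemma partials p : ~ slit E p ->
  [/\ is_derive p.1 1 (fun t => u (t, p.2)) (ux p),
      is_derive p.2 1 (fun t => u (p.1, t)) (uy p),
      {for p, continuous ux} & {for p, continuous uy}].
Proof. by case: su => uxx [uxy H] /H []. Qed.

(** Moving planes in the horizontal line through [p] itself give
    [u (p.1, p.2 - s) <= u (p.1, p.2 + s)]. *)
Lemma uy_ge0 p : 0 < p.2 -> 0 <= uy p.
Proof.
move=> p0; have [_ d2 _ _] := partials (upper_not_slit p0).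
apply: (derive_ge0_symm ltr01 d2) => s /andP[s0 _].
have l0 : 0 <= p.2 by exact: ltW.
have ps : (p.1, p.2 - s).2 < p.2 by rewrite /=; lra.
have := green_fun_reflect cE gu l0 ps.
by rewrite /= mulr2n opprB addrA addrAC addrK addrC.
Qed.

Lemma conj_nonincreasing x x' y : 0 < y -> x <= x' -> h (x', y) <= h (x, y).
Proof.
move=> y0 xx'.
have [c _] := @mean_value _ (fun t => h (t, y)) (fun t => - uy (t, y)) _ _ xx'
  (fun t _ => (hd (p := (t, y)) y0).1).
have := uy_ge0 (p := (c, y)) y0 => c0 E0; rewrite -subr_le0 E0.
by rewrite mulNr oppr_le0 mulr_ge0 // subr_ge0.
Qed.

Lemma notin_nbhs x : ~ E x -> exists2 d, 0 < d & forall t, `|t - x| < d -> ~ E t.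
Proof.
move=> nEx; have := cE; rewrite -openC => oE.
have /nbhs_ballP [d /= d0 dE] := open_nbhs_nbhs (conj oE nEx : open_nbhs x (~` E)).
by exists d => // t td; apply: dE; rewrite /ball /= distrC.
Qed.

Lemma interior_nbhs x : interior E x -> exists2 d, 0 < d & forall t, `|t - x| < d -> E t.
Proof.
move=> /nbhs_ballP [d /= d0 dE].
by exists d => // t td; apply: dE; rewrite /ball /= distrC.
Qed.

Lemma bounded_gradient_off x : ~ E x -> bounded_gradient ux uy x.
Proof.
move=> nEx; have [_ _ cx cy] := partials (off_not_slit (nEx : ~ E (x, 0).1)).
move/continuous_pairP : cx => /(_ _ ltr01) [d1 d10 cx].
move/continuous_pairP : cy => /(_ _ ltr01) [d2 d20 cy].
exists (`|ux (x, 0)| + `|uy (x, 0)| + 1), (Num.min d1 d2); split; first by rewrite lt_min d10.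
move=> [x' y'] /=; rewrite !lt_min => /andP[xd1 xd2] /and3P[y0 yd1 yd2].
have ynorm d : y' < d -> `|y' - 0| < d by rewrite subr0 gtr0_norm.
have b1 := cx _ _ xd1 (ynorm _ yd1); have b2 := cy _ _ xd2 (ynorm _ yd2).
have := ler_normD (ux (x', y') - ux (x, 0)) (ux (x, 0)).
have := ler_normD (uy (x', y') - uy (x, 0)) (uy (x, 0)).
rewrite !subrK; have := normr_ge0 (ux (x, 0)); have := normr_ge0 (uy (x, 0)).
by move=> *; split; lra.
Qed.

Lemma interior_setup x : interior E x -> exists2 r, 0 < r &
  (forall t, `|t - x| <= r *+ 2 -> u (t, 0) = 0) /\
  (forall p, `|p.1 - x| <= r *+ 2 -> 0 <= p.2 <= r -> `|u p| <= 1).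
Proof.
move=> /interior_nbhs [d d0 dE]; have [cu _ u0 _] := gu.
have /continuous_pairP /(_ _ ltr01) [d' d'0 H] := cu (x, 0).
have m0 : 0 < Num.min d d' by rewrite lt_min d0.
have : Num.min d d' / 3 *+ 2 < Num.min d d' by lra.
have r0 : 0 < Num.min d d' / 3 by rewrite divr_gt0.
set r := _ / 3 in r0 * => rm; exists r => //.
have [rd rd'] : r *+ 2 < d /\ r *+ 2 < d' by move: rm; rewrite lt_min => /andP.
have ux0 : u (x, 0) = 0.
  by apply: u0; split=> //=; apply: dE; rewrite subrr normr0.
split=> [t tr|[a b] /= ar /andP[b0 br]].
  by apply: u0; split=> //=; apply: dE; exact: le_lt_trans rd.
rewrite -[u _]subr0 -ux0 ltW //; apply: H => /=; first exact: le_lt_trans rd'.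
by rewrite subr0 ger0_norm //; lra.
Qed.

Lemma interior_gradient x r : 0 < r ->
  (forall t, `|t - x| <= r *+ 2 -> u (t, 0) = 0) ->
  (forall p, `|p.1 - x| <= r *+ 2 -> 0 <= p.2 <= r -> `|u p| <= 1) ->
  forall p, `|p.1 - x| <= r / 2 -> 0 < p.2 <= r / 2 ->
  `|ux p| <= 12 / r /\ `|uy p| <= 12 / r.
Proof.
move=> r0 u0 u1 [a b] /= ar br; have [cu hu _ _] := gu.
have hu' p : `|p.1 - x| <= r *+ 2 -> 0 < p.2 <= r -> harm u p.
  by move=> _ /andP[/upper_not_slit /hu].
have [H1 H2] := gradient_bound_boundary r0 (fun p _ _ => cu p) hu' u0 u1 ar br.
have b0 : 0 < (a, b).2 by case/andP: br.
have [d1 d2 _ _] := partials (upper_not_slit b0).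
by split; [exact: H1|exact: H2].
Qed.

Lemma bounded_gradient_interior x : interior E x -> bounded_gradient ux uy x.
Proof.
move=> /interior_setup [r r0 [u0 u1]]; have r20 : 0 < r / 2 by rewrite divr_gt0.
exists (12 / r), (r / 2); split => // p p1 /andP[p2 p2'].
by apply: (interior_gradient r0 u0 u1); rewrite ?p2 ltW.
Qed.

Lemma uy_real_off x : ~ E x -> uy (x, 0) = 0.
Proof.
move=> nEx; have [_ d2 _ _] := partials (off_not_slit (nEx : ~ E (x, 0).1)).
have d2' : is_derive (0 - 0 : R) 1 (fun t : R => u (x, t)) (uy (x, 0)) by rewrite subr0.
have := is_derive_reflect d2'.
have -> : (fun s => u (x, 0 - s)) = (fun t => u (x, t)).
  by apply/funext => t; rewrite sub0r -(green_fun_symm (x, t) cE gu).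
by move=> /(is_derive_unique d2) /=; lra.
Qed.

(** The default 0 at points without a limit carries no meaning; statements about this function are
    made where a limit is known to exist. *)
Definition boundary_fun x : R := xget 0 [set c | boundary_lim h x c].
Local Notation hp := boundary_fun.
Local Notation good := (bounded_gradient ux uy).

Lemma boundary_funP x : good x -> boundary_lim h x (hp x).
Proof.
by move=> /(bounded_gradient_lim hd) [c hc]; apply: (@xgetPex _ 0 [set c | boundary_lim h x c]); exists c.
Qed.

Lemma boundary_fun_left x : x < al -> hp x = 0.
Proof.
move=> xl; apply: boundary_lim_unique (hl xl).
by apply: (@xgetPex _ 0 [set c | boundary_lim h x c]); exists 0; exact: hl.
Qed.

Lemma boundary_lim_le x x' c c' K d : 0 < d ->
  boundary_lim h x c -> boundary_lim h x' c' ->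
  (forall y, 0 < y < d -> h (x', y) <= h (x, y) + K) -> c' <= c + K.
Proof.
move=> d0 H H' hK; apply/ler_addgt0Pr => e e0; have e20 : 0 < e / 2 by lra.
have [d1 d10 {}H] := H _ e20; have [d2 d20 {}H'] := H' _ e20.
have m0 : 0 < Num.min d (Num.min d1 d2) by rewrite !lt_min d0 d10.
have /andP[y0] := half_between m0; set y := _ / 2 in y0 *.
rewrite !lt_min => /and3P[yd yd1 yd2].
have := hK y; have := H x y; have := H' x' y.
rewrite !subrr normr0 y0 yd yd1 yd2 => /(_ d20 isT) + /(_ d10 isT) + /(_ isT).
by rewrite !ltr_norml => /andP[? ?] /andP[? ?] ?; lra.
Qed.

Lemma boundary_lim_dist x x' c c' K d : 0 < d ->
  boundary_lim h x c -> boundary_lim h x' c' ->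
  (forall y, 0 < y < d -> `|h (x', y) - h (x, y)| <= K) -> `|c' - c| <= K.
Proof.
move=> d0 H H' hK.
have H1 : c <= c' + K.
  apply: (boundary_lim_le d0 H' H) => y /hK.
  by rewrite ler_norml => /andP[]; lra.
have H2 : c' <= c + K.
  apply: (boundary_lim_le d0 H H') => y /hK.
  by rewrite ler_norml => /andP[]; lra.
by rewrite ler_norml; apply/andP; split; lra.
Qed.

Lemma boundary_fun_nonincreasing x x' : good x -> good x' -> x <= x' -> hp x' <= hp x.
Proof.
move=> gx gx' xx'; rewrite -[leRHS]addr0.
apply: (boundary_lim_le ltr01 (boundary_funP gx) (boundary_funP gx')) => y /andP[y0 _].
by rewrite addr0; exact: conj_nonincreasing.
Qed.

(** Off [E] the symmetry of [u] makes [uy] vanish on the axis, so by continuity it is below [e] in a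
    box above [x], and [h] varies by at most [e * |s|] at every small height. *)
Lemma boundary_fun_derive_off x : ~ E x -> is_derive x 1 hp 0.
Proof.
move=> nEx; apply/is_deriveP => e e0; have [d d0 dE] := notin_nbhs nEx.
have [_ _ _ /continuous_pairP /(_ _ e0) [d' d'0 cy]] := partials (off_not_slit (nEx : ~ E (x, 0).1)).
exists (Num.min d d'); first by rewrite lt_min d0.
move=> s; rewrite lt_min => /andP[sd sd']; rewrite mul0r subr0.
have nEs : ~ E (x + s) by apply: dE; rewrite addrC addKr.
apply: (boundary_lim_dist d'0 (boundary_funP (bounded_gradient_off nEx))
  (boundary_funP (bounded_gradient_off nEs))) => y /andP[y0 yd'].
have -> : `|s| = `|x + s - x| by rewrite [in RHS]addrC addKr.
apply: (conj_horizontal hd) => // t tx.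
have tx' : `|t - x| < d'.
  by move: sd'; rewrite !ltr_norml => /andP[? ?]; apply/andP; split; lra.
have := cy t y tx'; rewrite /= subr0 gtr0_norm // => /(_ yd').
by rewrite uy_real_off // subr0 => /ltW.
Qed.

Lemma boundary_fun_cst_off x x' :
  (forall t, x <= t <= x' \/ x' <= t <= x -> ~ E t) -> hp x' = hp x.
Proof.
move=> nE; apply: (@mean_value_eq _ hp (fun=> 0)) => // t /nE.
exact: boundary_fun_derive_off.
Qed.

(* Far from E the gradient of u is O(1/|z|), so h varies by O(1) along the
   vertical lines x = -r and x = r up to height r; monotonicity does the rest. *)
Lemma conj_bounded : exists K, forall p, 0 < p.2 -> `|h p| <= K.
Proof.
have [cu hu _ [M [r uM]]] := gu.
(* For [r1 >= r0] the square of half-side [r1 / 2] about a point with abscissa [r1] or [- r1] misses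
   [E] and lies where the logarithmic asymptotics hold. *)
pose r0 := Num.max 1 (Num.max (r *+ 2) (Num.max (`|al| *+ 2) (`|be| *+ 2))) + 1.
have r00 : [/\ 2 <= r0, r *+ 2 < r0, `|al| *+ 2 < r0 & `|be| *+ 2 < r0].
  split; [rewrite -[2](natrD R 1 1) lerD2r|..]; rewrite ?ltr_pwDr // ?le_max ?lexx ?orbT //.
(* On that square the modulus is between [r1 / 2] and [3 r1], so [u] differs from the constant
   [ln r1] by at most [M + ln 3]; the interior estimate multiplies by [2 / (r1 / 2)], that is
   [4 / r1]. *)
pose B := (M + ln 3) *+ 2 *+ 2.
have gradB X r1 y : r0 <= r1 -> `|X| = r1 -> 0 < y <= r1 -> `|ux (X, y)| <= B / r1.
  move=> r01 Xr yr; have [? ? ? ?] := r00.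
  have r1p : 0 < r1 by lra.
  have r12 : 0 < r1 / 2 by rewrite divr_gt0.
  have y0 : 0 < (X, y).2 by case/andP: yr.
  have [d1 _ _ _] := partials (upper_not_slit y0).
  have -> : B / r1 = (M + ln 3) *+ 2 / (r1 / 2) by rewrite /B; field; rewrite gt_eqF.
  apply: (gradient_bound_x (k := ln r1) r12 _ d1) => p /= p1 p2.
  have a1 : r1 / 2 <= `|p.1|.
    by have := ler_distD p.1 X 0; rewrite !subr0 Xr distrC; lra.
  have a2 : `|p.1| <= r1 * (3 / 2).
    by have := ler_distD X p.1 0; rewrite !subr0 Xr; lra.
  have a3 : `|p.2| <= r1 * (3 / 2).
    have := ler_distD y p.2 0; rewrite !subr0 (gtr0_norm (y0 : 0 < y)).
    by case/andP: yr => *; lra.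
  have nE : ~ E p.1.
    move=> /bE /andP[b1 b2].
    have := ler_norm be; have := ler_norm (- al); rewrite normrN.
    have [p10|p10] := leP 0 p.1; move: a1; first by rewrite ger0_norm //; lra.
    by rewrite ltr0_norm //; lra.
  split; [exact: cu|apply: hu; exact: off_not_slit|].
  have s1 : r1 / 2 <= Num.sqrt (sqnorm p).
    apply: le_trans a1 _; rewrite -sqrtr_sqr ler_wsqrtr // /sqnorm lerDl; exact: sqr_ge0.
  have s2 : Num.sqrt (sqnorm p) <= r1 * 3.
    have r13 : 0 <= r1 * 3 by lra.
    rewrite -(ger0_norm r13) -sqrtr_sqr ler_wsqrtr // /sqnorm.
    rewrite -(real_normK (num_real p.1)) -(real_normK (num_real p.2)).
    have := normr_ge0 p.1; have := normr_ge0 p.2; nra.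
  have sp : 0 < Num.sqrt (sqnorm p) by lra.
  have rs : r < Num.sqrt (sqnorm p) by lra.
  have := uM p rs.
  have : ln (Num.sqrt (sqnorm p)) <= ln r1 + ln 3.
    by rewrite -lnM ?posrE // ler_ln // posrE mulr_gt0.
  have : ln r1 - ln 3 <= ln (Num.sqrt (sqnorm p)).
    rewrite -ln_div ?posrE // ler_ln // ?posrE ?divr_gt0 //.
    by apply: le_trans s1; lra.
  rewrite !ler_norml => ? ? /andP[? ?]; apply/andP; split; lra.
have B0 : 0 <= B.
  have [? ? ? ?] := r00.
  have h1 : 0 < r0 <= r0 by lra.
  have h2 : `|r0| = r0 by rewrite gtr0_norm; lra.
  have := gradB _ _ _ (lexx r0) h2 h1.
  move=> /(le_trans (normr_ge0 _)); rewrite pmulr_lge0 // invr_gt0; lra.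
have nEX X r1 : r0 <= r1 -> `|X| = r1 -> ~ E X.
  move=> r01 Xr /bE /andP[b1 b2]; have [? ? ? ?] := r00.
  have := ler_norm be; have := ler_norm (- al); rewrite normrN.
  have := normr_ge0 al; have := normr_ge0 be.
  have [X0|X0] := leP 0 X; move: Xr; first by rewrite ger0_norm //; lra.
  by rewrite ltr0_norm //; lra.
have hB X r1 y : r0 <= r1 -> `|X| = r1 -> 0 < y <= r1 -> `|h (X, y) - hp X| <= B.
  move=> r01 Xr yr; have hX := boundary_funP (bounded_gradient_off (nEX _ _ r01 Xr)).
  have r1p : 0 < r1 by have [? ? ? ?] := r00; lra.
  apply: le_of_right_approx => e e0; have [d d0 {}hX] := hX _ e0.
  have y0 : 0 < y by case/andP: yr.
  exists (Num.min y d); first by rewrite lt_min y0.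
  move=> t; rewrite lt_min => /and3P[t0 ty td].
  have h1 : `|h (X, y) - h (X, t)| <= B.
    have : `|h (X, y) - h (X, t)| <= B / r1 * `|y - t|.
      apply: (conj_vertical hd) => // z zt.
      by apply: gradB => //; case/andP: yr => *; apply/andP; split; lra.
    move/le_trans; apply; rewrite mulrAC ler_pdivrMr // ler_wpM2l //.
    by rewrite gtr0_norm; case/andP: yr; lra.
  have := hX X t; rewrite subrr normr0 t0 td => /(_ d0 isT) h2.
  by have := ler_distD (h (X, t)) (h (X, y)) (hp X); lra.
exists (B + `|hp r0|) => -[x y] /= y0.
pose r1 := Num.max r0 (Num.max `|x| y).
have [r01 xr yr] : [/\ r0 <= r1, `|x| <= r1 & y <= r1].
  by rewrite /r1 !le_max !lexx !orbT.
have [r02 _ ral rbe] := r00.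
have r1p : 0 < r1 by lra.
have n1 : `|r1| = r1 by rewrite gtr0_norm.
have n2 : `|- r1| = r1 by rewrite normrN.
have yr1 : 0 < y <= r1 by rewrite y0.
have := hB _ _ _ r01 n1 yr1; have := hB _ _ _ r01 n2 yr1.
(* The boundary values at [- r1] and [r1] do not depend on [r1], because no point of [E] has modulus
   [r0] or more; this makes the bound uniform in [p]. *)
have -> : hp (- r1) = 0.
  apply: boundary_fun_left; have := ler_norm (- al); rewrite normrN.
  by have := normr_ge0 al; lra.
have -> : hp r1 = hp r0.
  apply: boundary_fun_cst_off => t tr /bE /andP[_ tb].
  have : r0 <= t by case: tr => /andP[]; lra.
  by have := ler_norm be; have := normr_ge0 be; lra.
move: xr; rewrite ler_norml => /andP[x1 x2].
have m1 := conj_nonincreasing y0 x1; have m2 := conj_nonincreasing y0 x2.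
have := ler_norm (hp r0); have := ler_norm (- hp r0); rewrite normrN.
by rewrite !ler_norml => ? ? /andP[? ?] /andP[? ?]; apply/andP; split; lra.
Qed.

End GreenConjugate.

Lemma norm_between {R : realType} (a b c k t : R) : `|a - c| <= k -> `|b - c| <= k ->
  a <= t <= b \/ b <= t <= a -> `|t - c| <= k.
Proof.
rewrite !ler_norml => /andP[? ?] /andP[? ?] [/andP[? ?]|/andP[? ?]];
  by apply/andP; split; lra.
Qed.

(** * Differentiability of the boundary values in the interior of E *)

Section InteriorRegularity.
Context {R : realType} (E : set R) (u ux uy h : R * R -> R).
Hypotheses (cE : closed E) (gu : green_fun E u)
  (su : smooth_harmonic (~` slit E) u ux uy) (hd : conjugate_plus u ux uy h).
Implicit Types (x y : R) (p q : R * R).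
Local Notation hp := (boundary_fun h).

(* The translates u(x + s, y) - u(x, y) vanish on the boundary and are O(s), so
   the boundary gradient estimate applies to them in turn. *)
Lemma uy_lipschitz x0 : interior E x0 -> exists K d : R, [/\ 0 < d, 0 <= K &
  forall x s y, `|x - x0| < d -> `|s| < d -> 0 < y < d ->
    `|uy (x + s, y) - uy (x, y)| <= K * `|s|].
Proof.
move=> /(interior_setup gu) [r r0 [u0 u1]]; have [cu hu _ _] := gu.
(* [K1] bounds [ux] near [x0], hence [|v| <= K1 * |s|]. The radius [r'] keeps every point of the
   smaller box, and its translate by [s], within [r / 2] of [x0]. *)
pose K1 := 12 / r; pose r' := r / 8.
have r'0 : 0 < r' by rewrite divr_gt0.
have K10 : 0 < K1 by rewrite divr_gt0.
have r'r2 : r' *+ 2 <= r / 2 by rewrite /r'; lra.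
exists (K1 *+ 12 / r'), (r' / 2); split; [by rewrite divr_gt0|by rewrite divr_ge0 ?ltW // mulrn_wgt0|].
move=> x s y xr sr yr.
pose v p := u (p.1 + s, p.2) - u p.
have shiftc p : {for p, continuous (fun p => u (p.1 + s, p.2))}.
  apply/continuous_pairP => e e0.
  have /continuous_pairP /(_ _ e0) [d d0 H] := cu (p.1 + s, p.2).
  by exists d => // a b ad bd; apply: H => //=; rewrite opprD addrACA subrr addr0.
have cv p : {for p, continuous v} by apply: continuousB; [exact: shiftc|exact: cu].
have hv p : 0 < p.2 -> harm v p.
  move=> p0; apply: harmB; last by apply: hu; exact: upper_not_slit.
  apply: harm_shift; apply: hu; exact: upper_not_slit.
have near_s a : `|a - x0| <= r' *+ 2 -> `|a + s - x0| <= r / 2.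
  move: sr; rewrite ltr_norml !ler_norml /r' => /andP[? ?] /andP[? ?].
  by apply/andP; split; lra.
have r'r a : `|a - x0| <= r' *+ 2 -> `|a - x0| <= r *+ 2.
  by move/le_trans; apply; rewrite /r'; lra.
have v0 a : `|a - x0| <= r' *+ 2 -> v (a, 0) = 0.
  move=> ar; rewrite /v /= !u0 ?subrr //; first exact: r'r.
  by apply: le_trans (near_s _ ar) _; lra.
have vB p : `|p.1 - x0| <= r' *+ 2 -> 0 <= p.2 <= r' -> `|v p| <= K1 * `|s|.
  case: p => a b /= ar /andP[b0 br].
  have [->|bn0] := eqVneq b 0; first by rewrite v0 // normr0 mulr_ge0 // ltW.
  have {bn0}b0 : 0 < b by rewrite lt_neqAle eq_sym bn0.
  have -> : `|s| = `|a + s - a| by rewrite [in RHS]addrC addKr.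
  apply: (@mean_value_bound _ (fun t => u (t, b)) (fun t => ux (t, b))) => t tx.
    have tb : 0 < (t, b).2 by [].
    by have [] := partials su (upper_not_slit tb).
  have tr : `|(t, b).1 - x0| <= r / 2.
    exact: norm_between (le_trans ar r'r2) (near_s _ ar) tx.
  have br' : 0 < (t, b).2 <= r / 2.
    by rewrite /= b0 /=; apply: le_trans br _; lra.
  by have [] := interior_gradient gu su r0 u0 u1 tr br'.
have y0 : 0 < y by case/andP: yr.
have xr' : `|x - x0| <= r' / 2 by exact: ltW.
have yr' : 0 < y <= r' / 2 by rewrite y0 ltW //; case/andP: yr.
have hv' p : `|p.1 - x0| <= r' *+ 2 -> 0 < p.2 <= r' -> harm v p.
  by move=> _ /andP[/hv].
have [_ H] := gradient_bound_boundary r'0 (fun p _ _ => cv p) hv' v0 vB xr' yr'.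
have -> : K1 *+ 12 / r' * `|s| = (K1 * `|s|) *+ 12 / r' by field; rewrite gt_eqF.
apply: H.
have p1 : 0 < (x + s, y).2 by []. have p2 : 0 < (x, y).2 by [].
have [_ d1 _ _] := partials su (upper_not_slit p1).
have [_ d2 _ _] := partials su (upper_not_slit p2).
exact: is_derive_fB d1 d2.
Qed.

(** The Lipschitz bound on [uy] gives [h (x + t, y) - h (x, y) = - uy (x, y) t + O(K t ^+ 2)]
    uniformly in [y]. Since both values of [h] converge as [y] decreases to 0, so does
    [- uy (x, y)]; its limit [a x] inherits the constant [K], and the expansion passes to the
    limit. *)
Lemma boundary_fun_interior x0 : interior E x0 -> exists (a : R -> R) (K d : R), 0 < d /\
  forall x, `|x - x0| < d -> is_derive x 1 hp (a x) /\
    forall x', `|x' - x0| < d -> `|a x' - a x| <= K * `|x' - x|.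
Proof.
move=> iEx0; have [K [d [d0 K0 H]]] := uy_lipschitz iEx0.
have [d' d'0 dE] := interior_nbhs iEx0.
have m0 : 0 < Num.min d d' by rewrite lt_min d0.
pose m := Num.min d d' / 2; have m0' : 0 < m by rewrite divr_gt0.
have [md md'] : m *+ 2 <= d /\ m *+ 2 <= d'.
  have : m *+ 2 <= Num.min d d' by rewrite /m; lra.
  by rewrite le_min => /andP.
have hB x t : `|x - x0| < m -> `|t - x0| < m -> boundary_lim h x (hp x).
  move=> xm _; apply: (boundary_funP hd); apply: (bounded_gradient_interior gu su).
  apply/nbhs_ballP; exists m => //= z; rewrite /ball /= distrC => zx.
  by apply: dE; have := ler_distD x z x0; lra.
have taylor x t y : `|x - x0| < m -> `|t| < m -> 0 < y < d ->
    `|h (x + t, y) - h (x, y) + uy (x, y) * t| <= K * `|t| * `|t|.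
  move=> xm tm yd; have y0 : 0 < y by case/andP: yd.
  pose f z := h (z, y) + uy (x, y) * z.
  have -> : h (x + t, y) - h (x, y) + uy (x, y) * t = f (x + t) - f x.
    by rewrite /f; ring.
  have -> : K * `|t| * `|t| = K * `|t| * `|x + t - x| by rewrite [x + t]addrC addrK.
  apply: (@mean_value_bound _ f (fun z => - uy (z, y) + uy (x, y))) => z zx.
    have h1 := (hd (p := (z, y)) y0).1.
    have h2 := is_derive_affine 0 (uy (x, y)) z.
    have := is_derive_fD h1 h2.
    by have -> : (fun s => h (s, (z, y).2) + (0 + uy (x, y) * s)) = f;
      first by apply/funext => s; rewrite add0r.
  have zt : `|z - x| <= `|t|.
    have := ler_norm t; have := ler_norm (- t); rewrite normrN => ? ?.
    by rewrite ler_norml; apply/andP; split; case: zx; lra.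
  have -> : - uy (z, y) + uy (x, y) = - (uy (x + (z - x), y) - uy (x, y)).
    by rewrite opprB addrC; congr (_ - uy (_, _)); ring.
  rewrite normrN (le_trans (H _ _ _ _ _ yd)) ?ler_wpM2l //; lra.
have step (e : R) : 0 < e -> exists2 t : R, 0 < t < m & K * t < e.
  move=> e0; have K1 : 0 < K + 1 by lra.
  have q0 : 0 < Num.min m (e / (K + 1)) by rewrite lt_min m0' divr_gt0.
  have /andP[t0] := half_between q0; set t := _ / 2 in t0 *.
  rewrite lt_min => /andP[tm te]; exists t; first by rewrite t0.
  by move: te; rewrite ltr_pdivlMr //; nra.
(* The step [t] is fixed first, with [K t] small; only then is [y] taken small compared with [t], so
   that the quotient of boundary values pins down [- uy (x, y)] up to [e / 2]. *)
have lim_uy x : `|x - x0| < m -> exists a, forall e, 0 < e ->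
    exists2 r, 0 < r & forall y, 0 < y < r -> `|- uy (x, y) - a| < e.
  move=> xm; apply: right_cauchy_lim => e e0.
  have e30 : 0 < e / 4 by lra.
  have [t /andP[t0 tm] Kt] := step _ e30.
  have xt : boundary_lim h (x + t) (hp (x + t)).
    apply: (boundary_funP hd); apply: (bounded_gradient_interior gu su).
    apply/nbhs_ballP; exists (m *+ 2 - `|x + t - x0|) => /=.
      by rewrite subr_gt0; have := ler_normD (x - x0) t; rewrite addrAC (gtr0_norm t0); lra.
    by move=> z; rewrite /ball /= distrC => zx; apply: dE; have := ler_distD (x + t) z x0; lra.
  have et0 : 0 < e / 8 * t by rewrite mulr_gt0 //; lra.
  have [d1 d10 h1] := xt _ et0; have [d2 d20 h2] := hB _ _ xm xm _ et0.
  exists (Num.min d (Num.min d1 d2)); first by rewrite !lt_min d0 d10.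
  have xx : `|x - x| < d2 by rewrite subrr normr0.
  have xx' : `|x + t - (x + t)| < d1 by rewrite subrr normr0.
  have Kt2 : K * t * t < e / 4 * t by rewrite ltr_pM2r.
  have tn : `|t| = t by exact: gtr0_norm.
  have main y : 0 < y -> y < d -> y < d1 -> y < d2 ->
      `|uy (x, y) * t - (hp x - hp (x + t))| < e / 2 * t.
    move=> y0 yd y1 y2; have yd' : 0 < y < d by rewrite y0.
    have y1' : 0 < y < d1 by rewrite y0. have y2' : 0 < y < d2 by rewrite y0.
    have := taylor x t y xm; rewrite tn => /(_ tm yd').
    have := h1 _ _ xx' y1'; have := h2 _ _ xx y2'; move: Kt2; clear.
    rewrite !ltr_norml !ler_norml => ? /andP[? ?] /andP[? ?] /andP[? ?].
    by apply/andP; split; lra.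
  move=> y y'; rewrite !lt_min => /and4P[y0 yd y1 y2] /and4P[y'0 y'd y'1 y'2].
  have := main y y0 yd y1 y2; have := main y' y'0 y'd y'1 y'2.
  suff : `|(- uy (x, y) - - uy (x, y')) * t| < e * t -> `|- uy (x, y) - - uy (x, y')| < e.
    move=> + h1' h2'; apply; move: h1' h2'; clear; rewrite !ltr_norml => /andP[? ?] /andP[? ?].
    by apply/andP; split; lra.
  by rewrite normrM tn ltr_pM2r.
pose a x : R := xget 0 [set a : R | forall e, 0 < e ->
    exists2 r, 0 < r & forall y, 0 < y < r -> `|- uy (x, y) - a| < e].
have aP x : `|x - x0| < m -> forall e, 0 < e ->
    exists2 r, 0 < r & forall y, 0 < y < r -> `|- uy (x, y) - a x| < e.
  move=> /lim_uy [c hc].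
  by apply: (@xgetPex _ 0 [set a : R | forall e, 0 < e ->
    exists2 r, 0 < r & forall y, 0 < y < r -> `|- uy (x, y) - a| < e]); exists c.
exists a, K, m; split => // x xm; split.
  apply/is_deriveP => e e0; have e20 : 0 < e / 2 by lra.
  have [t0 /andP[t00 t0m] Kt0] := step _ e0.
  have xm0 : 0 < m - `|x - x0| by rewrite subr_gt0.
  exists (Num.min t0 (m - `|x - x0|)); first by rewrite lt_min t00.
  move=> t; rewrite lt_min => /andP[tt0 txm].
  have tm : `|t| < m by exact: lt_trans t0m.
  have xtm : `|x + t - x0| < m.
    rewrite addrAC; apply: le_lt_trans (ler_normD _ _) _.
    by rewrite -ltrBrDl.
  apply: (@le_trans _ _ (K * `|t| * `|t|)); last first.
    rewrite ler_wpM2r //; apply: le_trans (ltW Kt0); rewrite ler_wpM2l //; exact: ltW.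
  apply: le_of_right_approx => e' e'0.
  have t1 : 0 < `|t| + 1 by have := normr_ge0 t; lra.
  have e3 : 0 < e' / 3 by lra. have e4 : 0 < e' / 3 / (`|t| + 1) by rewrite divr_gt0.
  have [r1 r10 h1] := hB _ _ xtm xtm _ e3.
  have [r2 r20 h2] := hB _ _ xm xm _ e3.
  have [r3 r30 h3] := aP _ xm _ e4.
  exists (Num.min d (Num.min r1 (Num.min r2 r3))); first by rewrite !lt_min d0 r10 r20.
  move=> y; rewrite !lt_min => /and5P[y0 yd y1 y2 y3].
  have y0d : 0 < y < d by rewrite y0. have y01 : 0 < y < r1 by rewrite y0.
  have y02 : 0 < y < r2 by rewrite y0. have y03 : 0 < y < r3 by rewrite y0.
  have xx : `|x - x| < r2 by rewrite subrr normr0.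
  have xx' : `|x + t - (x + t)| < r1 by rewrite subrr normr0.
  have := taylor _ _ _ xm tm y0d; have := h1 _ _ xx' y01; have := h2 _ _ xx y02.
  have : `|(- uy (x, y) - a x) * t| <= e' / 3.
    rewrite normrM; apply: (@le_trans _ _ (e' / 3 / (`|t| + 1) * (`|t| + 1))).
      by apply: ler_pM => //; [exact/ltW/h3|rewrite lerDl].
    by rewrite divfK // gt_eqF.
  set X := K * `|t| * `|t|; clear; rewrite !ltr_norml !ler_norml.
  by move=> /andP[? ?] /andP[? ?] /andP[? ?] /andP[? ?]; apply/andP; split; lra.
move=> x' xm'; apply: le_of_right_approx => e e0; have e20 : 0 < e / 2 by lra.
have [r1 r10 h1] := aP _ xm _ e20; have [r2 r20 h2] := aP _ xm' _ e20.
exists (Num.min d (Num.min r1 r2)); first by rewrite !lt_min d0 r10.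
move=> y; rewrite !lt_min => /and4P[y0 yd y1 y2].
have y0d : 0 < y < d by rewrite y0.
have y01 : 0 < y < r1 by rewrite y0. have y02 : 0 < y < r2 by rewrite y0.
have xd : `|x - x0| < d by lra.
have xxd : `|x' - x| < d by have := ler_distD x0 x' x; rewrite (distrC x0); lra.
have := H x (x' - x) y xd xxd y0d; rewrite (addrC x) subrK.
have := h1 _ y01; have := h2 _ y02.
set X := K * _; clear; rewrite !ltr_norml !ler_norml.
by move=> /andP[? ?] /andP[? ?] /andP[? ?]; apply/andP; split; lra.
Qed.

End InteriorRegularity.

(** * Half-plane kernels and Phragmen-Lindelof *)

Section Kernels.
Context {R : realType}.
Implicit Types x y t : R.

Definition logk (x y : R) : R := ln (x ^+ 2 + y ^+ 2) / 2.
(* The argument of x + iy, for y > 0. *)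
Definition argk (x y : R) : R := pi / 2 - atan (x / y).
(** With [z = x + i y], [1 / z = rek - i imk]. Thus [(rek, imk)] is the gradient of [logk] and
    [(- imk, rek)] that of [argk]. *)
Definition rek (x y : R) : R := x / (x ^+ 2 + y ^+ 2).
Definition imk (x y : R) : R := y / (x ^+ 2 + y ^+ 2).

Lemma is_derive_inv (f : R -> R) t a : f t != 0 -> is_derive t 1 f a ->
  is_derive t 1 (fun s => (f s)^-1) (- a / f t ^+ 2).
Proof.
move=> f0 fa; have := is_deriveV f0 fa.
by rewrite /GRing.scale /= mulrC mulrN mulNr.
Qed.

Lemma is_derive_sqr t c : is_derive t 1 (fun s => s ^+ 2 + c) (t *+ 2).
Proof.
apply/is_deriveP => e e0; exists e => // s se.
rewrite (_ : _ - _ = s * s); last by ring.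
by rewrite normrM ler_wpM2r // ltW.
Qed.

Lemma is_derive_eqf (f g : R -> R) t a b : f = g -> a = b ->
  is_derive t 1 f a -> is_derive t 1 g b.
Proof. by move=> -> ->. Qed.

Lemma is_derive_half_ln x c : 0 < x ^+ 2 + c ->
  is_derive x 1 (fun s => ln (s ^+ 2 + c) / 2) (x / (x ^+ 2 + c)).
Proof.
move=> q0; have d1 := @is_derive1_comp _ (@ln R) (fun s => s ^+ 2 + c) x _ _
  (is_derive1_ln q0) (is_derive_sqr x c).
have d2 := is_derive_fM d1 (is_derive_affine 2^-1 0 x).
apply: is_derive_eqf d2.
  by apply/funext => s /=; rewrite mul0r addr0.
rewrite mul0r addr0 /GRing.scale /=; field.
by rewrite gt_eqF.
Qed.

Lemma is_derive_recip_sqr x c k : 0 < x ^+ 2 + c ->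
  is_derive x 1 (fun s => k / (s ^+ 2 + c)) (- (k * x *+ 2) / (x ^+ 2 + c) ^+ 2).
Proof.
move=> q0; have d1 := @is_derive_inv (fun s => s ^+ 2 + c) x _ (lt0r_neq0 q0) (is_derive_sqr x c).
have d2 := is_derive_fM (is_derive_affine k 0 x) d1.
apply: is_derive_eqf d2.
  by apply/funext => s /=; rewrite mul0r addr0.
by rewrite !mul0r !addr0 /=; field; rewrite gt_eqF.
Qed.

Lemma is_derive_ratio_sqr x c : 0 < x ^+ 2 + c ->
  is_derive x 1 (fun s => s / (s ^+ 2 + c)) ((c - x ^+ 2) / (x ^+ 2 + c) ^+ 2).
Proof.
move=> q0; have d1 := @is_derive_inv (fun s => s ^+ 2 + c) x _ (lt0r_neq0 q0) (is_derive_sqr x c).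
have d2 := is_derive_fM (is_derive_affine 0 1 x) d1.
apply: is_derive_eqf d2.
  by apply/funext => s /=; rewrite mul1r add0r.
by rewrite !mul1r !add0r /=; field; rewrite gt_eqF.
Qed.

Section Derivatives.
Context (x y : R) (q0 : 0 < x ^+ 2 + y ^+ 2).

Let q0' : 0 < y ^+ 2 + x ^+ 2. Proof. by rewrite addrC. Qed.

Lemma logk_dx : is_derive x 1 (logk ^~ y) (rek x y).
Proof. exact: is_derive_half_ln. Qed.

Lemma logk_dy : is_derive y 1 (logk x) (imk x y).
Proof.
apply: is_derive_eqf (is_derive_half_ln q0'); last by rewrite /imk addrC.
by apply/funext => s; rewrite /logk addrC.
Qed.

Lemma rek_dx : is_derive x 1 (rek ^~ y) ((y ^+ 2 - x ^+ 2) / (x ^+ 2 + y ^+ 2) ^+ 2).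
Proof. exact: is_derive_ratio_sqr. Qed.

Lemma rek_dy : is_derive y 1 (rek x) (- (x * y *+ 2) / (x ^+ 2 + y ^+ 2) ^+ 2).
Proof.
apply: is_derive_eqf (is_derive_recip_sqr x q0'); last by rewrite (addrC (x ^+ 2)).
by apply/funext => s; rewrite /rek addrC.
Qed.

Lemma imk_dx : is_derive x 1 (imk ^~ y) (- (x * y *+ 2) / (x ^+ 2 + y ^+ 2) ^+ 2).
Proof. by apply: is_derive_eqf (is_derive_recip_sqr y q0) => //; rewrite (mulrC y). Qed.

Lemma imk_dy : is_derive y 1 (imk x) ((x ^+ 2 - y ^+ 2) / (x ^+ 2 + y ^+ 2) ^+ 2).
Proof.
apply: is_derive_eqf (is_derive_ratio_sqr q0'); last by rewrite (addrC (x ^+ 2) (y ^+ 2)).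
by apply/funext => s; rewrite /imk addrC.
Qed.

End Derivatives.

Lemma argk_dx x y : 0 < y -> is_derive x 1 (argk ^~ y) (- imk x y).
Proof.
move=> y0; have d0 := is_derive_affine 0 y^-1 x.
have d1 := @is_derive1_comp _ (@atan R) (fun s => 0 + y^-1 * s) x _ _ (is_derive1_atan _) d0.
have d2 := is_derive_fB (is_derive_affine (pi / 2) 0 x) d1.
apply: is_derive_eqf d2.
  by apply/funext => s /=; rewrite mul0r addr0 add0r (mulrC _ s).
rewrite /imk sub0r add0r /GRing.scale /=; congr (- _); field.
by rewrite !gt_eqF //= ?ltr_pwDr ?exprn_gt0 ?sqr_ge0.
Qed.

Lemma argk_dy x y : 0 < y -> is_derive y 1 (argk x) (rek x y).
Proof.
move=> y0; have d0 := is_derive_affine 0 1 y.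
have y0' : 0 + 1 * y != 0 by rewrite add0r mul1r gt_eqF.
have d1 := is_derive_fM (is_derive_affine x 0 y) (@is_derive_inv (fun s => 0 + 1 * s) y _ y0' d0).
have d2 := @is_derive1_comp _ (@atan R) _ y _ _ (is_derive1_atan _) d1.
have d3 := is_derive_fB (is_derive_affine (pi / 2) 0 y) d2.
apply: is_derive_eqf d3.
  by apply/funext => s /=; rewrite !mul0r !addr0 add0r mul1r.
rewrite /rek sub0r !mul0r !addr0 !add0r !mul1r /GRing.scale /=; field.
by rewrite !gt_eqF //= ?ltr_pwDr ?ltr_pwDl ?exprn_gt0 ?sqr_ge0.
Qed.

Lemma argk_bounds x y : 0 <= argk x y <= pi.
Proof.
rewrite /argk; have := atan_ltpi2 (x / y); have := atan_gtNpi2 (x / y); lra.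
Qed.

Lemma sqsum_gt0 x y : y != 0 -> 0 < x ^+ 2 + y ^+ 2.
Proof. by move=> y0; rewrite ltr_wpDl ?sqr_ge0 // exprn_even_gt0. Qed.

Lemma rek_bound x y : 0 < y -> `|rek x y| <= y^-1.
Proof.
move=> y0; have q0 := sqsum_gt0 x (lt0r_neq0 y0).
rewrite /rek normrM normfV (gtr0_norm q0) ler_pdivrMr // mulrC ler_pdivlMr //.
rewrite -(real_normK (num_real x)); have := normr_ge0 x; nra.
Qed.

Lemma imk_bound x y : 0 < y -> `|imk x y| <= y^-1.
Proof.
move=> y0; have q0 := sqsum_gt0 x (lt0r_neq0 y0).
rewrite /imk normrM normfV (gtr0_norm q0) (gtr0_norm y0) ler_pdivrMr // mulrC ler_pdivlMr //.
by have := sqr_ge0 x; nra.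
Qed.

Lemma cross_bound x y : 0 < y -> `|- (x * y *+ 2) / (x ^+ 2 + y ^+ 2) ^+ 2| <= y ^- 2.
Proof.
move=> y0; have q0 := sqsum_gt0 x (lt0r_neq0 y0).
rewrite normrM normfV (gtr0_norm (exprn_gt0 2 q0)) ler_pdivrMr ?exprn_gt0 //.
rewrite [leRHS]mulrC ler_pdivlMr ?exprn_gt0 // normrN normrMn normrM (gtr0_norm y0).
apply: (@le_trans _ _ ((x ^+ 2 + y ^+ 2) * y ^+ 2)).
  rewrite ler_wpM2r ?sqr_ge0 // -(real_normK (num_real x)).
  by have := sqr_ge0 (`|x| - y); nra.
by rewrite expr2 ler_wpM2l ?(ltW q0) // lerDr sqr_ge0.
Qed.

Lemma argk_at_right (d e : R) : 0 < d -> 0 < e -> exists2 r, 0 < r &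
  forall x y, 0 < y < r -> (d <= x -> argk x y < e) /\ (x <= - d -> pi - e < argk x y).
Proof.
move=> d0 e0; have /cvgrPdist_lt /(_ _ e0) [V [Vr HV]] := @cvgy_atan R.
have HV' v : `|V| + 1 <= v -> pi / 2 - atan v < e.
  move=> Vv; have : V < v by have := ler_norm V; lra.
  by move/HV; apply: le_lt_trans; exact: ler_norm.
have V0 : 0 < `|V| + 1 by have := normr_ge0 V; lra.
exists (d / (`|V| + 1)); first by rewrite divr_gt0.
move=> x y /andP[y0]; rewrite ltr_pdivlMr // => yd; split => xd.
  by apply: HV'; rewrite ler_pdivlMr // mulrC; lra.
have hv : `|V| + 1 <= - (x / y) by rewrite -mulNr ler_pdivlMr // mulrC; lra.
by have := HV' _ hv; rewrite atanN /argk; lra.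
Qed.

Lemma logk_harm x y : y != 0 -> harm (fun p => logk p.1 p.2) (x, y).
Proof.
move=> y0; have q0 := sqsum_gt0 x y0.
have [d d0 dy] : exists2 d, 0 < d & forall t, `|t - y| < d -> t != 0.
  exists `|y|; first by rewrite normr_gt0.
  by move=> t ty; apply/eqP => t0; rewrite t0 sub0r normrN ltxx in ty.
exists ((y ^+ 2 - x ^+ 2) / (x ^+ 2 + y ^+ 2) ^+ 2); split.
  apply: (@sym2_derive_derive2 _ (logk ^~ y) (rek ^~ y) _ 1) => // [s _|].
    exact/logk_dx/sqsum_gt0.
  exact: rek_dx.
rewrite -mulNr opprB.
apply: (@sym2_derive_derive2 _ (logk x) (imk x) _ d) => // [s /dy s0|].
  exact/logk_dy/sqsum_gt0.
exact: imk_dy.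
Qed.

End Kernels.

(** * Uniqueness of bounded harmonic functions in the half-plane *)

Section HalfPlaneUniqueness.
Context {R : realType}.
Implicit Types (x y b : R) (p : R * R).

Lemma shift_logk_harm b d p : p.2 + d != 0 -> harm (fun p => logk (p.1 - b) (p.2 + d)) p.
Proof.
move=> /(logk_harm (p.1 - b)) [c [c1 c2]]; exists c; split.
  by apply: eq_sym2_derive c1; exists 1 => //= s _; rewrite addrAC.
by apply: eq_sym2_derive c2; exists 1 => //= s _; rewrite addrAC.
Qed.

Lemma shift_logk_cont b d p : 0 < p.2 + d ->
  {for p, continuous (fun p => logk (p.1 - b) (p.2 + d))}.
Proof.
move=> p0; have e0 : 0 < (p.2 + d) / 2 by rewrite divr_gt0.
apply: (@continuous_of_bounded_partials _ (fun p => logk (p.1 - b) (p.2 + d))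
  (fun p => rek (p.1 - b) (p.2 + d)) (fun p => imk (p.1 - b) (p.2 + d))
  p ((p.2 + d) / 2)^-1 _ e0) => q _.
rewrite ltr_norml => /andP[q2 _].
have q0 : (p.2 + d) / 2 <= q.2 + d by lra.
have q0' : 0 < q.2 + d by lra.
have le_inv : (q.2 + d)^-1 <= ((p.2 + d) / 2)^-1 by rewrite lef_pV2 ?posrE.
have s0 := sqsum_gt0 (q.1 - b) (lt0r_neq0 q0').
split.
- have := @is_derive_shift _ (logk ^~ (q.2 + d)) (rek (q.1 - b) (q.2 + d)) (- b) q.1.
  rewrite (addrC (- b)) => /(_ (logk_dx s0)); apply: is_derive_eqf => //.
  by apply/funext => t; rewrite addrC.
- have := @is_derive_shift _ (logk (q.1 - b)) (imk (q.1 - b) (q.2 + d)) d q.2.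
  rewrite (addrC d) => /(_ (logk_dy s0)); apply: is_derive_eqf => //.
  by apply/funext => t; rewrite (addrC d).
- exact: le_trans (rek_bound _ q0') le_inv.
- exact: le_trans (imk_bound _ q0') le_inv.
Qed.

Lemma logk_mono x y y' : 0 < y -> y <= y' -> logk x y <= logk x y'.
Proof.
move=> y0 yy'; rewrite /logk ler_pM2r ?invr_gt0 //.
rewrite ler_ln ?posrE ?sqsum_gt0 ?gt_eqF //; last by lra.
by rewrite lerD2l ler_sqr ?nnegrE; lra.
Qed.

Lemma logk1_ge0 x y : 0 < y -> 0 <= logk x (y + 1).
Proof.
move=> y0; rewrite /logk mulr_ge0 // ln_ge0 //.
by have := sqr_ge0 x; nra.
Qed.

(* Each summand is harmonic and nonnegative in the upper half-plane; the first
   tends to infinity at infinity and the one for b tends to infinity at b. *)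
Definition log_barrier (s : seq R) p : R :=
  logk (p.1 - 0) (p.2 + 1) +
  \sum_(b <- s) (logk (p.1 - b) (p.2 + 1) - logk (p.1 - b) (p.2 + 0)).

Lemma log_barrier_term_ge0 b p : 0 < p.2 ->
  0 <= logk (p.1 - b) (p.2 + 1) - logk (p.1 - b) (p.2 + 0).
Proof. by move=> p0; rewrite subr_ge0 addr0 logk_mono // lerDl. Qed.

Lemma log_barrier_ge0 s p : 0 < p.2 -> 0 <= log_barrier s p.
Proof.
move=> p0; apply: addr_ge0; first exact: logk1_ge0.
by apply: sumr_ge0 => b _; exact: log_barrier_term_ge0.
Qed.

Lemma log_barrier_harm s p : 0 < p.2 -> harm (log_barrier s) p.
Proof.
move=> p0; apply: harmD.
  by apply: shift_logk_harm; rewrite gt_eqF // ltr_wpDr.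
apply: harm_sum => b; apply: harmB; apply: shift_logk_harm.
  by rewrite gt_eqF // ltr_wpDr.
by rewrite addr0 gt_eqF.
Qed.

Lemma log_barrier_cont s p : 0 < p.2 -> {for p, continuous (log_barrier s)}.
Proof.
move=> p0; have p1 : 0 < p.2 + 1 by rewrite ltr_wpDr.
have p2 : 0 < p.2 + 0 by rewrite addr0.
apply: (@continuousD _ _ _ (fun p => logk (p.1 - 0) (p.2 + 1))); first exact: shift_logk_cont.
elim: s => [|b s IH].
  rewrite (_ : (fun p => _) = fun=> 0); first exact: cst_continuous.
  by apply/funext => q; rewrite big_nil.
rewrite (_ : (fun p => _) = (fun p => (logk (p.1 - b) (p.2 + 1) - logk (p.1 - b) (p.2 + 0)) +
   \sum_(b <- s) (logk (p.1 - b) (p.2 + 1) - logk (p.1 - b) (p.2 + 0)))); last first.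
  by apply/funext => q; rewrite big_cons.
apply: continuousD IH; apply: (@continuousB _ _ _ (fun p => logk (p.1 - b) (p.2 + 1)));
  exact: shift_logk_cont.
Qed.

Lemma log_barrier_infty s (K : R) : exists N : R, forall p, 0 < p.2 ->
  N < `|p.1| \/ N < `|p.2| -> K <= log_barrier s p.
Proof.
exists (expR K) => p p0 pN.
apply: (@le_trans _ _ (logk (p.1 - 0) (p.2 + 1))); last first.
  by rewrite /log_barrier lerDl; apply: sumr_ge0 => b _; exact: log_barrier_term_ge0.
rewrite subr0 /logk ler_pdivlMr // mulr_natr -[leLHS]expRK ler_ln ?posrE ?expR_gt0 //; last first.
  by apply: sqsum_gt0; rewrite gt_eqF // ltr_wpDr.
rewrite mulr2n expRD -expr2.
have e0 := expR_gt0 K; case: pN => pN.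
  rewrite -(real_normK (num_real p.1)); have := sqr_ge0 (p.2 + 1).
  have := normr_ge0 p.1; nra.
by move: pN; rewrite gtr0_norm // => pN; have := sqr_ge0 p.1; nra.
Qed.

Lemma log_barrier_pole s (b K : R) : b \in s -> exists2 r : R, 0 < r &
  forall p, 0 < p.2 -> `|p.1 - b| < r -> p.2 < r -> K <= log_barrier s p.
Proof.
(* Both coordinates relative to [b] being below [expR (- K) / 2], the modulus is below [expR (- K)]
   and the negated logarithm of the summand for [b] exceeds [K]; everything else in the barrier is
   nonnegative. *)
move=> bs; exists (expR (- K) / 2); first by rewrite divr_gt0 ?expR_gt0.
move=> p p0 pb pr.
apply: (@le_trans _ _ (logk (p.1 - b) (p.2 + 1) - logk (p.1 - b) (p.2 + 0))); last first.
  rewrite /log_barrier (perm_big _ (perm_to_rem bs)) big_cons /=.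
  rewrite addrCA lerDl; apply: addr_ge0; first by rewrite subr0; exact: logk1_ge0.
  by apply: sumr_ge0 => c _; exact: log_barrier_term_ge0.
have := logk1_ge0 (p.1 - b) p0.
suff : logk (p.1 - b) (p.2 + 0) <= - K by lra.
rewrite addr0 /logk ler_pdivrMr // mulr_natr -[leRHS]expRK ler_ln ?posrE ?expR_gt0 //; last first.
  by apply: sqsum_gt0; rewrite gt_eqF.
rewrite mulr2n expRD -(real_normK (num_real (p.1 - b))).
have := expR_gt0 (- K); have := normr_ge0 (p.1 - b); nra.
Qed.

(* Phragmen-Lindelof, with finitely many exceptional boundary points. *)
Lemma half_plane_le (w : R * R -> R) (s : seq R) (K c : R) :
  (forall p, 0 < p.2 -> [/\ {for p, continuous w}, harm w p & w p <= K]) ->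
  (forall x, x \notin s -> boundary_lim w x c) ->
  forall p, 0 < p.2 -> w p <= c.
Proof.
move=> Hw wc p p0; rewrite -subr_le0.
pose K' := `|K - c|; have K'0 : 0 <= K' by exact: normr_ge0.
have wK q : 0 < q.2 -> w q - c <= K'.
  by move=> /Hw [_ _ wq]; apply: le_trans (ler_norm _); rewrite lerD2r.
apply: (@max_principle_barrier _ [set p : R * R | 0 < p.2] (fun p => w p - c) (log_barrier s)) => //.
- rewrite (_ : [set p | _] = snd @^-1` `]0, +oo[%classic); last first.
    by apply/seteqP; split=> q /=; rewrite in_itv /= andbT.
  by apply: open_comp => // q _; exact: cvg_snd.
- move=> q q0; have [cw _ _] := Hw q q0; split; last exact: log_barrier_cont.
  by apply: (@continuousB _ _ _ w (fun=> c)) => //; exact: cst_continuous.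
- move=> q q0; have [_ hw _] := Hw q q0; split; last exact: log_barrier_harm.
  by apply: harmB => //; exact: harm_cst.
- move=> e e0; have [N HN] := log_barrier_infty s (K' / e).
  exists N => q q0 /(HN q q0); rewrite ler_pdivrMr // mulrC; exact/le_trans/wK.
- move=> q /negP; rewrite -leNgt => q0 e e' e0 e'0.
  have [q2|q2] := ltP q.2 0.
    apply/nbhs_pairP; exists (- q.2); first by rewrite oppr_gt0.
    by move=> x y _; rewrite ltr_norml => /andP[_ ?] /=; lra.
  have {q0 q2}q2 : q.2 = 0 by apply/eqP; rewrite eq_le q0.
  have [qs|qs] := boolP (q.1 \in s).
    have [r r0 Hr] := log_barrier_pole (K' / e) qs.
    apply/nbhs_pairP; exists r => // x y xr; rewrite q2 subr0 => yr /= y0.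
    have := Hr (x, y) y0 xr; rewrite gtr0_norm // in yr; move=> /(_ yr).
    rewrite ler_pdivrMr // mulrC => H; apply: le_trans (wK (x, y) y0) _.
    by apply: le_trans H _; rewrite lerDl ltW.
  have [r r0 Hr] := wc _ qs _ e'0.
  apply/nbhs_pairP; exists r => // x y xr; rewrite q2 subr0 => yr /= y0.
  rewrite gtr0_norm // in yr.
  have yr' : 0 < y < r by rewrite y0.
  apply: (@le_trans _ _ e'); last by rewrite lerDr mulr_ge0 ?(ltW e0) // log_barrier_ge0.
  by apply: le_trans (ler_norm _) _; apply: ltW; exact: Hr.
Qed.

Lemma half_plane_cst (w : R * R -> R) (s : seq R) (K c : R) :
  (forall p, 0 < p.2 -> [/\ {for p, continuous w}, harm w p & `|w p| <= K]) ->
  (forall x, x \notin s -> boundary_lim w x c) ->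
  forall p, 0 < p.2 -> w p = c.
Proof.
move=> Hw wc p p0; apply/eqP; rewrite eq_le; apply/andP; split.
  apply: (@half_plane_le w s K) => // q /Hw [? ? wq]; split=> //.
  exact: le_trans (ler_norm _) wq.
rewrite -lerN2; apply: (@half_plane_le (fun p => - w p) s K) => // [q /Hw [cw hw wq]|x /wc H].
  split; [exact: continuousN|exact: harmN|].
  by apply: le_trans (ler_norm _) _; rewrite normrN.
move=> e /H [d d0 {}H]; exists d => // x' y xd yd.
by rewrite -opprD normrN; exact: H.
Qed.

End HalfPlaneUniqueness.

(** * Logarithmic and argument potentials *)

Section Potentials.
Context {R : realType} (nu : {measure set (measurableTypeR R) -> \bar R}) (a0 b0 : R).
Hypotheses (ab : a0 < b0) (nu_fin : (nu `]a0, b0]%classic < +oo)%E).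
Local Notation D := (`]a0, b0]%classic : set (measurableTypeR R)).
Implicit Types (k : R -> R -> R) (x y t : R) (p : R * R).

Lemma continuous_kernel_integrable (f : R -> R) :
  continuous f -> nu.-integrable D (EFin \o (f : measurableTypeR R -> R)).
Proof.
move=> cf; apply: measurable_bounded_integrable => //.
  apply: measurable_funTS; exact: continuous_measurable_fun.
have [c _ cM] := EVT_max (ltW ab) (continuous_subspaceT cf).
have [d _ dm] := EVT_min (ltW ab) (continuous_subspaceT cf).
exists (`|f c| + `|f d|); split=> [|M fM t /= Dt]; first exact: num_real.
apply: le_trans (ltW fM).
have tab : t \in `[a0, b0] by move: Dt; rewrite !in_itv /= => /andP[/ltW -> ->].
have := cM _ tab; have := dm _ tab; have := ler_norm (f c); have := ler_norm (- f d).
rewrite normrN ler_norml; have := normr_ge0 (f c); have := normr_ge0 (f d).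
by move=> *; apply/andP; split; lra.
Qed.

Lemma kernel_continuous (f df : R -> R) x : (forall z : R, is_derive z 1 f (df z)) ->
  continuous (fun t => f (x - t)).
Proof.
move=> fd t; have [+ _] := is_derive_reflect (fd (x - t)).
by move=> /derivable1_diffP/differentiable_continuous.
Qed.

(** The constant [|K|] dominates the derivatives for [s] near [a], and constants are integrable
    because [nu D] is finite. A local bound is what the kernels offer in the vertical direction, as
    they blow up at height 0. *)
Lemma integral_is_derive (f df : R -> R -> R) (a r K : R) : 0 < r ->
  (forall s t, `|s - a| < r -> is_derive s 1 (f ^~ t) (df s t)) ->
  (forall s t, `|s - a| < r -> `|df s t| <= K) ->
  (forall s, `|s - a| < r -> continuous (f s)) ->
  is_derive a 1 (fun s => \int[nu]_(t in D) f s t) (\int[nu]_(t in D) df a t).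
Proof.
move=> r0 fd dfK cf.
have I s : (`]a - r, a + r[%classic : set R) s -> `|s - a| < r.
  by rewrite /= in_itv /= ltr_norml => /andP[? ?]; apply/andP; split; lra.
have Ia : (`]a - r, a + r[%classic : set R) a.
  by rewrite /= in_itv /=; apply/andP; split; lra.
have dE s t : `|s - a| < r -> partial1of2 (f : R -> measurableTypeR R -> R) s t = df s t.
  by move=> sr; have [_ <-] := fd s t sr; rewrite partial1of2E.
have intf s : (`]a - r, a + r[%classic : set R) s -> nu.-integrable D (EFin \o (f s : measurableTypeR R -> R)).
  by move=> /I /cf; exact: continuous_kernel_integrable.
have derf s (t : measurableTypeR R) : (`]a - r, a + r[%classic : set R) s -> D t -> derivable (f ^~ t) s 1.
  by move=> /I sr _; have [] := fd s t sr.
have intG : nu.-integrable D (EFin \o (cst `|K| : measurableTypeR R -> R)).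
  by apply: continuous_kernel_integrable; exact: cst_continuous.
have G_ub s (t : measurableTypeR R) : (`]a - r, a + r[%classic : set R) s -> D t ->
    `|partial1of2 (f : R -> measurableTypeR R -> R) s t| <= (cst `|K| : measurableTypeR R -> R) t.
  by move=> /I sr _; rewrite dE // (le_trans (dfK _ _ sr)) // ler_norm.
have mD : measurable D by [].
apply: DeriveDef; first exact: (derivable_under_integral mD Ia intf derf _ intG G_ub).
rewrite -derive1E (differentiation_under_integral mD Ia intf derf _ intG G_ub) //.
by apply: eq_Rintegral => t _; rewrite dE // subrr normr0.
Qed.

Definition potential k p := \int[nu]_(t in D) k (p.1 - t) p.2.

Lemma potential_dx k kx p K : 0 < p.2 ->
  (forall x, is_derive x 1 (k ^~ p.2) (kx x p.2)) ->
  (forall x, `|kx x p.2| <= K) ->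
  is_derive p.1 1 (fun x => potential k (x, p.2)) (potential kx p).
Proof.
move=> p0 kd kK; apply: (@integral_is_derive (fun x t => k (x - t) p.2)
  (fun x t => kx (x - t) p.2) p.1 1 K) => //= s.
- move=> t _; have := @is_derive_shift _ (k ^~ p.2) (kx (s - t) p.2) (- t) s.
  rewrite (addrC (- t)) => /(_ (kd _)); apply: is_derive_eqf => //.
  by apply/funext => z; rewrite addrC.
- by move=> _; apply: (@kernel_continuous (k ^~ p.2)) => z; exact: kd.
Qed.

Lemma potential_dy k kx ky p (B : R -> R) : 0 < p.2 ->
  (forall x y, 0 < y -> is_derive x 1 (k ^~ y) (kx x y)) ->
  (forall x y, 0 < y -> is_derive y 1 (k x) (ky x y)) ->
  (forall x y, 0 < y -> `|ky x y| <= B y) ->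
  (forall y y', 0 < y -> y <= y' -> B y' <= B y) ->
  is_derive p.2 1 (fun y => potential k (p.1, y)) (potential ky p).
Proof.
move=> p0 kx' ky' kB mB; have r0 : 0 < p.2 / 2 by rewrite divr_gt0.
have near_pos s : `|s - p.2| < p.2 / 2 -> 0 < s /\ p.2 / 2 <= s.
  by rewrite ltr_norml => /andP[? ?]; split; lra.
apply: (@integral_is_derive (fun y t => k (p.1 - t) y)
  (fun y t => ky (p.1 - t) y) p.2 (p.2 / 2) (B (p.2 / 2))) => //= s.
- by move=> t /near_pos [s0 _]; exact: ky'.
- by move=> t /near_pos [s0 sp]; apply: le_trans (kB _ _ s0) _; exact: mB.
- by move=> /near_pos [s0 _]; apply: (@kernel_continuous (k ^~ s)) => z; exact: kx'.
Qed.

Lemma inv_anti (y y' : R) : 0 < y -> y <= y' -> y'^-1 <= y^-1.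
Proof. by move=> y0 yy'; rewrite lef_pV2 ?posrE //; exact: lt_le_trans yy'. Qed.

Lemma inv_sqr_anti (y y' : R) : 0 < y -> y <= y' -> y' ^- 2 <= y ^- 2.
Proof.
move=> y0 yy'; have y'0 : 0 < y' by exact: lt_le_trans yy'.
rewrite lef_pV2 ?posrE ?exprn_gt0 // ler_sqr ?nnegrE //; exact: ltW.
Qed.

Let q0 x y : 0 < y -> 0 < x ^+ 2 + y ^+ 2.
Proof. by move=> y0; apply: sqsum_gt0; rewrite gt_eqF. Qed.

(** The imaginary part of [1 / z ^+ 2]. It is the mixed second derivative of [logk] and the second
    [y]-derivative of [argk]; the second [x]-derivative of [argk] is its negative. *)
Definition crossk x y := - (x * y *+ 2) / (x ^+ 2 + y ^+ 2) ^+ 2.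

Lemma log_potential_dx p : 0 < p.2 ->
  is_derive p.1 1 (fun x => potential logk (x, p.2)) (potential rek p).
Proof.
move=> p0; apply: (@potential_dx _ _ _ (p.2)^-1 p0) => x; last exact: rek_bound.
exact/logk_dx/q0.
Qed.

Lemma log_potential_dy p : 0 < p.2 ->
  is_derive p.2 1 (fun y => potential logk (p.1, y)) (potential imk p).
Proof.
move=> p0; apply: (@potential_dy _ rek _ _ GRing.inv p0) => [x y y0|x y y0|x y y0|y y' y0].
- exact/logk_dx/q0.
- exact/logk_dy/q0.
- exact: imk_bound.
- exact: inv_anti.
Qed.

Lemma arg_potential_dx p : 0 < p.2 ->
  is_derive p.1 1 (fun x => potential argk (x, p.2)) (potential (fun x y => - imk x y) p).
Proof.
move=> p0; apply: (@potential_dx _ _ _ (p.2)^-1 p0) => x; last by rewrite normrN imk_bound.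
exact: argk_dx.
Qed.

Lemma arg_potential_dy p : 0 < p.2 ->
  is_derive p.2 1 (fun y => potential argk (p.1, y)) (potential rek p).
Proof.
move=> p0; apply: (@potential_dy _ (fun x y => - imk x y) _ _ GRing.inv p0) => [x y y0|x y y0|x y y0|y y' y0].
- exact: argk_dx.
- exact: argk_dy.
- exact: rek_bound.
- exact: inv_anti.
Qed.

Lemma potentialN k p : continuous (fun t => k (p.1 - t) p.2) ->
  potential (fun x y => - k x y) p = - potential k p.
Proof.
move=> ck; rewrite -mulN1r -RintegralZl //; last exact: continuous_kernel_integrable.
by apply: eq_Rintegral => t _; rewrite mulN1r.
Qed.

Lemma imk_continuous p : 0 < p.2 -> continuous (fun t => imk (p.1 - t) p.2).
Proof. by move=> p0; apply: (@kernel_continuous (imk ^~ p.2)) => z; exact/imk_dx/q0. Qed.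

Lemma crossk_continuous p : 0 < p.2 -> continuous (fun t => crossk (p.1 - t) p.2).
Proof.
move=> p0; apply: (@kernel_continuous (crossk ^~ p.2)) => z.
(* [crossk] is [- 2 rek imk], so its continuity follows from derivatives already computed. *)
have d1 := is_derive_fM (is_derive_affine (- 2) 0 z)
  (is_derive_fM (rek_dx (q0 z p0)) (imk_dx (q0 z p0))).
apply: is_derive_eqf d1 => //.
apply/funext => s; have := q0 s p0 => s0.
by rewrite /rek /imk /crossk; field; rewrite gt_eqF.
Qed.

Lemma arg_potential_harm p : 0 < p.2 -> harm (potential argk) p.
Proof.
move=> p0; exists (potential (fun x y => - crossk x y) p); split.
  apply: (@sym2_derive_derive2 _ (fun x => potential argk (x, p.2))
    (fun x => potential (fun x y => - imk x y) (x, p.2)) _ 1 _ ltr01) => [s _|].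
    by have := @arg_potential_dx (s, p.2) p0.
  apply: (@potential_dx _ _ _ (p.2 ^- 2) p0) => x; last by rewrite normrN; exact: cross_bound.
  have := imk_dx (q0 x p0) => h; have := is_derive_fM (is_derive_affine (- 1) 0 x) h.
  apply: is_derive_eqf; first by apply/funext => s; ring.
  by rewrite /crossk; ring.
rewrite potentialN ?opprK; last exact: crossk_continuous.
apply: (@sym2_derive_derive2 _ (fun y => potential argk (p.1, y))
    (fun y => potential rek (p.1, y)) _ p.2 _ p0) => [s sp|].
  have s0 : 0 < s by move: sp; rewrite ltr_norml => /andP[]; lra.
  by have := @arg_potential_dy (p.1, s) s0.
apply: (@potential_dy _ _ _ _ (fun y => y ^- 2) p0) => [x y y0|x y y0|x y y0|y y' y0].
- exact/rek_dx/q0.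
- exact/rek_dy/q0.
- exact: cross_bound.
- exact: inv_sqr_anti.
Qed.

Lemma arg_continuous p : 0 < p.2 -> continuous (fun t => argk (p.1 - t) p.2).
Proof. by move=> p0; apply: (@kernel_continuous (argk ^~ p.2)) => z; exact: argk_dx. Qed.

Lemma arg_potential_bounds p : 0 < p.2 -> 0 <= potential argk p <= pi * fine (nu D).
Proof.
move=> p0; apply/andP; split.
  by apply: Rintegral_ge0 => t _; have /andP[] := argk_bounds (p.1 - t) p.2.
rewrite -Rintegral_cst //; apply: le_Rintegral => //.
- by apply: continuous_kernel_integrable; exact: arg_continuous.
- by apply: continuous_kernel_integrable; exact: cst_continuous.
- by move=> t _; have /andP[] := argk_bounds (p.1 - t) p.2.
Qed.

End Potentials.

(** * Boundary behaviour and growth of the potentials *)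

Section PotentialLimits.
Context {R : realType} (nu : {measure set (measurableTypeR R) -> \bar R}) (a0 b0 : R).
Hypotheses (ab : a0 < b0) (nu_fin : (nu `]a0, b0]%classic < +oo)%E).
Local Notation D := (`]a0, b0]%classic : set (measurableTypeR R)).
Local Notation potential := (potential nu a0 b0).
Implicit Types (x y t z : R) (p : R * R).

(** As the height tends to 0, [argk (x - t)] tends to [pi] for [t > x] and to 0 for [t < x], so
    [pi * tail x] is the expected boundary value of the argument potential. *)
Definition tail z := fine (nu (D `&` `]z, +oo[%classic)).

Let mass := fine (nu D).

Let mD : measurable D.
Proof. by []. Qed.

Lemma integral_indic_affine z (c d : R) :
  nu.-integrable D (EFin \o ((fun t => c * \1_(`]z, +oo[%classic : set R) t + d) : measurableTypeR R -> R)) /\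
  \int[nu]_(t in D) (c * \1_(`]z, +oo[%classic : set R) t + d) = c * tail z + d * mass.
Proof.
have mI : measurable (`]z, +oo[%classic : set (measurableTypeR R)) by [].
have iI : nu.-integrable D (EFin \o (\1_(`]z, +oo[%classic) : measurableTypeR R -> R)).
  apply: measurable_bounded_integrable => //.
  exists 1; split=> [|M M1 t /= _]; first exact: num_real.
  by apply: le_trans (ltW M1); rewrite indicE ger0_norm // lern1 leq_b1.
have icI : nu.-integrable D (EFin \o ((fun t => c * \1_(`]z, +oo[%classic) t) : measurableTypeR R -> R)).
  by have := integrableZl mD c iI; apply: eq_integrable => // t _; rewrite /= EFinM.
have id : nu.-integrable D (EFin \o (cst d : measurableTypeR R -> R)).
  by apply: continuous_kernel_integrable => //; exact: cst_continuous.
split.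
  by have := integrableD mD icI id; apply: eq_integrable => // t _; rewrite /= EFinD.
rewrite RintegralD // RintegralZl // Rintegral_cst //; congr (_ * _ + _).
by rewrite /Rintegral integral_indic // setIC.
Qed.

(* argk (x - t, y) is close to 0 for t well below x and to pi for t well
   above it. *)
Lemma arg_potential_lim x :
  (forall e, 0 < e -> exists2 d, 0 < d & tail (x - d) <= tail (x + d) + e) ->
  (forall z z', z <= z' -> tail z' <= tail z) ->
  boundary_lim (potential argk) x (pi * tail x).
Proof.
move=> sm tail_mono e e0.
have pi0 : 0 < pi :> R by exact: pi_gt0.
have m0 : 0 <= mass by exact: fine_ge0.
have m1 : 0 < mass + 1 by lra.
have e1 : 0 < e / 2 / pi by rewrite !divr_gt0.
have e2 : 0 < e / 2 / (mass + 1) by rewrite !divr_gt0.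
have [d d0 Hd] := sm _ e1.
have d2 : 0 < d / 2 by rewrite divr_gt0.
have [r r0 Hr] := argk_at_right d2 e2.
exists (Num.min r (d / 2)); first by rewrite lt_min r0.
move=> x' y; rewrite !lt_min => /andP[_ xd] /and3P[y0 yr _].
have {}yr : 0 < y < r by rewrite y0.
have H t := Hr (x' - t) y yr.
have piE : pi * (e / 2 / pi) = e / 2 by rewrite mulrC divfK // gt_eqF.
have emE : e / 2 / (mass + 1) * mass < e / 2.
  rewrite mulrAC ltr_pdivrMr //; nra.
set e' := e / 2 / (mass + 1) in e2 H emE *.
have ia : nu.-integrable D (EFin \o ((fun t => argk (x' - t) y) : measurableTypeR R -> R)).
  by apply: continuous_kernel_integrable => //; exact: (@arg_continuous _ (x', y)).
have up : potential argk (x', y) <= pi * tail (x - d) + e' * mass.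
  have [i1 <-] := integral_indic_affine (x - d) pi e'.
  apply: le_Rintegral => // t _ /=.
  have /andP[a1 a2] := argk_bounds (x' - t) y.
  rewrite indicE mem_setE in_itv /= andbT; have [td|td] := ltP (x - d) t.
    by rewrite mulr1; lra.
  rewrite mulr0 add0r; have [+ _] := H t.
  by move: xd; rewrite ltr_norml => /andP[? ?] h; apply/ltW/h; lra.
have lo : pi * tail (x + d) - e' * mass <= potential argk (x', y).
  rewrite -mulNr; have [i1 <-] := integral_indic_affine (x + d) pi (- e').
  apply: le_Rintegral => // t _ /=.
  have /andP[a1 a2] := argk_bounds (x' - t) y.
  rewrite indicE mem_setE in_itv /= andbT; have [td|td] := ltP (x + d) t; last first.
    by rewrite mulr0; lra.
  rewrite mulr1; have [_ +] := H t.
  by move: xd; rewrite ltr_norml => /andP[? ?] h; apply/ltW/h; lra.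
have t1 : tail x <= tail (x - d) by apply: tail_mono; lra.
have t2 : tail (x + d) <= tail x by apply: tail_mono; lra.
have Hd' : pi * tail (x - d) <= pi * tail (x + d) + e / 2.
  by rewrite -piE -mulrDr ler_pM2l.
have t1' : pi * tail x <= pi * tail (x - d) by rewrite ler_pM2l.
have t2' : pi * tail (x + d) <= pi * tail x by rewrite ler_pM2l.
by rewrite ltr_norml; apply/andP; split; lra.
Qed.

Lemma logk_continuous p : 0 < p.2 -> continuous (fun t => logk (p.1 - t) p.2).
Proof.
move=> p0; apply: (@kernel_continuous _ (logk ^~ p.2)) => z.
by apply/logk_dx/sqsum_gt0; rewrite gt_eqF.
Qed.

Lemma log_potential_asymptotics : exists2 B, 1 <= B & forall y, B <= y ->
  ln y * mass <= potential logk (0, y) <= (ln y + 1) * mass.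
Proof.
exists (`|a0| + `|b0| + 1); first by have := normr_ge0 a0; have := normr_ge0 b0; lra.
move=> y By; have y1 : 1 <= y by have := normr_ge0 a0; have := normr_ge0 b0; lra.
have y0 : 0 < y by lra.
have il : nu.-integrable D (EFin \o ((fun t => logk (0 - t) y) : measurableTypeR R -> R)).
  by apply: continuous_kernel_integrable => //; exact: (@logk_continuous (0, y)).
have icst c : nu.-integrable D (EFin \o (cst c : measurableTypeR R -> R)).
  by apply: continuous_kernel_integrable => //; exact: cst_continuous.
have lny : ln (y ^+ 2) = ln y *+ 2 by rewrite lnXn.
rewrite /mass -!Rintegral_cst //; apply/andP; split;
  (apply: le_Rintegral; [exact: mD|by (exact: icst || exact: il)|by (exact: il || exact: icst)|]) => t Dt /=;
  rewrite sub0r /logk sqrrN.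
  rewrite ler_pdivlMr // mulr_natr -lny ler_ln ?posrE ?exprn_gt0 ?ltr_wpDl ?sqr_ge0 ?exprn_gt0 //.
  by rewrite lerDr sqr_ge0.
rewrite ler_pdivrMr // mulr_natr mulrnDl -lny.
have tB : `|t| <= y.
  move: Dt; rewrite /= in_itv /= => /andP[ta tb].
  have := ler_norm b0; have := ler_norm (- a0); rewrite normrN.
  by have := normr_ge0 a0; have := normr_ge0 b0; rewrite ler_norml => *; apply/andP; split; lra.
(* [|t| <= y] gives [t ^+ 2 + y ^+ 2 <= 2 y ^+ 2], and [expR 2 >= 3]; halving the logarithm turns
   [expR 2] into the summand 1. *)
apply: (@le_trans _ _ (ln (y ^+ 2 * expR 2))).
  rewrite ler_ln ?posrE ?mulr_gt0 ?expR_gt0 ?exprn_gt0 ?ltr_wpDl ?sqr_ge0 ?exprn_gt0 //.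
  have : 1 + 2 <= expR (2 : R) by exact: expR_ge1Dx.
  rewrite -(real_normK (num_real t)); have := normr_ge0 t; nra.
by rewrite lnM ?posrE ?expR_gt0 ?exprn_gt0 // expRK.
Qed.

Lemma half_ln_sqr x : 0 < x -> ln (x ^+ 2) / 2 = ln x.
Proof. by move=> x0; rewrite lnXn // -[_ *+ 2]mulr_natr mulfK // pnatr_eq0. Qed.

(** The logarithmic kernel is regularised by lifting the point to height [1 / (n + 1)]. On the
    diagonal the lifted value is [C + ln (n + 1)], which tends to infinity in accordance with
    [lne 0 = -oo]. *)
Lemma lne_abs_lim x t (C : R) :
  (C - logk (x - t) n.+1%:R^-1)%:E @[n --> \oo] --> (C%:E - lne (`|x - t|%:E))%E.
Proof.
have [xt|xt] := eqVneq (x - t) 0.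
  rewrite xt normr0; have -> : (C%:E - lne 0%:E)%E = +oo%E by rewrite /= lexx.
  apply/cvgeyPge => A; near=> n.
  rewrite lee_fin /logk expr0n /= add0r half_ln_sqr ?invr_gt0 // lnV ?posrE //.
  rewrite opprK -lerBlDl -[leLHS]expRK ler_ln ?posrE ?expR_gt0 //.
  apply: (@le_trans _ _ n%:R); last by rewrite ler_nat.
  by near: n; exact: nbhs_infty_ger.
have q0 : 0 < (x - t) ^+ 2 + 0 ^+ 2 by rewrite expr0n /= addr0 exprn_even_gt0.
have xt0 : 0 < `|x - t| by rewrite normr_gt0.
have -> : (C%:E - lne `|x - t|%:E)%E = (C - logk (x - t) 0)%:E.
  rewrite /lne leNgt xt0 /= /logk expr0n /= addr0 -real_normK ?num_real //.
  by rewrite half_ln_sqr.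
apply/cvg_EFin; first by near=> n.
apply: cvgB; first exact: cvg_cst.
apply: (@cvg_comp _ _ _ (fun n : nat => n.+1%:R^-1 : R) (logk (x - t)) _ (nbhs (0 : R))).
  exact: cvg_harmonic.
have [+ _] := logk_dy q0.
by move=> /derivable1_diffP/differentiable_continuous.
Unshelve. all: end_near. Qed.

(** The constant [C] makes the regularised kernels [C - logk (x - t) y] nonnegative for [y <= 1],
    and they increase as [y] decreases to 0; monotone convergence then identifies the integral on
    the boundary with the limit of potentials from above. *)
Lemma log_potential_boundary x (C L : R) :
  (forall t, D t -> logk (x - t) 1 <= C) ->
  potential logk (x, y) @[y --> 0^'+] --> L ->
  (\int[nu]_(t in D) (C%:E - lne (`|x - t|%:E)))%E = (C * mass - L)%:E.
Proof.
move=> HC HL.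
pose g (n : nat) t := (C - logk (x - t) n.+1%:R^-1)%:E.
have yn0 n : 0 < n.+1%:R^-1 :> R by rewrite invr_gt0.
have yn1 n : n.+1%:R^-1 <= 1 :> R by rewrite invf_le1 // ler1n.
have contg n : continuous (fun t => logk (x - t) n.+1%:R^-1).
  exact: (@logk_continuous (x, n.+1%:R^-1) (yn0 n)).
have mg n : measurable_fun D (g n : measurableTypeR R -> \bar R).
  apply/measurable_EFinP; apply: measurable_funTS; apply: measurable_funB; first exact: measurable_cst.
  exact: continuous_measurable_fun.
have g0 n t : D t -> (0 <= g n t)%E.
  move=> Dt; rewrite lee_fin subr_ge0; apply: le_trans (HC _ Dt); exact: logk_mono.
have ndg t : D t -> {homo g^~ t : n m / (n <= m)%N >-> (n <= m)%E}.
  move=> _ n m nm; rewrite lee_fin lerB // logk_mono // lef_pV2 ?posrE // ler_nat.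
  by rewrite ltnS.
have cv : (\int[nu]_(t in D) g n t)%E @[n --> \oo] -->
    (\int[nu]_(t in D) (C%:E - lne (`|x - t|%:E)))%E.
  rewrite (_ : (\int[nu]_(t in D) _)%E = (\int[nu]_(t in D) limn (g^~ t))%E).
    exact: cvg_monotone_convergence.
  by apply: eq_integral => t _; apply/esym/cvg_lim => //; exact: lne_abs_lim.
have gE n : (\int[nu]_(t in D) g n t)%E = (C * mass - potential logk (x, n.+1%:R^-1))%:E.
  have il : nu.-integrable D (EFin \o ((fun t => logk (x - t) n.+1%:R^-1) : measurableTypeR R -> R)).
    exact: continuous_kernel_integrable.
  have ic : nu.-integrable D (EFin \o (cst C : measurableTypeR R -> R)).
    by apply: continuous_kernel_integrable => //; exact: cst_continuous.
  rewrite /potential /= -Rintegral_cst // -RintegralB // /Rintegral fineK //.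
  apply: integrable_fin_num => //.
  by have := integrableB mD ic il; apply: eq_integrable => // t _; rewrite /= EFinB.
apply: (cvg_unique _ cv) => //; rewrite (_ : (fun n => _) = fun n => (C * mass - potential logk (x, n.+1%:R^-1))%:E); last by apply/funext.
apply/cvg_EFin; first by near=> n.
apply: cvgB; first exact: cvg_cst.
move/cvg_at_rightP : HL => /(_ (fun n => n.+1%:R^-1)); apply; split => //.
exact: cvg_harmonic.
Unshelve. all: end_near. Qed.

End PotentialLimits.

(** * The boundary measure *)

Section StieltjesMeasure.
Context {R : realType}.

Lemma stieltjes_measure (F : R -> R) : {homo F : x y / x <= y} ->
  (forall x e, 0 < e -> exists2 d, 0 < d & forall y, x <= y < x + d -> F y <= F x + e) ->
  exists nu : {measure set (measurableTypeR R) -> \bar R},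
    forall a b, a <= b -> nu `]a, b]%classic = (F b - F a)%:E.
Proof.
move=> ndF rcF.
have rc : right_continuous F.
  move=> x; apply/cvgrPdist_le => e e0; have [d d0 Hd] := rcF x e e0.
  rewrite /prop_near1 /nbhs /= /within /=; apply/nbhs_ballP; exists d => //= y.
  rewrite /ball /= ltr_norml => /andP[yd _] xy.
  have Fxy := ndF _ _ (ltW xy).
  have Fyd : F y <= F x + e by apply: Hd; rewrite ltW //=; lra.
  by rewrite ler_norml; apply/andP; split; lra.
pose mF := isCumulative.Build R _ R F ndF rc.
have [cF cFE] : exists f : cumulative R R, f = F :> (R -> R).
  pose cF : cumulative R R := HB.pack F mF.
  by exists cF.
exists (lebesgue_stieltjes_measure cF) => a b ab.
rewrite /= /lebesgue_stieltjes_measure /measure_extension /=.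
rewrite measurable_mu_extE /=; last exact: is_ocitv.
by rewrite wlength_itv_bnd // EFinB cFE.
Qed.

(** The sets are the half-open intervals with rational ends whose closure lies in [U], enumerated
    through all pairs of rationals, with [set0] for the unsuitable pairs. Closed containment matters
    because the distribution functions are understood only on segments inside [U]. *)
Lemma itv_cover (U : set R) : open U -> exists A : nat -> set (measurableTypeR R),
  (forall n, A n = set0 \/ exists2 pq : R * R, (pq.1 <= pq.2 /\ forall t, pq.1 <= t <= pq.2 -> U t) &
     A n = `]pq.1, pq.2]%classic) /\ \bigcup_n A n = U.
Proof.
move=> oU.
have [f fK] : exists f : nat -> option (rat * rat), forall z, exists n, f n = Some z.
  by exists unpickle => z; exists (pickle z); rewrite pickleK.
pose A (n : nat) : set (measurableTypeR R) := if f n is Some (p, q) then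
  if `[< ratr p <= ratr q :> R /\ forall t : R, ratr p <= t <= ratr q -> U t >]
  then `]ratr p, ratr q]%classic else set0 else set0 :> set R.
exists A; split=> [n|].
  rewrite /A; case: (f n) => [[p q]|]; last by left.
  by case: ifPn => [/asboolP pqU|_]; [right; exists (ratr p, ratr q)|left].
apply/seteqP; split => x.
  move=> [n _]; rewrite /A; case: (f n) => [[p q]|//]; case: ifPn => // /asboolP [_ pqU] /=.
  by rewrite in_itv /= => /andP[px xq]; apply: pqU; rewrite (ltW px).
move=> Ux; have /nbhs_ballP [d /= d0 dU] : nbhs x U by exact: open_nbhs_nbhs.
have xd1 : x - d < x by rewrite ltrBlDr ltrDl.
have xd2 : x < x + d by rewrite ltrDl.
have [p] := rat_in_itvoo xd1; rewrite in_itv /= => /andP[p1 p2].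
have [q] := rat_in_itvoo xd2; rewrite in_itv /= => /andP[q1 q2].
have [n fn] := fK (p, q); exists n; first exact: I.
rewrite /A fn; case: ifPn => [_|/asboolP []]; first by rewrite /= in_itv /= p2 ltW.
split; first by rewrite ltW // (lt_trans p2).
move=> t /andP[t1 t2]; apply: dU; rewrite /ball /= ltr_norml; apply/andP; split; lra.
Qed.

Lemma null_open (nu : {measure set (measurableTypeR R) -> \bar R}) (U : set R) :
  open U ->
  (forall c d, c <= d -> (forall t, c <= t <= d -> U t) -> nu `]c, d]%classic = 0%E) ->
  nu U = 0%E.
Proof.
move=> oU nU; have [A [AP UE]] := itv_cover oU.
have A0 n : nu (A n) = 0%E /\ measurable (A n).
  have [->|[[p q] [/= pq pqU] ->]] := AP n; first by rewrite measure0.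
  by split; [exact: nU|exact: measurable_itv].
have mU : measurable (U : set (measurableTypeR R)) by exact: open_measurable.
have UA : (U : set (measurableTypeR R)) `<=` \bigcup_n A n by rewrite UE.
apply/eqP; rewrite eq_le measure_ge0 andbT.
have le := @measure_sigma_subadditive _ _ _ nu U A (fun n => (A0 n).2) mU UA.
by apply: (le_trans le); rewrite eseries0 // => n _ _; exact: (A0 n).1.
Qed.

End StieltjesMeasure.

Section BoundaryMeasure.
Context {R : realType} (E : set R) (al be : R) (u ux uy h : R * R -> R) (s : seq R).
Hypotheses (cE : closed E) (bE : forall x, E x -> al <= x <= be) (albe : al <= be)
  (gu : green_fun E u) (su : smooth_harmonic (~` slit E) u ux uy)
  (hd : conjugate_plus u ux uy h)
  (hl : forall x, x < al -> boundary_lim h x 0)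
  (Es : forall x, x \notin s -> ~ E x \/ interior E x).
Implicit Types (x y z t : R) (p q : R * R).
Local Notation hp := (boundary_fun h).
Local Notation good := (bounded_gradient ux uy).

Lemma good_notin x : x \notin s -> good x.
Proof.
by move=> /Es [nE|iE]; [exact: bounded_gradient_off su _ nE|exact: bounded_gradient_interior gu su _ iE].
Qed.

Lemma good_near x : good x -> exists2 d, 0 < d & forall z, `|z - x| < d -> good z.
Proof.
move=> [K [d [d0 H]]]; exists (d / 2); first by rewrite divr_gt0.
move=> z zd; exists K, (d / 2); split; first by rewrite divr_gt0.
move=> p pz pd; apply: H; last by lra.
by have := ler_distD z p.1 x; lra.
Qed.

Lemma boundary_fun_near x e : good x -> 0 < e ->
  exists2 d, 0 < d & forall z, `|z - x| < d -> good z /\ `|hp z - hp x| <= e.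
Proof.
move=> gx e0; have [d1 d10 H1] := good_near gx; have e20 : 0 < e / 2 by lra.
have [d2 d20 H2] := boundary_funP hd gx e20.
exists (Num.min d1 d2); first by rewrite lt_min d10.
move=> z; rewrite lt_min => /andP[z1 z2]; have gz := H1 _ z1; split => //.
have [d3 d30 H3] := boundary_funP hd gz e20.
pose y := Num.min d2 d3 / 2.
have m0 : 0 < Num.min d2 d3 by rewrite lt_min d20.
have /andP[y0 ym] := half_between m0; rewrite -/y in y0 ym.
move: ym; rewrite lt_min => /andP[y2 y3].
have := H2 z y z2; have := H3 z y; rewrite subrr normr0 y0 y2 y3 => /(_ d30 isT) + /(_ isT).
by rewrite (distrC (hp z)); exact: dist_le_halves.
Qed.

(** Taking the infimum over good points strictly to the right makes the function right-continuous by
    construction and bypasses the meaningless default of [boundary_fun] at exceptional points. A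
    jump there remains possible at this stage. *)
Definition boundary_cdf x := inf [set - hp z / pi | z in [set z | x < z /\ good z]].
Local Notation F := boundary_cdf.

Let pi0 : 0 < pi :> R. Proof. exact: pi_gt0. Qed.

Lemma far_good x : be < x -> good x.
Proof. by move=> bx; apply: (bounded_gradient_off su) => /bE /andP[]; lra. Qed.

Lemma boundary_cdf_set_ge0 z : good z -> 0 <= - hp z / pi.
Proof.
move=> gz; rewrite divr_ge0 ?(ltW pi0) // oppr_ge0.
pose z' := Num.min z al - 1.
have z'm : z' < Num.min z al by rewrite ltrBlDr ltrDl.
move: z'm; rewrite lt_min => /andP[z'z z'al].
have nE : ~ E z' by move=> /bE /andP[]; lra.
have gz' := bounded_gradient_off su nE.
by have := boundary_fun_nonincreasing cE gu su hd gz' gz (ltW z'z);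
  rewrite (boundary_fun_left hl z'al).
Qed.

Lemma boundary_cdf_le x z : x < z -> good z -> F x <= - hp z / pi.
Proof.
move=> xz gz; apply: ge_inf; last by exists z.
by exists 0 => _ [w [_ gw] <-]; exact: boundary_cdf_set_ge0.
Qed.

Lemma boundary_cdf_ge x c : (forall z, x < z -> good z -> c <= - hp z / pi) -> c <= F x.
Proof.
move=> H; apply: lb_le_inf; last by move=> _ [z [xz gz] <-]; exact: H.
have m : Num.max x be < Num.max x be + 1 by rewrite ltrDl.
move: (m); rewrite gt_max => /andP[xm bm].
by exists (- hp (Num.max x be + 1) / pi), (Num.max x be + 1) => //; split => //; exact: far_good.
Qed.

Lemma boundary_cdf_nondecreasing : {homo F : x y / x <= y}.
Proof.
move=> x y xy; apply: boundary_cdf_ge => z yz gz; apply: boundary_cdf_le => //.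
exact: le_lt_trans yz.
Qed.

Lemma boundary_cdf_rc x e : 0 < e ->
  exists2 d, 0 < d & forall y, x <= y < x + d -> F y <= F x + e.
Proof.
move=> e0; have [z [xz gz] Hz] : exists2 z, x < z /\ good z & - hp z / pi < F x + e.
  apply: contrapT => nH; suff : F x + e <= F x by rewrite gerDl leNgt e0.
  apply: boundary_cdf_ge => z xz gz; rewrite leNgt; apply/negP => Hz.
  by apply: nH; exists z.
exists (z - x); first by rewrite subr_gt0.
move=> y /andP[xy]; rewrite addrC subrK => yz.
by apply: le_trans (ltW Hz); exact: boundary_cdf_le.
Qed.

Lemma boundary_cdf_good x : good x -> F x = - hp x / pi.
Proof.
move=> gx; apply/eqP; rewrite eq_le; apply/andP; split; last first.
  apply: boundary_cdf_ge => z xz gz; rewrite ler_pM2r ?invr_gt0 // lerN2.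
  exact: (boundary_fun_nonincreasing cE gu su hd gx gz (ltW xz)).
apply/ler_addgt0Pr => e e0; have ep : 0 < e * pi by rewrite mulr_gt0.
have [d d0 H] := boundary_fun_near gx ep.
have /andP[d2 d2'] := half_between d0.
have [] := H (x + d / 2); first by rewrite addrC addKr gtr0_norm.
move=> gz hz; apply: (@le_trans _ _ (- hp (x + d / 2) / pi)).
  by apply: boundary_cdf_le => //; rewrite ltrDl.
rewrite ler_pdivrMr // mulrDl divfK ?gt_eqF //.
by move: hz; rewrite ler_norml => /andP[? ?]; lra.
Qed.

Lemma boundary_cdf_left x : x < al -> F x = 0.
Proof.
move=> xal; rewrite boundary_cdf_good; first by rewrite (boundary_fun_left hl xal) oppr0 mul0r.
by apply: (bounded_gradient_off su) => /bE /andP[]; lra.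
Qed.

Lemma boundary_cdf_cst_off c d : c <= d -> (forall t, c <= t <= d -> ~ E t) -> F d = F c.
Proof.
move=> cd nE; rewrite !boundary_cdf_good; try by apply: (bounded_gradient_off su); apply: nE; rewrite ?lexx ?cd.
congr (- _ / _); apply: (boundary_fun_cst_off cE gu su hd) => t [/nE //|].
by move=> /andP[dt tc]; apply: nE; lra.
Qed.

Lemma boundary_cdf_right x x' : be < x -> be < x' -> F x = F x'.
Proof.
wlog xx' : x x' / x <= x' => [H|] bx bx'.
  by have [/H|/ltW /H xx'] := leP x x'; [apply|rewrite xx'].
by apply/esym/boundary_cdf_cst_off => // t /andP[xt _] /bE /andP[_]; lra.
Qed.

End BoundaryMeasure.

(** * Representation of h and u by the boundary measure *)

Section Representation.
Context {R : realType} (E : set R) (al be : R) (u ux uy h : R * R -> R) (s : seq R).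
Hypotheses (cE : closed E) (bE : forall x, E x -> al <= x <= be) (albe : al <= be)
  (gu : green_fun E u) (su : smooth_harmonic (~` slit E) u ux uy)
  (hd : conjugate_plus u ux uy h)
  (hl : forall x, x < al -> boundary_lim h x 0)
  (Es : forall x, x \notin s -> ~ E x \/ interior E x).
Implicit Types (x y z t : R) (p q : R * R).
Local Notation hp := (boundary_fun h).
Local Notation good := (bounded_gradient ux uy).
Local Notation F := (boundary_cdf ux uy h).
Local Notation a0 := (al - 1).
Local Notation b0 := (be + 1).
Local Notation D := (`]a0, b0]%classic : set (measurableTypeR R)).

Let ab : a0 < b0.
Proof. by apply: (@lt_le_trans _ _ be); [apply: lt_le_trans albe; rewrite ltrBlDr ltrDl|rewrite lerDl]. Qed.
Let pi0 : 0 < pi :> R. Proof. exact: pi_gt0. Qed.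

Section WithMeasure.
Context (nu : {measure set (measurableTypeR R) -> \bar R}).
Hypothesis nuF : forall a b, a <= b -> nu `]a, b]%classic = (F b - F a)%:E.
Local Notation tl := (tail nu a0 b0).
Local Notation potential := (potential nu a0 b0).

Let Fa0 : F a0 = 0.
Proof. by apply: (boundary_cdf_left cE bE gu su hd hl); lra. Qed.

Lemma mass_cdf : nu D = (F b0)%:E.
Proof. by rewrite nuF ?Fa0 ?subr0 // ltW. Qed.

Let nu_fin : (nu D < +oo)%E.
Proof. by rewrite mass_cdf ltry. Qed.

Let mono_F : {homo F : x y / x <= y}.
Proof. exact: (boundary_cdf_nondecreasing cE bE gu su hd hl). Qed.

Lemma tail_cdf z : tl z = F b0 - F z.
Proof.
rewrite /tail; have [za|za] := ltP z a0.
  rewrite (_ : _ `&` _ = D); last first.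
    apply/seteqP; split=> t; first by case.
    by move=> Dt; split=> //; move: Dt; rewrite /= !in_itv /= andbT => /andP[]; lra.
  rewrite mass_cdf /= (_ : F z = 0) ?subr0 //.
  by apply: (boundary_cdf_left cE bE gu su hd hl); lra.
have [zb|zb] := leP z b0.
  rewrite (_ : _ `&` _ = `]z, b0]%classic) ?nuF //.
  apply/seteqP; split=> t; rewrite /= !in_itv /= ?andbT.
    by move=> [/andP[_ ->] ->].
  by move=> /andP[zt tb]; split=> //; rewrite tb andbT; exact: le_lt_trans zt.
rewrite (_ : _ `&` _ = set0); last first.
  apply/seteqP; split=> // t [] /=; rewrite !in_itv /= andbT => /andP[_ tb] zt.
  by lra.
rewrite measure0 /= (@boundary_cdf_right _ E al be u ux uy h cE bE gu su hd hl z b0) ?subrr //; lra.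
Qed.

Lemma tail_nonincreasing z z' : z <= z' -> tl z' <= tl z.
Proof. by move=> /mono_F; rewrite !tail_cdf; lra. Qed.

Lemma tail_continuous x e : good x -> 0 < e ->
  exists2 d, 0 < d & tl (x - d) <= tl (x + d) + e.
Proof.
move=> gx e0; have ep : 0 < e * pi / 2 by rewrite divr_gt0 // mulr_gt0.
have [d d0 H] := boundary_fun_near hd gx ep.
have /andP[d2 d2'] := half_between d0; exists (d / 2) => //.
have [g1 h1] : good (x - d / 2) /\ `|hp (x - d / 2) - hp x| <= e * pi / 2.
  by apply: H; rewrite addrC addKr normrN gtr0_norm.
have [g2 h2] : good (x + d / 2) /\ `|hp (x + d / 2) - hp x| <= e * pi / 2.
  by apply: H; rewrite addrC addKr gtr0_norm.
rewrite !tail_cdf (boundary_cdf_good cE bE gu su hd hl g1) (boundary_cdf_good cE bE gu su hd hl g2).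
suff : - hp (x + d / 2) / pi <= - hp (x - d / 2) / pi + e by lra.
rewrite ler_pdivrMr // mulrDl divfK ?gt_eqF //.
by move: h1 h2; rewrite !ler_norml => /andP[? ?] /andP[? ?]; lra.
Qed.

Lemma potential_bound k (K : R) p : continuous (fun t => k (p.1 - t) p.2) ->
  (forall x, `|k x p.2| <= K) -> `|potential k p| <= K * fine (nu D).
Proof.
move=> ck kK.
have ik := continuous_kernel_integrable ab nu_fin ck.
have ic c := continuous_kernel_integrable ab nu_fin (@cst_continuous R R c).
have mD : measurable D by [].
rewrite ler_norml -mulNr -!(Rintegral_cst nu mD); apply/andP; split.
  by apply: (le_Rintegral mD (ic (- K)) ik) => t _; have := kK (p.1 - t); rewrite ler_norml => /andP[].
by apply: (le_Rintegral mD ik (ic K)) => t _; have := kK (p.1 - t); rewrite ler_norml => /andP[].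
Qed.

Lemma arg_potential_continuous p : 0 < p.2 -> {for p, continuous (potential argk)}.
Proof.
move=> p0; have p20 : 0 < p.2 / 2 by rewrite divr_gt0.
apply: (@continuous_of_bounded_partials _ (potential argk)
  (potential (fun x y => - imk x y)) (potential rek) p ((p.2 / 2)^-1 * fine (nu D)) (p.2 / 2)) => // q _.
rewrite ltr_norml => /andP[q2 _].
have q0 : 0 < q.2 by lra.
have inv : (q.2)^-1 <= (p.2 / 2)^-1 by apply: inv_anti; lra.
have sq x : 0 < x ^+ 2 + q.2 ^+ 2 by apply: sqsum_gt0; rewrite gt_eqF.
split.
- exact: arg_potential_dx.
- exact: arg_potential_dy.
- rewrite potentialN //; last exact: imk_continuous.
  rewrite normrN; apply: potential_bound => [|x]; first exact: imk_continuous.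
  exact: le_trans (imk_bound _ q0) inv.
- apply: potential_bound => [|x]; last exact: le_trans (rek_bound _ q0) inv.
  by apply: (@kernel_continuous _ (rek ^~ q.2)) => z; exact: rek_dx.
Qed.

Lemma conjugate_continuous p : 0 < p.2 -> {for p, continuous h}.
Proof.
move=> p0; have [_ _ cx cy] := partials su (upper_not_slit (E := E) p0).
move/continuous_pairP : cx => /(_ _ ltr01) [d1 d10 cx].
move/continuous_pairP : cy => /(_ _ ltr01) [d2 d20 cy].
apply: (@continuous_of_bounded_partials _ h (fun q => - uy q) ux p
  (`|ux p| + `|uy p| + 1) (Num.min (p.2) (Num.min d1 d2))).
  by rewrite !lt_min p0 d10.
move=> q; rewrite !lt_min => /and3P[_ q1 q1'] /and3P[q0 q2 q2'].
have q0' : 0 < q.2 by move: q0; rewrite ltr_norml => /andP[]; lra.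
have [h1 h2] := hd q0'; split => //.
  rewrite normrN; have := cy _ _ q1' q2'; rewrite -surjective_pairing => h3.
  by have := ler_normD (uy q - uy p) (uy p); rewrite subrK; have := normr_ge0 (ux p); lra.
have := cx _ _ q1 q2; rewrite -surjective_pairing => h3.
by have := ler_normD (ux q - ux p) (ux p); rewrite subrK; have := normr_ge0 (uy p); lra.
Qed.

Lemma conjugate_plus_harm p : 0 < p.2 -> harm h p.
Proof.
move=> p0; apply: (@conjugate_harm _ [set p | 0 < p.2] u ux uy h) => //.
- rewrite (_ : [set p | _] = snd @^-1` `]0, +oo[%classic); last first.
    by apply/seteqP; split=> q /=; rewrite in_itv /= andbT.
  by apply: open_comp => // q _; exact: cvg_snd.
- have [uxx [uxy H]] := su; exists uxx, uxy => q q0; apply: H; exact: upper_not_slit.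
Qed.

(** The difference of [h] and the argument potential is bounded and harmonic. At [x] outside [s] its
    boundary value is [hp x - pi * (F b0 - F x)], which is [- pi * F b0] since [F x = - hp x / pi];
    Phragmen-Lindelof makes it constant. *)
Lemma conjugate_eq_potential p : 0 < p.2 -> h p = potential argk p - pi * F b0.
Proof.
have [K HK] := conj_bounded cE bE gu su hd hl.
move=> p0; suff : h p - potential argk p = - (pi * F b0) by lra.
apply: (@half_plane_cst _ (fun p => h p - potential argk p) s (K + pi * fine (nu D))) => // [q q0|x xs].
  split.
  - by apply: continuousB; [exact: conjugate_continuous|exact: arg_potential_continuous].
  - by apply: harmB; [exact: conjugate_plus_harm|exact: arg_potential_harm].
  - have /andP[b1 b2] := arg_potential_bounds ab nu_fin q0.
    apply: le_trans (ler_normB _ _) _; rewrite (ger0_norm b1); exact: lerD (HK _ q0) b2.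
have gx := good_notin gu su Es xs; have h1 := boundary_funP hd gx.
have h2 := arg_potential_lim ab nu_fin (fun e => tail_continuous gx) tail_nonincreasing.
have -> : - (pi * F b0) = hp x - pi * tl x.
  rewrite tail_cdf (boundary_cdf_good cE bE gu su hd hl gx) mulrBr mulrCA mulfV ?gt_eqF //.
  by ring.
move=> e e0; have e20 : 0 < e / 2 by lra.
have [d1 d10 {}h1] := h1 _ e20; have [d2 d20 {}h2] := h2 _ e20.
exists (Num.min d1 d2); first by rewrite lt_min d10.
move=> x' y; rewrite !lt_min => /andP[x1 x2] /and3P[y0 y1 y2].
have y01 : 0 < y < d1 by rewrite y0. have y02 : 0 < y < d2 by rewrite y0.
have := h1 _ _ x1 y01; have := h2 _ _ x2 y02; rewrite !ltr_norml.
by move=> /andP[? ?] /andP[? ?]; apply/andP; split; lra.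
Qed.

(** By the Cauchy-Riemann equations the gradient of [u] is read off from [h], and that of the
    logarithmic potential from the argument potential. As these conjugates differ by a constant,
    [u - potential logk] has zero gradient in the half-plane. *)
Lemma green_eq_potential : exists V, forall p, 0 < p.2 -> u p = V + potential logk p.
Proof.
pose w p := u p - potential logk p.
have wx p : 0 < p.2 -> is_derive p.1 1 (fun x => w (x, p.2)) 0.
  move=> p0; have [d1 _ _ _] := partials su (upper_not_slit (E := E) p0).
  have d2 := log_potential_dx ab nu_fin p0.
  have [_ e1] := hd p0; have e2 := arg_potential_dy ab nu_fin p0.
  have e3 : is_derive p.2 1 (fun t => h (p.1, t)) (potential rek p).
    apply/is_deriveP => e e0; move/is_deriveP : e2 => /(_ _ e0) [d d0 H].
    exists (Num.min d p.2); first by rewrite lt_min d0.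
    move=> r; rewrite lt_min => /andP[rd rp].
    have r0 : 0 < (p.1, p.2 + r).2 by move: rp; rewrite ltr_norml /= => /andP[]; lra.
    have p0' : 0 < (p.1, p.2).2 by [].
    rewrite (conjugate_eq_potential r0) (conjugate_eq_potential p0').
    have := H _ rd; set X := potential argk _; set Y := potential argk _.
    by rewrite (_ : X - _ - (Y - _) = X - Y) //; ring.
  by have := is_derive_fB d1 d2; rewrite (is_derive_unique e1 e3) subrr.
have wy p : 0 < p.2 -> is_derive p.2 1 (fun y => w (p.1, y)) 0.
  move=> p0; have [_ d1 _ _] := partials su (upper_not_slit (E := E) p0).
  have d2 := log_potential_dy ab nu_fin p0.
  have [e1 _] := hd p0; have e2 := arg_potential_dx ab nu_fin p0.
  have e3 : is_derive p.1 1 (fun t => h (t, p.2)) (potential (fun x y => - imk x y) p).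
    have -> : (fun t => h (t, p.2)) = (fun t => potential argk (t, p.2) - pi * F b0).
      by apply/funext => t; rewrite conjugate_eq_potential.
    have := is_derive_fB e2 (is_derive_affine (pi * F b0) 0 p.1); rewrite subr0.
    by apply: is_derive_eqf => //; apply/funext => t; rewrite mul0r addr0.
  have := is_derive_unique e1 e3; rewrite potentialN //; last exact: imk_continuous.
  by move=> /oppr_inj E1; have := is_derive_fB d1 d2; rewrite E1 subrr.
exists (w (0, 1)) => -[x y] /= y0; suff <- : w (x, y) = w (0, 1) by rewrite /w subrK.
transitivity (w (0, y)).
  apply: (@mean_value_eq _ (fun t => w (t, y)) (fun=> 0)) => // t _.
  exact: (wx (t, y) y0).
apply: (@mean_value_eq _ (fun t => w (0, t)) (fun=> 0)) => // t ty.
have t0 : 0 < (0 : R, t).2 by case: ty => /andP[? ?] /=; lra.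
exact: (wy (0, t) t0).
Qed.

(* Comparison of the logarithmic growth of both sides of u = V + potential. *)
Lemma mass_one : F b0 = 1.
Proof.
have [V HV] := green_eq_potential; have [_ _ _ [M [r uM]]] := gu.
have [B B1 HB] := log_potential_asymptotics ab nu_fin.
have mE : fine (nu D) = F b0 by rewrite mass_cdf.
rewrite mE in HB.
have F0 : 0 <= F b0 by rewrite -Fa0; apply: mono_F; exact: ltW.
(* At the point [i expR T] the Green function is [T] up to [M], and the potential lies between
   [T * F b0] and [(T + 1) * F b0]; a large [T] forces [F b0 = 1]. *)
have key T : 0 <= T -> B <= expR T -> r < expR T -> `|(F b0 - 1) * T| <= M + `|V| + F b0.
  move=> T0 BT rT; have e0 := expR_gt0 T.
  have sE : Num.sqrt (sqnorm (0, expR T)) = expR T :> R.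
    by rewrite /sqnorm /= expr0n add0r sqrtr_sqr gtr0_norm.
  have := uM (0, expR T); rewrite sE expRK => /(_ rT).
  have := HB _ BT; rewrite expRK => /andP[h1 h2].
  rewrite (HV (0, expR T) e0) !ler_norml => /andP[h3 h4].
  have := ler_norm V; have := ler_norm (- V); rewrite normrN => ? ?.
  by apply/andP; split; lra.
apply/eqP; rewrite -subr_eq0; apply: contraT => ne.
have n0 : 0 < `|F b0 - 1| by rewrite normr_gt0.
have K0 := normr_ge0 (M + `|V| + F b0).
pose T := `|B| + `|r| + (`|M + `|V| + F b0| + 1) / `|F b0 - 1|.
have q0 : 0 < (`|M + `|V| + F b0| + 1) / `|F b0 - 1| by rewrite divr_gt0 //; lra.
have eT : 1 + T <= expR T by exact: expR_ge1Dx.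
have T0 : 0 <= T by rewrite /T; have := normr_ge0 B; have := normr_ge0 r; lra.
have BT : B <= expR T.
  by apply: le_trans eT; rewrite /T; have := ler_norm B; have := normr_ge0 r; lra.
have rT : r < expR T.
  by apply: lt_le_trans eT; rewrite /T; have := ler_norm r; have := normr_ge0 B; lra.
have := key _ T0 BT rT; rewrite normrM (ger0_norm T0).
have : `|M + `|V| + F b0| + 1 <= `|F b0 - 1| * T.
  rewrite mulrC -ler_pdivrMr // /T; have := normr_ge0 B; have := normr_ge0 r; lra.
by have := ler_norm (M + `|V| + F b0); lra.
Qed.

Lemma null_off_E : nu (~` E) = 0%E.
Proof.
apply: null_open => [|c d cd nE]; first by rewrite openC.
by rewrite nuF // (boundary_cdf_cst_off cE bE gu su hd hl cd nE) subrr.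
Qed.

Lemma mass_setT : nu setT = 1%E.
Proof.
have mE : measurable (E : set (measurableTypeR R)) by exact: closed_measurable.
have ED : (E : set (measurableTypeR R)) `<=` D.
  by move=> x /bE /andP[? ?]; rewrite /= in_itv /=; apply/andP; split; lra.
have nuDE : nu (D `\` E) = 0%E.
  apply/eqP; rewrite eq_le measure_ge0 andbT -null_off_E le_measure ?inE //.
  - by apply: measurableD.
  - exact: measurableC.
have nuE : nu E = 1%E.
  rewrite -mass_one -mass_cdf -(setDUK ED) measureU ?setDIK //.
    by rewrite [X in (_ + X)%E]nuDE adde0.
  exact: measurableD.
rewrite -(setUv (E : set (measurableTypeR R))) measureU ?setICr //; last exact: measurableC.
by rewrite [X in (_ + X)%E]null_off_E adde0.
Qed.

End WithMeasure.

(** [u] is continuous and vanishes on [E], so above any [x] in [E], endpoints included, the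
    logarithmic potential tends to [- V]. The last clause states the resulting constancy on [E] with
    a kernel shifted by [C] to be nonnegative. *)
Lemma green_representation :
  exists (nu : {measure set (measurableTypeR R) -> \bar R}) (V : R),
  [/\ nu setT = 1%E, nu (~` E) = 0%E,
      forall p, 0 < p.2 -> h p = potential nu a0 b0 argk p - pi &
      forall x C, E x -> (forall t, D t -> logk (x - t) 1 <= C) ->
        (\int[nu]_(t in D) (C%:E - lne (`|x - t|%:E)))%E = (C + V)%:E].
Proof.
have [nu nuF] := stieltjes_measure (boundary_cdf_nondecreasing cE bE gu su hd hl)
  (boundary_cdf_rc cE bE gu su hd hl).
have [V HV] := green_eq_potential nuF.
have M1 := mass_one nuF.
have mass1 : nu D = 1%E by rewrite mass_cdf // M1.
have nu_fin : (nu D < +oo)%E by rewrite mass1 ltry.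
exists nu, V; split.
- exact: mass_setT.
- exact: null_off_E.
- by move=> p p0; rewrite (conjugate_eq_potential nuF p0) M1 mulr1.
move=> x C Ex HC.
have -> : C + V = C * fine (nu D) - - V by rewrite mass1 mulr1 opprK.
apply: log_potential_boundary => //.
have [cu _ u0 _] := gu; have ux0 : u (x, 0) = 0 by apply: u0; split.
apply/cvgrPdist_lt => e e0; have /continuous_pairP /(_ _ e0) [d d0 H] := cu (x, 0).
rewrite /prop_near1 /nbhs /= /within /=; apply/nbhs_ballP; exists d => //= y.
rewrite /ball /= sub0r normrN => yd y0.
have := H x y; rewrite /= subrr normr0 subr0 => /(_ d0 yd).
rewrite ux0 subr0 (HV (x, y) y0) => h1.
by rewrite -normrN opprD !opprK.
Qed.

End Representation.

(** * Positive definiteness of the logarithmic kernel *)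

Section BoxKernel.
Context {R : realType}.
Implicit Types (x y a r : R).
Local Notation TR := (measurableTypeR R).
Local Notation leb := (@lebesgue_measure R).

Definition tri r x : R := Num.max (r - `|x|) 0.
Definition box r x a : R := \1_(`]0, r]%classic : set R) (x - a).

Lemma boxE r x a : box r x a = \1_(`]a, a + r]%classic : set R) x.
Proof.
rewrite /box !indicE !mem_setE !in_itv /= subr_gt0 lerBlDl.
by [].
Qed.

Lemma tri_box r x y : 0 <= r ->
  (\int[leb]_a (box r x a * box r y a)%:E = (tri r (x - y))%:E)%E.
Proof.
move=> r0.
have E a : box r x a * box r y a = \1_(`[Num.max x y - r, Num.min x y[%classic : set R) a.
  rewrite !boxE !indicE !mem_setE !in_itv /= -natrM mulnb lt_min lerBlDr ge_max.
  by congr (_%:R); rewrite andbACA andbC.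
under eq_integral do rewrite E.
rewrite integral_indic // setIT.
have := @lebesgue_measure_itv R `[Num.max x y - r, Num.min x y[; rewrite /= lte_fin -EFinB => ->.
rewrite /tri; have [xy|xy] := leP x y.
  rewrite ler0_norm ?subr_le0 // ; case: ifPn => [h|]; last rewrite -leNgt => h.
    by rewrite max_l; [congr (_%:E)|]; lra.
  by rewrite max_r //; lra.
rewrite gtr0_norm ?subr_gt0 //; case: ifPn => [h|]; last rewrite -leNgt => h.
  by rewrite max_l; [congr (_%:E)|]; lra.
by rewrite max_r //; lra.
Qed.

Section Pair.
Context (m1 m2 : probability TR R).

(** [tri r (x - y)] is the integral over [a] of a product of two box functions, so Tonelli turns its
    energy into an integral of products of masses; this is the source of positive definiteness. *)
Lemma integral_tri r : 0 <= r ->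
  (\int[m1 \x m2]_z (tri r (z.1 - z.2))%:E =
   \int[leb]_a (m1 `]a, (a + r)%R]%classic * m2 `]a, (a + r)%R]%classic))%E.
Proof.
move=> r0.
pose f (q : (TR * TR) * TR) := (box r q.1.1 q.2 * box r q.1.2 q.2)%:E.
have mf : measurable_fun setT f.
  apply/measurable_EFinP; apply: measurable_funM; apply: measurableT_comp;
    try exact: measurable_indic; apply: measurable_funB; try exact: measurable_snd.
    by apply: measurableT_comp; [exact: measurable_fst|exact: measurable_fst].
  by apply: measurableT_comp; [exact: measurable_snd|exact: measurable_fst].
have f0 q : (0 <= f q)%E by rewrite lee_fin mulr_ge0 // /box indicE.
transitivity (\int[m1 \x m2]_z \int[leb]_a f (z, a))%E.
  by apply: eq_integral => z _; rewrite -tri_box.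
pose P : probability (TR * TR)%type R := (m1 \x m2)%E.
rewrite (@fubini_tonelli _ _ _ _ _ P leb f mf f0).
apply: eq_integral => a _.
set I := `]a, (a + r)%R]%classic : set TR.
have mI : measurable I by exact: measurable_itv.
transitivity (\int[m1 \x m2]_z (\1_(I `*` I) z)%:E)%E.
  apply: eq_integral => -[x y] _; rewrite /f /= !boxE !indicE -natrM mulnb.
  by rewrite in_setX.
rewrite integral_indic ?setIT; [|by []|exact: measurableX]. exact: product_measure1E.
Qed.

End Pair.

End BoxKernel.

Section LogKernel.
Context {R : realType}.
Implicit Types (x y a r t L : R).
Local Notation TR := (measurableTypeR R).
Local Notation leb := (@lebesgue_measure R).

Lemma integral_derive (F f : R -> R) (a b : R) : a < b ->
  (forall x, a <= x <= b -> is_derive x 1 F (f x)) ->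
  (forall x, a <= x <= b -> {for x, continuous f}) ->
  (\int[leb]_(x in `[a, b]) (f x)%:E = (F b - F a)%:E)%E.
Proof.
move=> ab dF cf; rewrite EFinB.
have cF x : a <= x <= b -> {for x, continuous F} by move=> /dF [/derivable1_diffP/differentiable_continuous].
apply: continuous_FTC2 => //.
- apply: continuous_in_subspaceT => x /set_mem /=; rewrite in_itv /= => xab; exact: cf.
- split=> [x||].
  + rewrite in_itv /= => /andP[ax xb]; have xab : a <= x <= b by rewrite !ltW.
    by case: (dF _ xab).
  + by apply: cvg_at_right_filter; apply: cF; rewrite lexx ltW.
  + by apply: cvg_at_left_filter; apply: cF; rewrite lexx ltW.
- move=> x; rewrite in_itv /= => /andP[ax xb]; have xab : a <= x <= b by rewrite !ltW.
  by rewrite derive1E; apply: derive_val; exact: dF.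
Qed.

(** The kernel [ln (L / |t|)] truncated at 0. Its integrals always exist in [[0, +oo]], and on a set
    of diameter at most [L] it differs from the logarithmic kernel by the constant [ln L] only. *)
Definition log_kernel L t : \bar R := (maxe 0%R%:E ((ln L)%:E - lne (`|t|%:E)))%E.

(** A convex function [k] vanishing beyond [L] is the superposition of [max (r - t, 0)] with density
    [k''(r)]. For [k = ln (L / t)] this is [r ^- 2] on []0, L]], and the corner at [L] adds a point
    mass [L^-1], whence the separate term [L^-1 * tri L] below. *)
Definition weight L r : R := if 0 < r <= L then r ^- 2 else 0.

Lemma weight_ge0 L r : 0 <= weight L r.
Proof. by rewrite /weight; case: ifP => // _; rewrite invr_ge0 sqr_ge0. Qed.

Lemma measurable_weight L : measurable_fun [set: TR] (weight L : TR -> R).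
Proof.
have -> : weight L = (fun r => r ^- 2) \_ `](0%R : R), L].
  by apply/funext => r; rewrite patchE mem_setE in_itv.
have mD : measurable (`](0 : R), L]%classic : set TR) by [].
apply/(@measurable_restrictT _ _ TR TR _ _ mD).
apply: (@measurable_funS _ _ TR TR (`]0, +oo[%classic : set R)); first exact: measurable_itv.
  by move=> r /=; rewrite !in_itv /= andbT => /andP[].
apply: open_continuous_measurable_fun; first exact: interval_open.
move=> r; rewrite mem_setE in_itv /= andbT => r0.
apply: cvgV; first by rewrite expf_neq0 // lt0r_neq0.
by apply: cvgM; exact: cvg_id.
Qed.

Lemma tri_ge0 r t : 0 <= tri r t.
Proof. by rewrite /tri le_max lexx orbT. Qed.

Lemma measurable_shell L t :
  measurable_fun [set: TR] ((fun r => (weight L r * tri r t)%:E) : TR -> \bar R).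
Proof.
apply/measurable_EFinP; apply: measurable_funM; first exact: measurable_weight.
apply: measurable_maxr => //; exact: measurable_funB.
Qed.

Lemma shell_integral_pos L t : 0 < t -> t < L ->
  (\int[leb]_r (weight L r * tri r t)%:E = (ln L - ln t + t / L - 1)%:E)%E.
Proof.
move=> t0 tL; transitivity (\int[leb]_(r in `[t, L]) (r ^- 2 * (r - t))%:E)%E.
  rewrite [RHS]integral_mkcond; apply: eq_integral => r _.
  rewrite patchE mem_setE in_itv /= /tri /weight (gtr0_norm t0).
  have [tr|rt] := leP t r.
    rewrite (lt_le_trans t0 tr) /= ; case: ifP => _; last by rewrite mul0r.
    by rewrite max_l // subr_ge0.
  have -> : Num.max (r - t) 0 = 0 by rewrite max_r // subr_le0 ltW.
  by rewrite mulr0.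
pose F r := ln r + t * r^-1.
have -> : ln L - ln t + t / L - 1 = F L - F t by rewrite /F divff ?lt0r_neq0 //; ring.
apply: (@integral_derive F (fun r => r ^- 2 * (r - t))) => //.
- move=> r /andP[tr _]; have r0 : 0 < r := lt_le_trans t0 tr.
  have d1 := is_derive1_ln r0.
  have d2 := @is_derive_inv _ (fun s => 0 + 1 * s) r 1 _ (is_derive_affine 0 1 r).
  rewrite add0r mul1r in d2; have d3 := is_derive_fM (is_derive_affine t 0 r) (d2 (lt0r_neq0 r0)).
  apply: is_derive_eqf (is_derive_fD d1 d3).
    by apply/funext => s /=; rewrite add0r mul1r mul0r addr0.
  by field; exact: lt0r_neq0.
- move=> r /andP[tr _]; have r0 : 0 < r := lt_le_trans t0 tr.
  apply: cvgM; last by apply: cvgB; [exact: cvg_id|exact: cvg_cst].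
  apply: cvgV; first by rewrite expf_neq0 // lt0r_neq0.
  by apply: cvgM; exact: cvg_id.
Qed.

(* Writes the logarithmic kernel as a superposition of the positive definite
   kernels [tri r (x - y)], the measure of the set of those a for which
   ]a, a + r] contains both x and y. *)
Lemma log_kernel_shells L t : 0 < L ->
  log_kernel L t = (\int[leb]_r (weight L r * tri r t)%:E + (L^-1 * tri L t)%:E)%E.
Proof.
move=> L0.
wlog t0 : t / 0 <= t.
  move=> H; have := H _ (normr_ge0 t); rewrite /log_kernel normr_id => ->.
  by rewrite /tri normr_id.
have [Lt|tL] := leP L t.
  have -> : log_kernel L t = 0%E.
    rewrite /log_kernel ger0_norm // lne_EFin ?(lt_le_trans L0) // -EFinB.
    by rewrite max_l // lee_fin subr_le0 ler_ln ?posrE // (lt_le_trans L0).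
  have triL r : r <= L -> tri r t = 0.
    by move=> rL; rewrite /tri max_r // subr_le0 ger0_norm // (le_trans rL).
  rewrite triL // mulr0 adde0 integral0_eq // => r _; rewrite /weight.
  by case: ifP => [/andP[_ /triL ->]|]; rewrite ?mulr0 ?mul0r.
move: t0; rewrite le_eqVlt => /orP[/eqP <-|t0]; last first.
  rewrite shell_integral_pos // -EFinD /log_kernel gtr0_norm // lne_EFin // -EFinB.
  rewrite max_r ?lee_fin ?subr_ge0 ?ler_ln ?posrE // ?ltW //; congr (_%:E).
  rewrite /tri gtr0_norm // max_l ?subr_ge0 1?ltW // mulrBr mulVf ?lt0r_neq0 //; ring.
rewrite /log_kernel normr0 /= lexx /= max_r ?leey //.
suff -> : (\int[leb]_r (weight L r * tri r 0)%:E = +oo)%E by rewrite addye.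
(* At distance [s] the shells contribute [A + s / L], and [tri r 0 >= tri r s]; hence the integral
   at distance 0 exceeds every [A]. *)
apply/eqyP => A A0; pose s := L * expR (- (A + 1)).
have s0 : 0 < s by rewrite mulr_gt0 ?expR_gt0.
have sL : s < L by rewrite /s gtr_pMr // expR_lt1; lra.
have : (A%:E <= \int[leb]_r (weight L r * tri r s)%:E)%E.
  rewrite shell_integral_pos // lee_fin /s lnM ?posrE ?expR_gt0 // expRK.
  by have : 0 < s / L by [rewrite divr_gt0]; rewrite /s; lra.
move=> /le_trans; apply; apply: ge0_le_integral => //.
- by move=> r _; rewrite lee_fin mulr_ge0 ?weight_ge0 ?tri_ge0.
- exact: measurable_shell.
- exact: measurable_shell.
move=> r _; rewrite lee_fin ler_wpM2l ?weight_ge0 // /tri.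
by rewrite ge_max !le_max lexx orbT andbT normr0 lerB ?normr_ge0.
Qed.

End LogKernel.

Section Measurability.
Context {R : realType}.
Local Notation TR := (measurableTypeR R).
Local Notation leb := (@lebesgue_measure R).
Implicit Types (x y a r t L : R).

(** A pointwise limit of continuous functions: the kernel lifted to height [1 / (n + 1)]. *)
Lemma measurable_neg_lne_abs :
  measurable_fun [set: TR] ((fun t => - lne (`|t|%:E))%E : TR -> \bar R).
Proof.
pose g (n : nat) t : \bar R := (0 - logk t n.+1%:R^-1)%:E.
apply: (@emeasurable_fun_cvg _ TR R setT (g : nat -> TR -> \bar R)) => [n|t _].
  apply/measurable_EFinP; apply: measurable_funB; first exact: measurable_cst.
  apply: continuous_measurable_fun => t.
  have q0 : 0 < t ^+ 2 + n.+1%:R^-1 ^+ 2 :> R.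
    by rewrite addrC ltr_pwDl ?sqr_ge0 // exprn_gt0.
  by have [/derivable1_diffP/differentiable_continuous] := logk_dx q0.
have := @lne_abs_lim R t 0 0.
by rewrite subr0 sub0e.
Qed.

Lemma measurable_log_kernel L : measurable_fun [set: TR] (log_kernel L : TR -> \bar R).
Proof.
apply: measurable_maxe => //; apply: (emeasurable_funD (f := cst (ln L)%:E)) => //.
exact: measurable_neg_lne_abs.
Qed.

Lemma measurable_diff : measurable_fun [set: TR * TR] (fun z : TR * TR => (z.1 - z.2 : TR)).
Proof.
by apply: measurable_funB; [exact: measurable_fst|exact: measurable_snd].
Qed.

Lemma log_kernel_ge0 L t : (0 <= log_kernel L t)%E.
Proof. by rewrite /log_kernel le_max lexx. Qed.

End Measurability.

(** * Energies as integrals of window masses *)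

Section MutualEnergy.
Context {R : realType}.
Local Notation TR := (measurableTypeR R).
Local Notation leb := (@lebesgue_measure R).
Implicit Types (m : probability TR R) (x y a r t L : R).

(* The energy of m1, m2 for the kernel [tri r]. *)
Definition box_energy m1 m2 r : \bar R :=
  (\int[leb]_a (m1 `]a, (a + r)%R]%classic * m2 `]a, (a + r)%R]%classic))%E.

Definition mutual_energy m1 m2 L : \bar R :=
  (\int[m1 \x m2]_z log_kernel L (z.1 - z.2))%E.

(** Tonelli in the three variables [x], [y], [r]. The measurability in [r] is recorded as well,
    because integrals of such functions are added and compared afterwards. *)
Lemma mutual_energy_boxes m1 m2 L : 0 < L ->
  measurable_fun [set: TR] ((fun r => (weight L r)%:E * box_energy m1 m2 r)%E : TR -> \bar R) /\
  (mutual_energy m1 m2 L = \int[leb]_r ((weight L r)%:E * box_energy m1 m2 r)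
    + (L^-1)%:E * box_energy m1 m2 L)%E.
Proof.
move=> L0.
pose f (q : (TR * TR) * TR) := (weight L q.2 * tri q.2 (q.1.1 - q.1.2))%:E.
have mtri r : measurable_fun setT (fun z : TR * TR => tri r (z.1 - z.2)).
  apply: (@measurableT_comp _ _ _ _ _ _ (tri r : TR -> R)); last exact: measurable_diff.
  apply: measurable_maxr => //; apply: measurable_funB => //.
have mf : measurable_fun setT f.
  apply/measurable_EFinP; apply: measurable_funM.
    by apply: (@measurableT_comp _ _ _ _ _ _ (weight L : TR -> R)); [exact: measurable_weight|exact: measurable_snd].
  apply: measurable_maxr => //; apply: measurable_funB; first exact: measurable_snd.
  apply: (@measurableT_comp _ _ _ _ _ _ (fun t : TR => `|t : R| : R)); first exact: normr_measurable.
  exact: (measurableT_comp measurable_diff measurable_fst).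
have f0 q : (0 <= f q)%E by rewrite lee_fin mulr_ge0 ?weight_ge0 ?tri_ge0.
pose P : probability (TR * TR)%type R := (m1 \x m2)%E.
have inner r : (\int[P]_z f (z, r) = (weight L r)%:E * box_energy m1 m2 r)%E.
  rewrite /f /=; under eq_integral do rewrite EFinM.
  have [r0|r0] := leP 0 r.
    rewrite ge0_integralZl_EFin ?weight_ge0 //.
    - by rewrite /P integral_tri.
    - by move=> z _; rewrite lee_fin tri_ge0.
    - by apply/measurable_EFinP; exact: mtri.
  rewrite /weight ltNge (ltW r0) /= mul0e integral0_eq // => z _; rewrite mul0e //.
split.
  have := @measurable_fun_fubini_tonelli_G _ _ _ _ _ P f mf f0.
  by rewrite /fubini_G (_ : (fun y => _) = fun r => ((weight L r)%:E * box_energy m1 m2 r)%E) //; apply/funext.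
rewrite /mutual_energy.
under eq_integral do rewrite log_kernel_shells //.
rewrite -/P ge0_integralD //.
- congr (_ + _)%E.
    have := @fubini_tonelli _ _ _ _ _ P leb f mf f0.
    by rewrite /f /= => ->; apply: eq_integral => r _; exact: inner.
  under eq_integral do rewrite EFinM.
  rewrite ge0_integralZl_EFin ?invr_ge0 ?(ltW L0) //.
  + by rewrite /P integral_tri // ltW.
  + by move=> z _; rewrite lee_fin tri_ge0.
  + by apply/measurable_EFinP; exact: mtri.
- by move=> z _; apply: integral_ge0 => r _; exact: (f0 (z, r)).
- exact: (@measurable_fun_fubini_tonelli_F _ _ _ _ _ leb f mf f0).
- by move=> z _; rewrite lee_fin mulr_ge0 ?invr_ge0 ?(ltW L0) ?tri_ge0.
- by apply/measurable_EFinP; apply: measurable_funM => //; exact: mtri.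
Qed.

End MutualEnergy.

Section BoxDefect.
Context {R : realType}.
Local Notation TR := (measurableTypeR R).
Local Notation leb := (@lebesgue_measure R).
Implicit Types (m : probability TR R) (x y a r t L : R).

Definition window m r a : R := fine (m `]a, (a + r)%R]%classic).

Lemma windowE m r a : m `]a, (a + r)%R]%classic = (window m r a)%:E.
Proof. by rewrite /window fineK // fin_num_measure //; exact: measurable_itv. Qed.

Lemma window_ge0 m r a : 0 <= window m r a.
Proof. by rewrite fine_ge0. Qed.

Lemma measurable_window m r : measurable_fun [set: TR] (window m r : TR -> R).
Proof.
apply/measurable_EFinP.
pose f (q : TR * TR) := (box r q.1 q.2)%:E.
have mf : measurable_fun setT f.
  apply/measurable_EFinP; apply: (@measurableT_comp _ _ _ _ _ _ (\1_(`]0, r]%classic : set R) : TR -> R)).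
    by apply: measurable_indic; exact: measurable_itv.
  exact: measurable_diff.
have f0 q : (0 <= f q)%E by rewrite lee_fin /f /box indicE.
have := @measurable_fun_fubini_tonelli_G _ _ _ _ _ m f mf f0.
rewrite /fubini_G (_ : (fun y => _) = EFin \o (window m r : TR -> R)) //.
apply/funext => a /=; rewrite -windowE /f /=.
under eq_integral do rewrite boxE.
by rewrite integral_indic ?setIT //; exact: measurable_itv.
Qed.

Lemma box_energyE m1 m2 r :
  box_energy m1 m2 r = (\int[leb]_a (window m1 r a * window m2 r a)%:E)%E.
Proof. by apply: eq_integral => a _; rewrite !windowE. Qed.

Lemma box_energy_ge0 m1 m2 r : (0 <= box_energy m1 m2 r)%E.
Proof. by rewrite box_energyE integral_ge0 // => a _; rewrite lee_fin mulr_ge0 ?window_ge0. Qed.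

(** The identity [x ^+ 2 + y ^+ 2 = 2 x y + (x - y) ^+ 2], integrated over window positions and kept
    free of subtractions of extended reals. *)
Lemma box_energy_defect m1 m2 r :
  (box_energy m1 m1 r + box_energy m2 m2 r = box_energy m1 m2 r + box_energy m1 m2 r
    + \int[leb]_a ((window m1 r a - window m2 r a) ^+ 2)%:E)%E.
Proof.
have mw m := measurable_window m r.
have mm m m' : measurable_fun [set: TR] (fun a : TR => (window m r a * window m' r a)%:E).
  by apply/measurable_EFinP; exact: measurable_funM.
have pos m m' (a : TR) : setT a -> (0 <= (window m r a * window m' r a)%:E)%E.
  by rewrite lee_fin mulr_ge0 ?window_ge0.
have md : measurable_fun [set: TR] (fun a : TR => ((window m1 r a - window m2 r a) ^+ 2)%:E).
  by apply/measurable_EFinP; apply: measurable_funX; exact: measurable_funB.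
have sq0 (a : TR) : setT a -> (0 <= ((window m1 r a - window m2 r a) ^+ 2)%:E)%E.
  by rewrite lee_fin sqr_ge0.
rewrite !box_energyE -ge0_integralD ?(pos, mm) //; try by move=> a; apply: pos.
rewrite -ge0_integralD ?(pos, mm) //; try by move=> a; apply: pos.
rewrite -ge0_integralD //; last 2 first.
- by move=> a _; rewrite adde_ge0 // pos.
- exact: emeasurable_funD.
by apply: eq_integral => a _; rewrite -!EFinD; congr (_%:E); ring.
Qed.

(** Every scale [r] contributes a nonnegative defect. Those weighted by [weight L] are dropped; the
    one kept comes from the point mass at scale [L]. *)
Lemma mutual_energy_defect m1 m2 L : 0 < L ->
  (mutual_energy m1 m2 L + mutual_energy m1 m2 L
    + (L^-1)%:E * \int[leb]_a ((window m1 L a - window m2 L a) ^+ 2)%:E <=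
   mutual_energy m1 m1 L + mutual_energy m2 m2 L)%E.
Proof.
move=> L0.
have [mw12 ->] := mutual_energy_boxes m1 m2 L0.
have [mw11 ->] := mutual_energy_boxes m1 m1 L0.
have [mw22 ->] := mutual_energy_boxes m2 m2 L0.
have p m m' r : (0 <= (weight L r)%:E * box_energy m m' r)%E.
  by rewrite mule_ge0 ?lee_fin ?weight_ge0 ?box_energy_ge0.
rewrite [leRHS]addeACA [X in (X + _ <= _)%E]addeACA -addeA.
have q m m' : (0 <= (L^-1)%:E * box_energy m m' L)%E.
  by rewrite mule_ge0 ?box_energy_ge0 // lee_fin invr_ge0 ltW.
have d0 : (0 <= \int[leb]_a ((window m1 L a - window m2 L a) ^+ 2)%:E)%E.
  by apply: integral_ge0 => a _; rewrite lee_fin sqr_ge0.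
apply: leeD.
  have mono (k k1 k2 : TR -> \bar R) : measurable_fun setT k -> measurable_fun setT k1 ->
      measurable_fun setT k2 -> (forall r, 0 <= k r)%E -> (forall r, 0 <= k1 r)%E ->
      (forall r, 0 <= k2 r)%E -> (forall r, k r + k r <= k1 r + k2 r)%E ->
      (\int[leb]_r k r + \int[leb]_r k r <= \int[leb]_r k1 r + \int[leb]_r k2 r)%E.
    move=> mk mk1 mk2 k0 k10 k20 le; rewrite -!ge0_integralD //; apply: ge0_le_integral => //.
    - by move=> r _; rewrite adde_ge0.
    - exact: emeasurable_funD.
    - exact: emeasurable_funD.
  apply: (mono _ _ _ mw12 mw11 mw22 (p m1 m2) (p m1 m1) (p m2 m2)) => r.
  rewrite -!ge0_muleDr ?box_energy_ge0 // lee_wpmul2l ?lee_fin ?weight_ge0 //.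
  rewrite box_energy_defect leeDl // integral_ge0 // => a _.
  by rewrite lee_fin sqr_ge0.
rewrite -[leRHS]ge0_muleDr ?box_energy_ge0 // box_energy_defect.
move: d0; set I := (\int[leb]_a _)%E => d0.
move: (box_energy m1 m2 L) (box_energy_ge0 m1 m2 L) I d0 => B B0 I I0.
by rewrite (ge0_muleDr _ (adde_ge0 B0 B0) I0) (ge0_muleDr _ B0 B0).
Qed.

End BoxDefect.

(** * Uniqueness of the equilibrium measure *)

Section LogEnergy.
Context {R : realType}.
Local Notation TR := (measurableTypeR R).
Local Notation leb := (@lebesgue_measure R).
Implicit Types (m : probability TR R) (x y a r t L : R).

(** Linearity covers a finite integral of [f]. If it is infinite, the positive part of [f - c] has
    infinite integral, while the negative part is bounded by [|c|], so both sides are [+oo]. *)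
Lemma integral_shift m (f : TR -> \bar R) (c : R) :
  measurable_fun setT f -> (forall x, (0 <= f x)%E) ->
  (\int[m]_x (f x - c%:E) = \int[m]_x f x - c%:E)%E.
Proof.
move=> mf f0.
have ic : (\int[m]_x c%:E = c%:E)%E by rewrite integral_cst // [X in (_ * X)%E]probability_setT mule1.
have [fin|] := ltP (\int[m]_x f x)%E +oo%E.
  rewrite integralB ?ic //; last exact: finite_measure_integrable_cst.
  by apply/integrableP; split => //; under eq_integral do rewrite gee0_abs //.
rewrite leye_eq => /eqP inf.
have mg : measurable_fun setT (fun x => f x - c%:E)%E.
  by apply: emeasurable_funB => //; exact: measurable_cst.
have ia : (\int[m]_x `|c|%:E = `|c|%:E)%E by rewrite integral_cst // [X in (_ * X)%E]probability_setT mule1.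
have infp : (\int[m]_x (fun x => f x - c%:E)^\+ x = +oo)%E.
  have : (\int[m]_x f x <= \int[m]_x ((fun x => f x - c%:E)^\+ x + `|c|%:E))%E.
    apply: ge0_le_integral => //.
    - by apply: emeasurable_funD => //; exact: measurable_funepos.
    move=> x _; rewrite funeposE; have := f0 x; case: (f x) => [r| |] //= r0.
    rewrite -EFinB -EFin_max -EFinD lee_fin.
    have : r - c <= Num.max (r - c) 0 by rewrite le_max lexx.
    by have := ler_norm c; lra.
  rewrite ge0_integralD //; [|exact: measurable_funepos].
  rewrite inf ia leye_eq.
  case: (\int[m]_x (fun x => f x - c%:E)^\+ x)%E => [r| |] //=.
have negfin : (\int[m]_x (fun x => f x - c%:E)^\- x <= `|c|%:E)%E.
  rewrite -ia; apply: ge0_le_integral => //.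
  - exact: measurable_funeneg.
  move=> x _; rewrite funenegE; have := f0 x; case: (f x) => [r r0|_|//] /=; last by rewrite max_r // lee_fin.
    rewrite lee_fin in r0.
    by rewrite -EFin_max lee_fin ge_max normr_ge0 andbT; have := ler_norm c; lra.
rewrite integralE infp inf.
have : (0 <= \int[m]_x (fun x => f x - c%:E)^\- x)%E by apply: integral_ge0.
move: negfin; case: (\int[m]_x (fun x => f x - c%:E)^\- x)%E => [r| |] //=.
Qed.

Section Support.
Context (E : set TR) (L : R).
Hypotheses (mE : measurable E) (L0 : 0 < L)
  (EL : forall x y, E x -> E y -> `|x - y| <= L).

Lemma ae_support m (P : TR -> Prop) : m E = 1%E -> (forall x, E x -> P x) ->
  {ae m, forall x, P x}.
Proof.
move=> mE1 H; exists (~` E); split; first exact: measurableC.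
  by rewrite probability_setC // mE1 subee.
by move=> x /= nP Ex; apply: nP; exact: H.
Qed.

Lemma log_kernel_diam x y : E x -> E y ->
  (log_kernel L (x - y) - (ln L)%:E = - lne (`|x - y|%:E))%E.
Proof.
move=> Ex Ey; rewrite /log_kernel; have [->|xy] := eqVneq (x - y) 0.
  by rewrite normr0 /= lexx /= max_r ?leey.
have xy0 : 0 < `|x - y| by rewrite normr_gt0.
rewrite lne_EFin // -EFinB max_r; first by rewrite -!EFinB; congr (_%:E); lra.
by rewrite lee_fin subr_ge0 ler_ln ?posrE // EL.
Qed.

Lemma measurable_section (k : TR -> \bar R) x : measurable_fun setT k ->
  measurable_fun setT (fun y : TR => k (x - y)).
Proof.
move=> mk; apply: (measurableT_comp mk); apply: measurable_funB => //.
Qed.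

Lemma inner_log_energy m x : m E = 1%E -> E x ->
  (\int[m]_y - lne (`|x - y|%:E) = \int[m]_y log_kernel L (x - y) - (ln L)%:E)%E.
Proof.
move=> mE1 Ex; have mk := measurable_section x (measurable_log_kernel L).
rewrite -integral_shift //; last by move=> y; exact: log_kernel_ge0.
apply: ae_eq_integral => //.
- exact: (@measurable_section (fun t => - lne (`|t|%:E))%E x (@measurable_neg_lne_abs R)).
- by apply: emeasurable_funB => //; exact: measurable_cst.
by apply: (ae_support mE1) => y Ey _; rewrite log_kernel_diam.
Qed.

(** On [E] the truncation is inactive, so inner and outer integrands agree almost everywhere with
    the shifted nonnegative kernel, for which Tonelli yields the integral over the product. *)
Lemma log_energyE m : m E = 1%E ->
  log_energy m = (mutual_energy m m L - (ln L)%:E)%E.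
Proof.
move=> mE1.
pose f (z : TR * TR) := log_kernel L (z.1 - z.2).
have mf : measurable_fun setT f := measurableT_comp (measurable_log_kernel L) measurable_diff.
have f0 z : (0 <= f z)%E by exact: log_kernel_ge0.
have mJ := @measurable_fun_fubini_tonelli_F _ _ _ _ _ m f mf f0.
rewrite /mutual_energy (@fubini_tonelli1 _ _ _ _ _ m m f mf f0).
rewrite -integral_shift //; last by move=> x; apply: integral_ge0.
apply: ae_eq_integral => //.
(* The untruncated kernel changes sign, so measurability of its inner integral is obtained from the
   positive and negative parts separately. *)
- pose g (z : TR * TR) : \bar R := (- lne (`|z.1 - z.2|%:E))%E.
  have mg : measurable_fun setT g := measurableT_comp (@measurable_neg_lne_abs R) measurable_diff.
  have gp := @measurable_fun_fubini_tonelli_F _ _ _ _ _ m (g^\+)%E (measurable_funepos mg) (@funepos_ge0 _ _ g).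
  have gn := @measurable_fun_fubini_tonelli_F _ _ _ _ _ m (g^\-)%E (measurable_funeneg mg) (@funeneg_ge0 _ _ g).
  have := emeasurable_funB gp gn; apply: eq_measurable_fun => x _.
  rewrite /fubini_F [RHS]integralE; congr (_ - _)%E.
    by apply: eq_integral => y _; rewrite !funeposE.
  by apply: eq_integral => y _; rewrite !funenegE.
- by apply: emeasurable_funB => //; exact: measurable_cst.
by apply: (ae_support mE1) => x Ex _; exact: inner_log_energy.
Qed.

End Support.
End LogEnergy.

Section MeasureUniqueness.
Context {R : realType}.
Local Notation TR := (measurableTypeR R).
Local Notation leb := (@lebesgue_measure R).
Implicit Types (x y a b r t L e : R).

Lemma measure_eq_ocitv (m1 m2 : {measure set TR -> \bar R}) :
  (forall a b, a < b -> m1 `]a, b]%classic = m2 `]a, b]%classic) ->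
  (forall a b, (m1 `]a, b]%classic < +oo)%E) ->
  forall A, measurable A -> m1 A = m2 A.
Proof.
move=> H fin A mA.
apply: (@measure_unique _ R TR (@ocitv R) (fun n : nat => `](- n%:R : R), n%:R]%classic)) => //.
- exact: ocitvI.
- by move=> n; exact: is_ocitv.
- apply/seteqP; split => // x _; have /ltr_normlP [h1 h2] := archi_boundP (normr_ge0 x).
  by exists (Num.bound `|x|) => //=; rewrite in_itv /=; apply/andP; split; [lra|exact: ltW].
- move=> _ [[a b] _ <-] /=; have [ab|ba] := ltP a b; first exact: H.
  by rewrite set_itv_ge ?measure0 // bnd_simp -leNgt.
Qed.

Lemma small_measure (m : probability TR R) (F : nat -> set TR) e :
  (forall i, measurable (F i)) -> nonincreasing_seq F ->
  m (\bigcap_n F n) = 0%E -> 0 < e -> exists n, (m (F n) <= e%:E)%E.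
Proof.
move=> mF dF F0 e0.
have cv : m \o F @ \oo --> m (\bigcap_n F n).
  apply: nonincreasing_cvg_mu => //; last exact: bigcapT_measurable.
  by rewrite ltey_eq fin_num_measure.
rewrite F0 in cv.
have /cvgrPdist_lt H : (fun n => fine (m (F n))) @ \oo --> (0 : R) by exact: fine_cvg.
have [N _ /(_ N (leqnn N))] := H _ e0.
rewrite sub0r normrN /= ger0_norm ?fine_ge0 // => /ltW h; exists N.
by rewrite -lee_fin fineK ?fin_num_measure // in h.
Qed.

Lemma small_right_window (m : probability TR R) x e : 0 < e ->
  exists2 d, 0 < d & (m `]x, (x + d)%R]%classic <= e%:E)%E.
Proof.
move=> e0; have [||||n Hn] := @small_measure m (fun n => `]x, x + n.+1%:R^-1]%classic) e.
- by move=> i; exact: measurable_itv.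
- move=> i j ij; apply/subsetPset => y /=; rewrite !in_itv /= => /andP[-> /le_trans]; apply.
  by rewrite lerD2l lef_pV2 ?posrE // ler_nat ltnS.
- rewrite (_ : \bigcap_n _ = set0) ?measure0 // -subset0 => y Hy.
  have := Hy 0%N I; rewrite /= in_itv /= => /andP[xy _].
  have h := archi_boundP (ltW (_ : 0 < (y - x)^-1)).
  have := Hy (Num.bound (y - x)^-1) I; rewrite /= in_itv /= xy /= leNgt => /negP; apply.
  rewrite -ltrBrDl -[ltRHS]invrK ltf_pV2 ?posrE ?invr_gt0 ?subr_gt0 //.
  by apply: (lt_trans (h _)); rewrite ?invr_gt0 ?subr_gt0 // ltr_nat.
- by [].
by exists n.+1%:R^-1 => //; rewrite invr_gt0.
Qed.

End MeasureUniqueness.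

Section WindowsDetermine.
Context {R : realType}.
Local Notation TR := (measurableTypeR R).
Local Notation leb := (@lebesgue_measure R).
Implicit Types (x y a b r t e : R) (m : probability TR R).

Definition dist_fun m x : R := fine (m `]-oo, x]%classic).

Lemma dist_funE m x : m `]-oo, x]%classic = (dist_fun m x)%:E.
Proof. by rewrite /dist_fun fineK // fin_num_measure //; exact: measurable_itv. Qed.

Lemma dist_fun_window m a b : a <= b ->
  m `]a, b]%classic = (dist_fun m b - dist_fun m a)%:E.
Proof.
move=> ab; have mI c : measurable (`]-oo, c]%classic : set TR) by exact: measurable_itv.
have mI2 : measurable (`]a, b]%classic : set TR) by exact: measurable_itv.
rewrite EFinB -!dist_funE.
have -> : `]-oo, b]%classic = `]-oo, a]%classic `|` `]a, b]%classic :> set TR.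
  apply/seteqP; split => x /=; rewrite !in_itv /=.
    by move=> xb; rewrite xb andbT; have [|] := leP x a; [left|right].
  by move=> [/le_trans ->|/andP[]].
rewrite measureU //; last first.
  rewrite -subset0 => x /= []; rewrite !in_itv /= => xa /andP[ax _].
  by move: (le_lt_trans xa ax); rewrite ltxx.
by rewrite addeAC subee ?add0e // fin_num_measure.
Qed.

Lemma measure_eq_dist_fun m1 m2 : dist_fun m1 =1 dist_fun m2 ->
  forall A, measurable A -> m1 A = m2 A.
Proof.
move=> H; apply: measure_eq_ocitv => a b => [ab|].
  have h2 := dist_fun_window m2 (ltW ab); rewrite -!H in h2.
  exact: (etrans (dist_fun_window m1 (ltW ab)) (esym h2)).
by rewrite ltey_eq fin_num_measure //; exact: measurable_itv.
Qed.

Section Supported.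
Context (E : set TR) (al be L : R).
Hypotheses (mE : measurable E) (bE : forall x, E x -> al <= x <= be) (L0 : be - al < L).

Lemma null_disjoint m (A : set TR) : m E = 1%E -> measurable A ->
  (forall x, A x -> ~ E x) -> m A = 0%E.
Proof.
move=> mE1 mA AE; apply/eqP; rewrite eq_le measure_ge0 andbT.
apply: (@le_trans _ _ (m (~` E))); last by rewrite probability_setC // mE1 subee.
by apply: le_measure; rewrite ?inE //; exact: measurableC.
Qed.

Lemma dist_fun_below m x : m E = 1%E -> x < al -> dist_fun m x = 0.
Proof.
move=> mE1 xal; have mI : measurable (`]-oo, x]%classic : set TR) by exact: measurable_itv.
rewrite /dist_fun (null_disjoint mE1 mI) //.
move=> y /=; rewrite in_itv /= => yx /bE /andP[aly _].
by have := le_lt_trans (le_trans aly yx) xal; rewrite ltxx.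
Qed.

Lemma dist_fun_above m x : m E = 1%E -> be <= x -> dist_fun m x = 1.
Proof.
move=> mE1 xbe; have mI : measurable (`]-oo, x]%classic : set TR) by exact: measurable_itv.
rewrite /dist_fun; suff -> : m `]-oo, x]%classic = 1%E by [].
apply/eqP; rewrite eq_le probability_le1 //= -mE1.
apply: le_measure; rewrite ?inE // => y /bE /andP[_ ybe] /=.
by rewrite in_itv /= (le_trans ybe).
Qed.

Lemma dist_fun_right m x e : 0 < e -> exists2 d, 0 < d &
  forall y, x <= y <= x + d -> `|dist_fun m y - dist_fun m x| <= e.
Proof.
move=> e0; have [d d0 Hd] := small_right_window m x e0; exists d => // y /andP[xy yd].
have : (m `]x, y]%classic <= e%:E)%E.
  apply: le_trans Hd; apply: le_measure; rewrite ?inE; try exact: measurable_itv.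
  by move=> z /=; rewrite !in_itv /= => /andP[-> /le_trans ->].
have : (0 <= m `]x, y]%classic)%E by [].
by rewrite dist_fun_window // !lee_fin => h1 h2; rewrite ger0_norm.
Qed.

(** A window []a, a + L]] starting to the left of [al] has mass [dist_fun (a + L)], and
    [L > be - al] lets [a + L] reach every [x < be]. So the distribution functions agree at almost
    every point of the relevant range, and right-continuity gives all points. *)
Lemma windows_determine m1 m2 : m1 E = 1%E -> m2 E = 1%E ->
  (\int[leb]_a ((window m1 L a - window m2 L a) ^+ 2)%:E = 0)%E ->
  forall A, measurable A -> m1 A = m2 A.
Proof.
move=> m1E m2E I0; apply: measure_eq_dist_fun => x.
have [bex|xbe] := leP be x; first by rewrite !dist_fun_above.
have md : measurable_fun setT ((fun a => ((window m1 L a - window m2 L a) ^+ 2)%:E) : TR -> \bar R).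
  by apply/measurable_EFinP; apply: measurable_funX; apply: measurable_funB; exact: measurable_window.
have [N [mN N0 HN]] : {ae leb, forall a : TR, setT a -> ((window m1 L a - window m2 L a) ^+ 2)%:E = 0%E}.
  apply/(ae_eq_integral_abs leb measurableT md); rewrite -[RHS]I0.
  by apply: eq_integral => a _; rewrite gee0_abs // lee_fin sqr_ge0.
have good a : a < al -> ~ N a -> dist_fun m1 (a + L) = dist_fun m2 (a + L).
  move=> aal Na; have : ((window m1 L a - window m2 L a) ^+ 2)%:E = 0%E :> \bar R.
    by apply: contrapT => H; apply: Na; apply: HN => /= /(_ I).
  move=> [] /eqP; rewrite sqrf_eq0 subr_eq0 => /eqP wa.
  have L00 : a <= a + L.
    have [y Ey] : E !=set0.
      apply/set0P/negP => /eqP E0; move: m1E; rewrite E0 measure0 => -[] /eqP.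
      by rewrite eq_sym oner_eq0.
    have /andP[/le_trans h /h albe] := bE Ey; clear m1E m2E I0; by rewrite lerDl (le_trans _ (ltW L0)) // subr_ge0.
  have W m : m E = 1%E -> window m L a = dist_fun m (a + L).
    by move=> mE1; rewrite /window dist_fun_window //= (dist_fun_below mE1 aal) subr0.
  by rewrite -!W.
apply/eqP; rewrite -subr_eq0 -normr_eq0; apply: contrapT => /negP n0.
pose e := `|dist_fun m1 x - dist_fun m2 x| / 4.
have e0 : 0 < e by rewrite divr_gt0 // lt_neqAle eq_sym n0 normr_ge0.
have [d1 d10 H1] := dist_fun_right m1 x e0; have [d2 d20 H2] := dist_fun_right m2 x e0.
(* The last term keeps [a < al] for [a] in []x - L, x - L + d[]. This interval has positive length,
   so it contains an [a] outside the null set [N]. *)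
pose d := Num.min (Num.min d1 d2) (al + L - x).
have d0 : 0 < d.
  by rewrite !lt_min d10 d20 /= subr_gt0 (lt_trans xbe) // -ltrBlDl.
have [a /= /andP[xa ad] Na] : exists2 a, x - L < a < x - L + d & ~ N a.
  apply: contrapT => H; have : (leb `](x - L)%R, (x - L + d)%R[%classic <= leb N)%E.
    have mI : measurable (`](x - L), (x - L + d)[%classic : set TR) by exact: measurable_itv.
    apply: le_measure; rewrite ?inE //.
    move=> a /=; rewrite in_itv /= => xad; apply: contrapT => Na; apply: H; by exists a.
  clear m1E m2E I0 HN good md; rewrite N0 lebesgue_measure_itv /= lte_fin ifT; last lra.
  by rewrite -EFinB lee_fin; lra.
have dd : d <= d1 /\ d <= d2 /\ d <= al + L - x by rewrite /d !ge_min !lexx ?orbT.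
clear I0 HN md.
have h := good a _ Na.
clear m1E m2E good N0.
have xy : x <= a + L <= x + d by apply/andP; split; lra.
have {}h := h ltac:(lra).
have h1 : `|dist_fun m1 (a + L) - dist_fun m1 x| <= e by apply: H1; apply/andP; split; lra.
have h2 : `|dist_fun m2 (a + L) - dist_fun m2 x| <= e by apply: H2; apply/andP; split; lra.
have : `|dist_fun m1 x - dist_fun m2 x| <= e + e.
  have -> : dist_fun m1 x - dist_fun m2 x =
    (dist_fun m2 (a + L) - dist_fun m2 x) - (dist_fun m1 (a + L) - dist_fun m1 x).
    by rewrite h; ring.
  by apply: le_trans (ler_normB _ _) _; exact: lerD.
by rewrite /e in e0 *; lra.
Qed.

End Supported.
End WindowsDetermine.

Section EquilibriumUniqueness.
Context {R : realType}.
Local Notation TR := (measurableTypeR R).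
Local Notation leb := (@lebesgue_measure R).
Implicit Types (x y a b r t e : R) (m : probability TR R).

Lemma probability_of_measure (nu : {measure set TR -> \bar R}) : nu setT = 1%E ->
  exists P : probability TR R, forall A, P A = nu A.
Proof.
move=> nu1.
(* The Dirac mass is the fallback of [mnormalize] for total mass 0 or infinity, and does not arise
   for mass 1. *)
exists (mnormalize nu (dirac (0 : TR) : probability TR R)) => A.
rewrite /= /mnormalize ifF; first by rewrite nu1 invr1 mule1.
by rewrite nu1 onee_eq0.
Qed.

Context (E : set TR) (L : R).
Hypotheses (mE : measurable E) (L0 : 0 < L)
  (EL : forall x y, E x -> E y -> `|x - y| <= L).

Lemma mutual_energy_constant m1 m2 (W : \bar R) : m1 E = 1%E ->
  (forall x, E x -> (\int[m2]_y log_kernel L (x - y) = W)%E) ->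
  mutual_energy m1 m2 L = W.
Proof.
move=> m1E HW; pose f (z : TR * TR) := log_kernel L (z.1 - z.2).
have mf : measurable_fun setT f := measurableT_comp (measurable_log_kernel L) measurable_diff.
have f0 z : (0 <= f z)%E by exact: log_kernel_ge0.
rewrite /mutual_energy (@fubini_tonelli1 _ _ _ _ _ m1 m2 f mf f0).
transitivity (\int[m1]_x W)%E.
  apply: ae_eq_integral => //.
  - exact: (@measurable_fun_fubini_tonelli_F _ _ _ _ _ m2 f mf f0).
  by apply: (ae_support mE m1E) => x Ex _; exact: HW.
by rewrite integral_cst // [X in (_ * X)%E]probability_setT mule1.
Qed.

(** The kernel is [+oo] at 0, so an atom at [x] would make the potential infinite there. *)
Lemma finite_potential_no_atom m x : (\int[m]_y log_kernel L (x - y) < +oo)%E ->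
  m [set x] = 0%E.
Proof.
move=> fin; apply: contrapT => /eqP m0; move: fin; rewrite ltNge => /negP; apply.
have mk : measurable_fun setT (fun y : TR => log_kernel L (x - y)).
  by apply: measurable_section; exact: measurable_log_kernel.
have mx : measurable ([set x] : set TR) by exact: measurable_set1.
have := @ge0_subset_integral _ TR R m [set x] setT mx measurableT
  (fun y => log_kernel L (x - y)) mk (fun y _ => log_kernel_ge0 _ _) (@subsetT _ _).
apply: le_trans; rewrite (eq_integral (cst +oo%E)).
  by rewrite integral_cst // gt0_mulye // lt0e m0 measure_ge0.
by move=> y; rewrite inE => ->; rewrite subrr /log_kernel normr0 /= lexx /= max_r ?leey.
Qed.

(** A potential of [nu] equal to [W] on [E] gives [I(m, nu) = I(nu, nu) = W], and minimality gives
    [I(m, m) <= W]. The defect inequality becomes [2 W + defect / L <= 2 W], and the finite [W]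
    cancels. *)
Lemma equilibrium_windows m (nu : probability TR R) W : is_equilibrium_measure E m -> nu E = 1%E ->
  (forall x, E x -> (\int[nu]_y log_kernel L (x - y) = W%:E)%E) ->
  (\int[leb]_a ((window m L a - window nu L a) ^+ 2)%:E = 0)%E.
Proof.
move=> [m1 min] nu1 HW.
have e12 := mutual_energy_constant m1 HW.
have e22 := mutual_energy_constant nu1 HW.
have := min nu nu1; rewrite (log_energyE mE L0 EL m1) (log_energyE mE L0 EL nu1) e22.
rewrite leeBlDr // subeK // => e11.
have := mutual_energy_defect m nu L0; rewrite e12 e22 => H.
have {}H := le_trans H (leeD e11 (lexx _)).
have : (0 <= \int[leb]_a ((window m L a - window nu L a) ^+ 2)%:E)%E.
  by apply: integral_ge0 => a _; rewrite lee_fin sqr_ge0.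
move: H; move: (\int[leb]_a _)%E => I H I0.
have L1 : 0 < L^-1 by rewrite invr_gt0.
case: I I0 H => [i| |] //; last by rewrite gt0_muley ?lte_fin // addey.
rewrite -?EFinM -?EFinD !lee_fin => i0 H; congr (_%:E); apply/eqP.
rewrite eq_le i0 andbT -(pmulr_rle0 _ L1); lra.
Qed.

End EquilibriumUniqueness.

(** * Identification of the equilibrium measure with the boundary measure *)

Section EquilibriumBoundary.
Context {R : realType} (E : set R) (al be : R) (u ux uy h : R * R -> R) (s : seq R)
  (mu : probability (measurableTypeR R) R).
Hypotheses (cE : closed E) (bE : forall x, E x -> al <= x <= be) (albe : al <= be)
  (gu : green_fun E u) (su : smooth_harmonic (~` slit E) u ux uy)
  (hd : conjugate_plus u ux uy h)
  (hl : forall x, x < al -> boundary_lim h x 0)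
  (Es : forall x, x \notin s -> ~ E x \/ interior E x)
  (hmu : is_equilibrium_measure E mu).
Local Notation TR := (measurableTypeR R).
Local Notation leb := (@lebesgue_measure R).
Implicit Types (x y z t : R) (p q : R * R).
Local Notation a0 := (al - 1).
Local Notation b0 := (be + 1).
Local Notation D := (`]a0, b0]%classic : set TR).

(** For [x] in [E] and [t] in [D] one has [|x - t| <= L - 2], and [(L - 2) ^+ 2 + 1 <= L ^+ 2], so
    [logk (x - t) 1 <= ln L]: the shift [C = ln L] is admissible in [green_representation]. *)
Let L := be - al + 3.

Let mE : measurable (E : set TR).
Proof. exact: closed_measurable. Qed.

Let L3 : 3 <= L.
Proof. by rewrite lerDr subr_ge0. Qed.

Let L0 : 0 < L.
Proof. exact: lt_le_trans L3. Qed.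

Let ab : a0 < b0.
Proof. by apply: (@lt_le_trans _ _ be); [apply: lt_le_trans albe; rewrite ltrBlDr ltrDl|rewrite lerDl]. Qed.

Let EL x y : E x -> E y -> `|x - y| <= L.
Proof.
move=> /bE /andP[a1 b1] /bE /andP[a2 b2]; rewrite ler_norml /L; apply/andP; split; lra.
Qed.

(** With the shift [ln L] the boundary measure has the constant truncated potential [ln L + V] on
    [E]. This identifies it with [mu] by minimality, and being finite it excludes atoms in [E];
    points off [E] carry no mass anyway. *)
Lemma equilibrium_representation : exists nu : probability TR R,
  [/\ forall A, measurable A -> mu A = nu A,
      forall p, 0 < p.2 -> h p = potential nu a0 b0 argk p - pi &
      forall x, nu [set x] = 0%E].
Proof.
have [nu0 [V [nu1 nuE hE HV]]] := green_representation cE bE albe gu su hd hl Es.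
have [nu nuA] := probability_of_measure nu1.
have nuE1 : nu E = 1%E.
  have h0 : nu (~` E) = 0%E := etrans (nuA _) nuE.
  by have := probability_setC nu (measurableC mE); rewrite setCK [X in (_ - X)%E]h0 sube0.
have HW x : E x -> (\int[nu]_y log_kernel L (x - y) = (ln L + V)%:E)%E.
  move=> Ex; rewrite -(HV x (ln L) Ex); last first.
    move=> t /=; rewrite in_itv /= => /andP[t1 t2]; have /andP[x1 x2] := bE Ex.
    rewrite /logk -[ln L]half_ln_sqr // ler_pM2r ?invr_gt0 //.
    rewrite ler_ln ?posrE ?exprn_gt0 //; last by rewrite addrC ltr_pwDl ?sqr_ge0.
    have : `|x - t| <= L - 2 by rewrite ler_norml /L; apply/andP; split; lra.
    have l3 := L3; move: L l3 => l l3; rewrite ler_norml => /andP[k1 k2].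
    by rewrite expr1n; nra.
  rewrite (@eq_measure_integral _ _ _ D nu nu0) => [|A _ _]; last exact: (esym (nuA A)).
  rewrite [RHS]integral_mkcond; apply: ae_eq_integral => //.
  - by apply: measurable_section; exact: measurable_log_kernel.
  - have mD : measurable D by exact: measurable_itv.
    apply/(measurable_restrictT _ mD); apply: measurable_funTS.
    apply: (emeasurable_funD (f := cst (ln L)%:E)) => //.
    exact: (@measurable_section _ (fun t => - lne (`|t|%:E))%E x (@measurable_neg_lne_abs R)).
  apply: (ae_support mE nuE1) => t Et _; rewrite patchE ifT; last first.
    by have /andP[? ?] := bE Et; rewrite mem_setE in_itv /=; apply/andP; split; lra.
  have := log_kernel_diam L0 EL Ex Et; rewrite /log_kernel.
  case: (lne _) => [r| |] /=; first by rewrite -EFin_max -EFinB => -[] h1; congr (_%:E); lra.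
    by rewrite addeNy max_l ?leNye.
  by rewrite max_r ?leey.
exists nu; split.
- apply: (windows_determine mE bE (L := L)) => //.
  + by rewrite /L; lra.
  + by case: hmu.
  + exact: (equilibrium_windows mE L0 EL hmu nuE1 HW).
- move=> p p0; rewrite hE //; congr (_ - _).
  rewrite /potential /Rintegral; congr fine; apply: eq_measure_integral => A _ _.
  exact: (esym (nuA A)).
- move=> x; have [Ex|nEx] := pselect (E x).
    by apply: (@finite_potential_no_atom _ L); rewrite HW // ltry.
  have mx : measurable ([set x] : set TR) by exact: measurable_set1.
  by apply: (null_disjoint mE nuE1 mx) => y ->.
Qed.

Lemma tail_dist_fun (nu : probability TR R) z : nu E = 1%E ->
  tail nu a0 b0 z = 1 - dist_fun nu z.
Proof.
move=> nuE1; have mD : measurable D by exact: measurable_itv.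
have mI : measurable (`]z, +oo[%classic : set TR) by exact: measurable_itv.
have -> : 1 - dist_fun nu z = fine (nu `]z, +oo[%classic).
  have -> : `]z, +oo[%classic = ~` `]-oo, z]%classic :> set TR.
    by apply/seteqP; split => y /=; rewrite !in_itv /= andbT ltNge => /negP.
  have mz : measurable (`]-oo, z]%classic : set TR) by exact: measurable_itv.
  by rewrite probability_setC // dist_funE.
rewrite /tail; congr fine; rewrite [RHS](measureDI _ mI mD) setIC.
rewrite [X in (X + _)%E](null_disjoint mE nuE1) ?add0e //; first exact: measurableD.
move=> y [/= _ yD] /bE /andP[y1 y2]; apply: yD; rewrite in_itv /=.
by apply/andP; split; lra.
Qed.

Lemma small_symmetric_window (nu : probability TR R) x e : nu [set x] = 0%E -> 0 < e ->
  exists2 d, 0 < d & dist_fun nu (x + d) <= dist_fun nu (x - d) + e.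
Proof.
move=> nux e0.
have [||||n Hn] := @small_measure _ nu (fun n => `](x - n.+1%:R^-1), (x + n.+1%:R^-1)]%classic) e.
- by move=> i; exact: measurable_itv.
- move=> i j ij; apply/subsetPset => y /=; rewrite !in_itv /=.
  have : j.+1%:R^-1 <= i.+1%:R^-1 :> R by rewrite lef_pV2 ?posrE // ler_nat ltnS.
  move=> hij /andP[k1 k2]; rewrite (le_lt_trans _ k1) ?lerD2l ?lerN2 //.
  by rewrite (le_trans k2) // lerD2l.
- rewrite (_ : \bigcap_n _ = [set x]) //; apply/seteqP; split => [y Hy|y ->]; last first.
    by move=> n _ /=; rewrite in_itv /= ltrBlDr ltrDl lerDl invr_gt0 invr_ge0 ltr0Sn ler0n.
  apply: contrapT => /eqP yx; have yx0 : 0 < `|y - x| by rewrite normr_gt0 subr_eq0.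
  have bnd := archi_boundP (ltW (_ : 0 < `|y - x|^-1)).
  have := Hy (Num.bound `|y - x|^-1) I; rewrite /= in_itv /=.
  have near (v w : R) : x - w < v <= x + w -> `|v - x| <= w.
    by move=> /andP[k1 k2]; rewrite ler_norml; apply/andP; split; lra.
  move=> /near.
  rewrite leNgt => /negP; apply.
  rewrite -[ltRHS]invrK ltf_pV2 ?posrE ?invr_gt0 //.
  by apply: (lt_trans (bnd _)); rewrite ?invr_gt0 // ltr_nat.
- by [].
exists n.+1%:R^-1; first by rewrite invr_gt0.
have n0 : 0 < n.+1%:R^-1 :> R by rewrite invr_gt0.
have xn : x - n.+1%:R^-1 <= x + n.+1%:R^-1 by rewrite lerD2l (le_trans _ (ltW n0)) // oppr_le0 ltW.
by have := Hn; rewrite (dist_fun_window nu xn) lee_fin lerBlDl addrC => ->.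
Qed.

(** Without atoms, [arg_potential_lim] applies at every real point, the endpoints included; the
    value is [pi * (1 - dist_fun mu x) - pi]. *)
Lemma equilibrium_boundary :
  (forall x, mu [set x] = 0%E) /\
  (forall x, boundary_lim h x (- (pi * dist_fun mu x))).
Proof.
have [nu [munu hE nux]] := equilibrium_representation.
have nuE1 : nu E = 1%E by rewrite -munu //; case: hmu.
have dE x : dist_fun mu x = dist_fun nu x.
  by rewrite /dist_fun munu //; exact: measurable_itv.
split=> x; first by rewrite munu ?nux //; exact: measurable_set1.
have nfin : (nu D < +oo)%E by rewrite ltey_eq fin_num_measure //; exact: measurable_itv.
have lim := @arg_potential_lim _ nu a0 b0 ab nfin x.
have tE z := tail_dist_fun z nuE1.
have {}lim : boundary_lim (potential nu a0 b0 argk) x (pi * (1 - dist_fun nu x)).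
  rewrite -tE; apply: lim => [e e0|z z' zz'].
    have [d d0 Hd] := small_symmetric_window (nux x) e0; exists d => //.
    by rewrite !tE; lra.
  rewrite !tE lerD2l lerN2 fine_le // ?fin_num_measure //; try exact: measurable_itv.
  apply: le_measure; rewrite ?inE; try exact: measurable_itv.
  by move=> y /=; rewrite !in_itv /= => /le_trans ->.
move=> e e0; have [d d0 H] := lim e e0; exists d => // x' y xx' /andP[y0 yd].
rewrite hE // dE (_ : _ - _ - _ = potential nu a0 b0 argk (x', y) - pi * (1 - dist_fun nu x)); last by ring.
by apply: H; rewrite ?y0.
Qed.

End EquilibriumBoundary.

(** * The branch of the complex Green function *)

Lemma is_derive_local {R : realType} (f g : R -> R) (x a d : R) : 0 < d ->
  (forall t, `|t - x| < d -> f t = g t) -> is_derive x 1 f a -> is_derive x 1 g a.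
Proof.
move=> d0 fg /is_deriveP fa; apply/is_deriveP => e e0.
have [d' d'0 H] := fa e e0; exists (Num.min d d') => [|t]; first by rewrite lt_min d0.
rewrite lt_min => /andP[td td']; rewrite -!fg; first exact: H.
  by rewrite subrr normr0.
by rewrite addrAC subrr add0r.
Qed.

Section GreenBranch.
Context {R : realType} (E : set R) (al be : R) (g : R[i] -> R) (G : R[i] -> R[i]).
Hypotheses (cE : closed E) (bE : forall x, E x -> al <= x <= be)
  (hg : is_green_function (real_set E) g) (hG : is_complex_green_branch al g G).
Implicit Types (x y t : R) (p q : R * R).

Let u p := g (p.1 +i* p.2).
Let h p := complex.Im (G (p.1 +i* p.2)).

Lemma real_setE (A : set R) x y : real_set A (x +i* y) <-> y = 0 /\ A x.
Proof. by split=> [[t At [<- <-]]|[-> Ax]] //; exists x. Qed.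

Lemma green_function_plane : green_fun E u.
Proof.
have [hh [M [r gM]] cg g0] := hg.
have oD : open [set p : R * R | (~` real_set E) (p.1 +i* p.2)].
  have := closed_slit cE; rewrite -openC; congr open.
  by apply/funext => -[x y]; apply/propext; split=> H /real_setE.
split.
- move=> p; apply/continuous_pairP => e e0; have := cg (p.1 +i* p.2) => /cvgrPdist_lt.
  move=> /(_ e e0) /nbhs_complexP [d d0 H]; exists d => // x y h1 h2.
  by rewrite distrC; exact: H.
- move=> p np; have [ux [uy su]] := harmonic_on_smooth oD hh.
  by apply: (smooth_harmonic_harm oD su) => /real_setE.
- by move=> p [p2 Ep]; apply: g0; apply/real_setE.
- by exists M, r => p; exact: (gM (p.1 +i* p.2)).
Qed.

Lemma smooth_green : exists ux uy, smooth_harmonic (~` slit E) u ux uy.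
Proof.
have [hh _ _ _] := hg.
have DE : [set p : R * R | (~` real_set E) (p.1 +i* p.2)] = ~` slit E.
  by apply/funext => -[x y]; apply/propext; split=> H /real_setE.
have [|ux [uy]] := harmonic_on_smooth _ hh; first by rewrite DE openC; exact: closed_slit.
by rewrite DE => su; exists ux, uy.
Qed.

Context (ux uy : R * R -> R) (su : smooth_harmonic (~` slit E) u ux uy).

Let gu : green_fun E u := green_function_plane.

Let slit_plane p := p.2 != 0 \/ p.1 < al.

Let slit_planeP p : slit_plane p -> (~` real_set `[al, +oo[) (p.1 +i* p.2).
Proof.
move=> sp /real_setE [p2]; rewrite /= in_itv /= andbT leNgt => /negP; apply.
by case: sp => //; rewrite p2 eqxx.
Qed.

Let slit_plane_off p : slit_plane p -> (~` slit E) p.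
Proof.
move=> sp [p2 /bE /andP[h1 _]]; case: sp; first by rewrite p2 eqxx.
by rewrite ltNge h1.
Qed.

Lemma branch_cauchy_riemann p : slit_plane p ->
  is_derive p.1 1 (fun t => h (t, p.2)) (- uy p) /\
  is_derive p.2 1 (fun t => h (p.1, t)) (ux p).
Proof.
move=> sp; have [hol ReG _] := hG.
have [a [b [Rx Ix Ry Iy]]] := cauchy_riemann (hol _ (slit_planeP sp)).
have [ux1 uy1 _ _] := partials su (slit_plane_off sp).
have -> : ux p = a.
  apply: (is_derive_unique ux1).
  (* [G] has real part [g] on the slit plane only. A horizontal line off the axis lies in it
     entirely, whereas on the axis the neighbourhood must stay to the left of [al]. *)
  pose d := if p.2 == 0 then al - p.1 else 1.
  apply: (is_derive_local (d := d)) Rx => [|t td]; rewrite /d.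
    by case: ifP => // /eqP p2; case: sp; rewrite ?p2 ?eqxx // subr_gt0.
  apply: ReG; apply: (@slit_planeP (t, p.2)); case: (eqVneq p.2 0) td => p2 td; [right|left] => //=.
  by move: td; rewrite /d p2 eqxx ltr_norml => /andP[_]; rewrite ltrD2r.
have -> : uy p = - b.
  apply: (is_derive_unique uy1).
  pose d := if p.2 == 0 then 1 else `|p.2|.
  apply: (is_derive_local (d := d)) Ry => [|t td].
    by rewrite /d; case: ifP => // /negbT; rewrite normr_gt0.
  apply: ReG; apply: (@slit_planeP (p.1, t)).
  case: sp => [p2|]; [left => /=|by right].
  apply: contraTneq td => ->; rewrite /d (negbTE p2) sub0r normrN ltxx //.
by rewrite opprK.
Qed.

Lemma branch_conjugate_plus : conjugate_plus u ux uy h.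
Proof. by move=> p p0; apply: branch_cauchy_riemann; left; rewrite gt_eqF. Qed.

(** To the left of [E] the derivative [- uy] of [h] along the axis vanishes by symmetry of [u], so
    [h] is constant there; the normalisation at [al] makes the constant 0. *)
Lemma branch_left x : x < al -> h (x, 0) = 0.
Proof.
move=> xal; have cst t : t < al -> h (t, 0) = h (x, 0).
  move=> tal; apply: (@mean_value_eq _ (fun s => h (s, 0)) (fun s => - uy (s, 0))) => s st.
    have sal : s < al by case: st => /andP[_ /le_lt_trans ->].
    by have [] := @branch_cauchy_riemann (s, 0) (or_intror sal).
  rewrite (uy_real_off cE gu su) ?oppr0 // => /bE /andP[als _].
  have sal : s < al by case: st => /andP[_ /le_lt_trans ->].
  by rewrite ltNge als in sal.
have [_ _ /cvg_complexP lim] := hG.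
apply/eqP; rewrite -normr_le0; apply/ler_addgt0Pr => e e0; rewrite add0r.
have := lim e e0; rewrite /prop_near1 /nbhs /= /within /= => /nbhs_ballP [d /= d0 H].
have ald : al - d / 2 < al by rewrite ltrBlDr ltrDl divr_gt0.
have := H (al - d / 2); rewrite /ball /= => /(_ _ ald) [].
  by rewrite opprB addrC subrK gtr0_norm ?divr_gt0 // ltr_pdivrMr // ltr_pMr // ltr1n.
by move=> _; rewrite subr0 -(cst _ ald) /h /= => /ltW.
Qed.

Lemma branch_boundary_left x : x < al -> boundary_lim h x 0.
Proof.
move=> xal; have nE : ~ slit E (x, 0) by apply: (@slit_plane_off (x, 0)); right.
have [_ _ cux _] := partials su nE.
have [d d0 H] := (continuous_pairP _ _).1 cux 1 ltr01.
pose K := `|ux (x, 0)| + 1; have K0 : 0 < K by rewrite ltr_pwDr.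
move=> e e0; pose r := Num.min (Num.min d (al - x)) (e / K).
exists r => [|x' y]; first by rewrite !lt_min d0 subr_gt0 xal divr_gt0.
rewrite !lt_min => /andP[/andP[xd xa] _] /andP[y0 /andP[/andP[yd _] yK]].
have x'al : x' < al by have := ler_norm (x' - x); lra.
rewrite -(branch_left x'al); apply: (@le_lt_trans _ _ (K * `|y - 0|)).
  apply: (@mean_value_bound _ (fun t => h (x', t)) (fun t => ux (x', t))) => t ty.
    by have [] := @branch_cauchy_riemann (x', t) (or_intror x'al).
  have td : `|t - 0| < d by rewrite subr0 ltr_norml; case: ty => /andP[t1 t2]; apply/andP; split; lra.
  have := H x' t xd td; have := ler_normD (ux (x', t) - ux (x, 0)) (ux (x, 0)).
  by rewrite subrK /K; lra.
by rewrite subr0 gtr0_norm // mulrC -ltr_pdivlMr.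
Qed.

(** As [u] is even in [y], [ux] is even and [uy] odd, so [h (x, y) + h (x, - y)] has zero
    derivatives. The two half-planes are joined through an abscissa [x0 < al], where the vertical
    line avoids the slit and [h (x0, 0) = 0]. *)
Lemma branch_reflect x y : 0 < y -> h (x, - y) = - h (x, y).
Proof.
move=> y0; have sym := green_fun_symm _ cE gu.
have nz t : 0 < t -> (x, t).2 != 0 /\ (x, - t).2 != 0 by move=> t0; rewrite /= oppr_eq0 gt_eqF.
have uxS t s : 0 < s -> ux (t, - s) = ux (t, s).
  move=> s0; have [a _ _ _] := partials su (@slit_plane_off (t, s) (or_introl (lt0r_neq0 s0))).
  have ns : (t, - s).2 != 0 by rewrite /= oppr_eq0 gt_eqF.
  have [b _ _ _] := partials su (@slit_plane_off (t, - s) (or_introl ns)).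
  apply: (is_derive_unique b); apply: is_derive_eqf a => //.
  by apply/funext => v; rewrite -(sym (v, s)).
have uyS t s : 0 < s -> uy (t, - s) = - uy (t, s).
  move=> s0; have [_ a _ _] := partials su (@slit_plane_off (t, s) (or_introl (lt0r_neq0 s0))).
  have ns : (t, - s).2 != 0 by rewrite /= oppr_eq0 gt_eqF.
  have [_ b _ _] := partials su (@slit_plane_off (t, - s) (or_introl ns)).
  apply: (is_derive_unique b).
  have a' : is_derive (0 - - s) 1 (fun v => u (t, v)) (uy (t, s)) by rewrite sub0r opprK.
  apply: is_derive_eqf (is_derive_reflect a') => //.
  by apply/funext => v; rewrite sub0r -(sym (t, v)).
pose x0 := al - 1; have x0al : x0 < al by rewrite ltrBlDr ltrDl.
have Hx : h (x, y) + h (x, - y) = h (x0, y) + h (x0, - y).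
  apply: (@mean_value_eq _ (fun t => h (t, y) + h (t, - y)) (fun t => - uy (t, y) + - uy (t, - y))) => t _.
    have ny : (t, - y).2 != 0 by rewrite /= oppr_eq0 gt_eqF.
    have [a _] := @branch_cauchy_riemann (t, y) (or_introl (lt0r_neq0 y0)).
    have [b _] := @branch_cauchy_riemann (t, - y) (or_introl ny).
    exact: is_derive_fD a b.
  by rewrite uyS // opprK addrC subrr.
have Hy : h (x0, y) + h (x0, - y) = h (x0, 0) + h (x0, - 0).
  apply: (@mean_value_eq _ (fun t => h (x0, t) + h (x0, - t)) (fun t => ux (x0, t) - ux (x0, - t))) => t ty.
    have [_ a] := @branch_cauchy_riemann (x0, t) (or_intror x0al).
    have [_ b] := @branch_cauchy_riemann (x0, - t) (or_intror x0al).
    have b' : is_derive (0 - t) 1 (fun v => h (x0, v)) (ux (x0, - t)) by rewrite sub0r.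
    apply: is_derive_eqf (is_derive_fD a (is_derive_reflect b')) => //.
    by apply/funext => v; rewrite sub0r.
  have [->|t0] := eqVneq t 0; first by rewrite oppr0 subrr.
  rewrite uxS ?subrr // lt_neqAle eq_sym t0 /=.
  by case: ty => /andP[t1 t2] //; exact: le_trans (ltW y0) t1.
move: Hx; rewrite Hy oppr0 branch_left // addr0 => /eqP.
by rewrite addrC addr_eq0 => /eqP.
Qed.

End GreenBranch.

(** * Densities *)

Section LocalMeasures.
Context {R : realType}.
Local Notation TR := (measurableTypeR R).
Local Notation leb := (@lebesgue_measure R).
Implicit Types (x y t a b c d : R).

(** On each piece of [itv_cover] the restricted measures agree on half-open intervals, hence on all
    measurable sets; making the cover disjoint glues the pieces by countable additivity. *)
Lemma measure_eq_on_open (m1 m2 : {measure set TR -> \bar R}) (U : set R) : open U ->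
  (forall c d, c <= d -> (forall t, c <= t <= d -> U t) ->
    m1 `]c, d]%classic = m2 `]c, d]%classic /\ (m1 `]c, d]%classic < +oo)%E) ->
  forall A, measurable A -> m1 (A `&` U) = m2 (A `&` U).
Proof.
move=> oU H A mA; have [V [VP UE]] := itv_cover oU.
have mV n : measurable (V n) by have [->|[pq _ ->]] := VP n => //; exact: measurable_itv.
have step n B : measurable B -> m1 (B `&` V n) = m2 (B `&` V n).
  move=> mB; have [->|[[p q] [/= pq pqU] Vn]] := VP n; first by rewrite setI0 !measure0.
  have mI : measurable (`]p, q]%classic : set TR) by exact: measurable_itv.
  have sub a b : m1 (`]a, b]%classic `&` `]p, q]%classic) = m2 (`]a, b]%classic `&` `]p, q]%classic).
    have -> : `]a, b]%classic `&` `]p, q]%classic = `](Num.max a p), (Num.min b q)]%classic :> set TR.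
      apply/seteqP; split=> x /=; rewrite !in_itv /= gt_max le_min.
        by move=> [/andP[-> ->] /andP[-> ->]].
      by move=> /andP[/andP[-> ->] /andP[-> ->]].
    have [ab|ba] := ltP (Num.max a p) (Num.min b q); last first.
      by rewrite set_itv_ge ?measure0 // bnd_simp -leNgt.
    apply: (H _ _ (ltW ab) _).1 => t /andP[t1 t2]; apply: pqU.
    by move: t1 t2; rewrite ge_max le_min => /andP[_ ->] /andP[_ ->].
  rewrite Vn; apply: (@measure_eq_ocitv _ (mrestr m1 mI) (mrestr m2 mI)) => // a b.
    by move=> _; exact: sub.
  apply: le_lt_trans (H _ _ pq pqU).2; apply: le_measure; rewrite ?inE //.
  by apply: measurableI => //; exact: measurable_itv.
have mD n : measurable (seqDU V n).
  by apply: measurableD => //; apply: bigsetU_measurable.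
have AU : A `&` U = \bigcup_n (A `&` seqDU V n).
  by rewrite -setI_bigcupr -seqDU_bigcup_eq UE.
have tAU : trivIset setT (fun n => A `&` seqDU V n) by apply: trivIset_setIl.
rewrite AU !measure_bigcup //; try by move=> n _; exact: measurableI.
apply: eq_eseriesr => n _.
have -> : A `&` seqDU V n = (A `&` seqDU V n) `&` V n.
  by rewrite -setIA; congr (_ `&` _); apply/esym/setIidl; exact: subset_seqDU.
by apply: step; exact: measurableI.
Qed.

Section Density.
Context (f : R -> R) (mf : measurable_fun [set: TR] (f : TR -> R)) (f0 : forall x, 0 <= f x).

Definition density_measure (A : set TR) : \bar R := (\int[leb]_(x in A) (f x)%:E)%E.

Let density_measure0 : density_measure set0 = 0%E.
Proof. exact: integral_set0. Qed.

Let density_measure_ge0 A : (0 <= density_measure A)%E.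
Proof. by apply: integral_ge0 => x _; rewrite lee_fin. Qed.

Let density_measure_semi_sigma_additive : semi_sigma_additive density_measure.
Proof.
move=> F mF tF mU; rewrite /density_measure ge0_integral_bigcup //.
- apply: is_cvg_nneseries => n _ _; exact: density_measure_ge0.
- by apply/measurable_EFinP; exact: measurable_funTS.
- by move=> x _; rewrite lee_fin.
Qed.

HB.instance Definition _ := isMeasure.Build _ _ _ density_measure
  density_measure0 density_measure_ge0 density_measure_semi_sigma_additive.

Lemma density_measure_is_measure : exists nu : {measure set TR -> \bar R},
  forall A, nu A = (\int[leb]_(x in A) (f x)%:E)%E.
Proof. by exists density_measure. Qed.

End Density.

Lemma derive_ge0_of_nondecreasing (F : R -> R) x (a : R) : {homo F : x y / x <= y} ->
  is_derive x 1 F a -> 0 <= a.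
Proof.
move=> ndF /is_deriveP H; rewrite leNgt; apply/negP => a0.
have [d d0 Hd] := H (- a / 2) ltac:(by rewrite divr_gt0 // oppr_gt0).
have d2 : 0 < d / 2 by rewrite divr_gt0.
have := Hd (d / 2); rewrite gtr0_norm // => /(_ ltac:(lra)).
have xd : x <= x + d / 2 by rewrite lerDl ltW.
have := ndF _ _ xd; have : a * (d / 2) < 0 by rewrite nmulr_rlt0.
have := ler_norm (F (x + d / 2) - F x - a * (d / 2)); lra.
Qed.

(** Both measures ignore the complement of [U]. On segments inside [U] they agree by the fundamental
    theorem of calculus, which needs the continuity of [f]; [f >= 0] because a distribution function
    is monotone. *)
Lemma density_of_dist_fun (mu : probability TR R) (U : set R) (f : R -> R) : open U ->
  (forall x, U x -> is_derive x 1 (dist_fun mu) (f x) /\ {for x, continuous f}) ->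
  (forall x, ~ U x -> f x = 0) -> mu (~` U) = 0%E -> is_density f mu.
Proof.
move=> oU HU fU muU.
have mU : measurable (U : set TR) by exact: open_measurable.
have ndF : {homo dist_fun mu : x y / x <= y}.
  move=> x y xy; by rewrite -subr_ge0 -lee_fin -dist_fun_window.
have f0 x : 0 <= f x.
  have [Ux|/fU -> //] := pselect (U x).
  exact: derive_ge0_of_nondecreasing ndF (HU x Ux).1.
have mf : measurable_fun [set: TR] (f : TR -> R).
  have -> : f = f \_ U.
    by apply/funext => x; rewrite patchE; case: ifPn => // /negP; rewrite inE => /fU.
  apply/(measurable_restrictT _ mU); apply: open_continuous_measurable_fun => //.
  by move=> x /set_mem /HU [].
have [nu nuE] := density_measure_is_measure mf f0.
split => // A mA; rewrite -nuE.
have mAU : measurable (A `\` U) by exact: measurableD.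
have nAU : nu (A `\` U) = 0%E.
  by rewrite nuE integral0_eq // => x [_ /fU ->].
have muAU : mu (A `\` U) = 0%E.
  apply/eqP; rewrite eq_le measure_ge0 andbT -muU; apply: le_measure; rewrite ?inE //.
    exact: measurableC.
rewrite (measureDI mu mA mU) (measureDI nu mA mU) [X in (X + _)%E]muAU [X in (_ = X + _)%E]nAU !add0e.
apply: measure_eq_on_open => // c d cd cdU; split; last first.
  by rewrite ltey_eq fin_num_measure //; exact: measurable_itv.
transitivity (dist_fun mu d - dist_fun mu c)%:E; first exact: (dist_fun_window mu cd).
rewrite nuE; move: cd; rewrite le_eqVlt => /orP[/eqP ->|cd].
  by rewrite subrr set_itv_ge ?integral_set0 // bnd_simp ltxx.
rewrite integral_itv_obnd_cbnd; last by apply/measurable_EFinP; exact: measurable_funTS.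
apply/esym; apply: (integral_derive cd) => x xcd; by have [] := HU x (cdU x xcd).
Qed.

End LocalMeasures.

(** * Boundary values of the branch and the density *)

Section EquilibriumBranch.
Context {R : realType} (E : set R) (al be : R) (g : R[i] -> R) (G : R[i] -> R[i])
  (s : seq R) (mu : probability (measurableTypeR R) R).
Hypotheses (cE : closed E) (bE : forall x, E x -> al <= x <= be) (albe : al <= be)
  (hg : is_green_function (real_set E) g) (hG : is_complex_green_branch al g G)
  (Es : forall x, x \notin s -> ~ E x \/ interior E x)
  (hmu : is_equilibrium_measure E mu).
Implicit Types (x y t : R).
Local Notation F := (dist_fun mu).
Local Notation Gp := (boundary_value upper_half_plane G).
Local Notation Gm := (boundary_value lower_half_plane G).

Let u (p : R * R) := g (p.1 +i* p.2).
Let h (p : R * R) := complex.Im (G (p.1 +i* p.2)).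

Let boundary : (forall x, mu [set x] = 0%E) /\
  (forall x, boundary_lim h x (- (pi * F x))).
Proof.
have [ux [uy su]] := smooth_green cE hg.
have gu := green_function_plane cE hg.
have hd := branch_conjugate_plus bE hG su.
have hl := branch_boundary_left cE bE hg hG su.
exact: (equilibrium_boundary cE bE albe gu su hd hl Es hmu).
Qed.

Lemma equilibrium_no_atom x : mu [set x] = 0%E.
Proof. exact: boundary.1. Qed.

(** [boundary_fun h] is now [- pi * dist_fun mu] at every point, so its interior regularity passes
    to the distribution function with the factor [- pi^-1]. *)
Lemma dist_fun_derive x0 : interior E x0 -> exists (a : R -> R) (K d : R), 0 < d /\
  forall x, `|x - x0| < d -> is_derive x 1 F (a x) /\
    forall x', `|x' - x0| < d -> `|a x' - a x| <= K * `|x' - x|.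
Proof.
have [ux [uy su]] := smooth_green cE hg.
have gu := green_function_plane cE hg.
have hd := branch_conjugate_plus bE hG su.
have pi0 : pi != 0 :> R by rewrite gt_eqF // pi_gt0.
have bF x : boundary_fun h x = - (pi * F x).
  have b := boundary.2 x; apply: (boundary_lim_unique _ b).
  by apply: (@xgetPex _ 0 [set c | boundary_lim h x c]); exists (- (pi * F x)).
move=> /(boundary_fun_interior gu su hd) [a [K [d [d0 H]]]].
exists (fun x => - pi^-1 * a x), (pi^-1 * K), d; split=> // x xd.
have [ax aK] := H x xd; split=> [|x' x'd].
  have h1 := is_derive_fM (is_derive_affine (- pi^-1) 0 x) ax.
  apply: is_derive_eqf h1; last by rewrite !mul0r mulr0 !addr0.
  by apply/funext => t; rewrite /= bF mul0r addr0 mulNr mulrN opprK mulKf.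
rewrite /= -mulrBr normrM normrN (ger0_norm (_ : 0 <= pi^-1)) ?invr_ge0 ?pi_ge0 // -mulrA.
by rewrite ler_wpM2l ?invr_ge0 ?pi_ge0 // aK.
Qed.

(** The real part is [g], continuous on the whole plane; the imaginary part is covered by [boundary]
    from above, and by [branch_reflect] from below with the opposite sign. *)
Lemma branch_limits x :
  G z @[z --> within upper_half_plane (nbhs x%:C)] --> g x%:C +i* (- (pi * F x)) /\
  G z @[z --> within lower_half_plane (nbhs x%:C)] --> g x%:C +i* (pi * F x).
Proof.
have [ux [uy su]] := smooth_green cE hg.
have [_ ReG _] := hG; have [_ _ cg _] := hg.
have cgx e : 0 < e -> exists2 d, 0 < d & forall x' y', `|x' - x| < d -> `|y'| < d ->
    `|g (x' +i* y') - g x%:C| < e.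
  move=> e0; have := cg (x%:C) => /cvgrPdist_lt /(_ e e0) /nbhs_complexP [d d0 H].
  by exists d => // x' y' h1 h2; rewrite distrC; apply: H; rewrite ?subr0.
have off x' y' : y' != 0 -> complex.Re (G (x' +i* y')) = g (x' +i* y').
  by move=> y0; apply: ReG => /real_setE [y'0]; rewrite y'0 eqxx in y0.
split; apply: cvg_within_complex => e e0; have [d d0 Hd] := cgx e e0;
  have [d' d'0 Hd'] := boundary.2 x e e0; exists (Num.min d d'); rewrite ?lt_min ?d0 //;
  move=> x' y'; rewrite !lt_min => /andP[xd xd'] /andP[yd yd']; rewrite /= => y0.
  have y'0 : 0 < y' by [].
  rewrite off ?gt_eqF //; split; first exact: Hd.
  by apply: Hd' => //; rewrite y'0 /= -[y']gtr0_norm.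
have y'0 : y' < 0 by [].
rewrite off ?lt_eqF //; split; first exact: Hd.
have ny0 : 0 < - y' by rewrite oppr_gt0.
have /= := branch_reflect cE bE hg hG su x' ny0; rewrite opprK => ->.
rewrite -normrN opprD !opprK -[pi * F x]opprK; apply: Hd' => //.
have yd2 : - y' < d' by have := yd'; rewrite (ltr0_norm y'0).
by rewrite ny0.
Qed.

Let upper_proper x : ProperFilter (within upper_half_plane (nbhs (x%:C : R[i]))).
Proof.
apply: within_nbhs_proper => B /nbhs_complexP [d d0 H]; exists (x +i* (d / 2)); split.
  by rewrite /upper_half_plane /= divr_gt0.
apply: H; first by rewrite subrr normr0.
by rewrite subr0 gtr0_norm ?divr_gt0 // ltr_pdivrMr // ltr_pMr // ltr1n.
Qed.

Let lower_proper x : ProperFilter (within lower_half_plane (nbhs (x%:C : R[i]))).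
Proof.
apply: within_nbhs_proper => B /nbhs_complexP [d d0 H]; exists (x +i* (- (d / 2))); split.
  by rewrite /lower_half_plane /= oppr_lt0 divr_gt0.
apply: H; first by rewrite subrr normr0.
by rewrite subr0 normrN gtr0_norm ?divr_gt0 // ltr_pdivrMr // ltr_pMr // ltr1n.
Qed.

Lemma upper_boundary_value x : Gp x = g x%:C +i* (- (pi * F x)).
Proof. exact: (@cvg_lim _ (@norm_hausdorff _ _) _ _ (upper_proper x) _ _ (branch_limits x).1). Qed.

Lemma lower_boundary_value x : Gm x = g x%:C +i* (pi * F x).
Proof. exact: (@cvg_lim _ (@norm_hausdorff _ _) _ _ (lower_proper x) _ _ (branch_limits x).2). Qed.

Lemma real_derive_imaginary (H : R -> R[i]) (k : R -> R) x (c d : R) : 0 < d ->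
  (forall t, `|t - x| < d -> H t = 0 +i* k t) -> is_derive x 1 k c ->
  real_derivable H x /\ real_derive H x = 0 +i* c.
Proof.
move=> d0 Hk /is_deriveP kc.
suff lim : real_diff_quotient H x v @[v --> 0^'] --> 0 +i* c.
  by split; [apply/cvg_ex; exists (0 +i* c)|apply: cvg_lim => //; exact: norm_hausdorff].
apply/cvg_complexP => e e0; have [d' d'0 Hd'] := kc (e / 2) (divr_gt0 e0 (ltr0n R 2)).
rewrite /prop_near1 /nbhs /= /within /=; apply/nbhs_ballP; exists (Num.min d d') => /=.
  by rewrite lt_min d0.
move=> v; rewrite /ball /= sub0r normrN lt_min => /andP[vd vd'] v0.
rewrite /real_diff_quotient !Hk ?subrr ?normr0 // ?[x + v]addrC ?addrK //.
have -> : ((0 +i* k (v + x)) - (0 +i* k x)) / v%:C = 0 +i* ((k (v + x) - k x) / v) :> R[i].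
  apply/eqP; rewrite eq_complex /= !(mul0r, mulr0, subr0, addr0, oppr0, subrr, expr0n) /=.
  rewrite !(mul0r, mulr0, subr0, addr0, oppr0, add0r, sub0r) eqxx /=.
  by apply/eqP; field.
rewrite /= subrr normr0; split=> //.
have v1 : 0 < `|v| by rewrite normr_gt0.
have := Hd' v vd'; rewrite [x + v]addrC => hv.
have -> : (k (v + x) - k x) / v - c = (k (v + x) - k x - c * v) / v by field.
rewrite normrM normfV ltr_pdivrMr //; apply: le_lt_trans hv _.
by rewrite ltr_pM2r // ltr_pdivrMr // ltr_pMr // ltr1n.
Qed.

(** In the interior of [E], where [g] vanishes, the boundary values are purely imaginary with
    imaginary parts [pi * F] from below and [- pi * F] from above, so their derivatives are [i pi f]
    and [- i pi f]. *)
Lemma equilibrium_density : exists2 f : R -> R, is_density f mu &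
  forall x : R, interior E x ->
    [/\ real_derivable Gm x, real_derivable Gp x,
        (f x)%:C = 1 / (pi%:C * 'i%C) * real_derive Gm x
      & (f x)%:C = - (1 / (pi%:C * 'i%C)) * real_derive Gp x].
Proof.
have [_ _ _ g0] := hg.
(* The value 0 off the interior is harmless: the complement of the interior lies in the union of the
   complement of [E] and the finite list [s], which has no atoms. *)
pose f x := if pselect (interior E x) then 'D_1 F x else 0.
have fE x : interior E x -> f x = 'D_1 F x by rewrite /f; case: pselect.
have dF x : interior E x -> is_derive x 1 F (f x).
  move=> Ex; have [a [K [d [d0 /(_ x)]]]] := dist_fun_derive Ex.
  by rewrite subrr normr0 => /(_ d0) [[da _] _]; rewrite fE //; exact/derivableP.
have cF x : interior E x -> {for x, continuous f}.
  move=> Ex; have [a [K [d [d0 H]]]] := dist_fun_derive Ex.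
  have /nbhs_ballP [r /= r0 rE] : nbhs x (interior E).
    exact: (open_nbhs_nbhs (conj (@open_interior _ E) Ex)).
  (* The Lipschitz derivative [a] is attached to a neighbourhood of [x]; identifying it with [f]
     there transfers continuity to [f]. *)
  have fa t : `|t - x| < d -> `|t - x| < r -> f t = a t.
    move=> td tr; have [at' _] := H t td.
    have Et : interior E t by apply: rE; rewrite /ball /= distrC.
    exact: is_derive_unique (dF t Et) at'.
  apply/cvgrPdist_lt => e e0; apply/nbhs_ballP.
  pose K1 := `|K| + 1; have K10 : 0 < K1 by rewrite ltr_pwDr.
  exists (Num.min (Num.min d r) (e / K1)) => [|t] /=.
    by rewrite !lt_min d0 r0 divr_gt0.
  rewrite /ball /= distrC !lt_min => /andP[/andP[td tr] te].
  have x0 : `|x - x| < d by rewrite subrr normr0.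
  rewrite !fa ?subrr ?normr0 // distrC.
  apply: le_lt_trans ((H x x0).2 t td) _.
  rewrite ltr_pdivlMr // in te; apply: le_lt_trans te.
  by rewrite mulrC ler_wpM2l // /K1; have := ler_norm K; lra.
exists f.
  apply: (@density_of_dist_fun _ mu (interior E)) => //; first exact: open_interior.
  - by move=> x Ex; split; [exact: dF|exact: cF].
  - by move=> x nEx; rewrite /f; case: pselect.
  have mE : measurable (E : set (measurableTypeR R)) by exact: closed_measurable.
  have [mu1 _] := hmu.
  have muE : mu (~` E) = 0%E by rewrite probability_setC // mu1 subee.
  have mI : measurable (interior E : set (measurableTypeR R)).
    by apply: open_measurable; exact: open_interior.
  have mu0 (r : seq R) : measurable ([set` r] : set (measurableTypeR R)) /\ mu [set` r] = 0%E.
    elim: r => [|x r [mr IH]]; first by rewrite set_nil measure0.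
    have -> : [set` x :: r] = [set x] `|` [set` r] :> set R.
      apply/seteqP; split=> y /=; rewrite in_cons; first by move=> /orP[/eqP|]; [left|right].
      by move=> [->|->]; rewrite ?eqxx ?orbT.
    have mx : measurable ([set x] : set (measurableTypeR R)) by exact: measurable_set1.
    split; first exact: measurableU.
    apply/eqP; rewrite eq_le measure_ge0 andbT.
    apply: (le_trans (measureU2 mu mx mr)); rewrite [X in (X + _)%E]equilibrium_no_atom.
    by rewrite [X in (_ + X)%E]IH adde0.
  have [ms mus] := mu0 s; have mCE : measurable (~` E : set (measurableTypeR R)) by exact: measurableC.
  apply/eqP; rewrite eq_le measure_ge0 andbT.
  apply: (@le_trans _ _ (mu (~` E `|` [set` s]))).
    apply: le_measure; rewrite ?inE //; [exact: measurableC|exact: measurableU|].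
    move=> x nI; have [xs|/Es [|//]] := boolP (x \in s); [by right|by left].
  by apply: (le_trans (measureU2 mu mCE ms)); rewrite [X in (X + _)%E]muE [X in (_ + X)%E]mus adde0.
move=> x Ex; have /nbhs_ballP [d /= d0 dE] := Ex.
have gE t : `|t - x| < d -> g t%:C = 0.
  by move=> td; apply: g0; exists t => //; apply: dE; rewrite /ball /= distrC.
have dpi : is_derive x 1 (fun t => pi * F t) (pi * f x).
  apply: is_derive_eqf (is_derive_fM (is_derive_affine pi 0 x) (dF x Ex)); last by rewrite !mul0r mulr0 !addr0.
  by apply/funext => t; rewrite mul0r addr0.
have dpn : is_derive x 1 (fun t => - (pi * F t)) (- (pi * f x)).
  apply: is_derive_eqf (is_derive_fM (is_derive_affine (- pi) 0 x) (dF x Ex)).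
    by apply/funext => t; rewrite mul0r addr0 mulNr.
  by rewrite !mul0r mulr0 !addr0 mulNr.
have [m1 m2] := @real_derive_imaginary Gm _ x _ d d0 (fun t td => etrans (lower_boundary_value t) (congr2 _ (gE t td) erefl)) dpi.
have [p1 p2] := @real_derive_imaginary Gp _ x _ d d0 (fun t td => etrans (upper_boundary_value t) (congr2 _ (gE t td) erefl)) dpn.
have pi0 : pi != 0 :> R by rewrite gt_eqF // pi_gt0.
have iE (c : R) : 0 +i* c = c%:C * 'i%C.
  by apply/eqP; rewrite eq_complex /= !(mul0r, mulr0, mulr1, subr0, addr0, add0r, oppr0) !eqxx.
have i0 : 'i%C != 0 :> R[i] by rewrite eq_complex /= oner_eq0 andbF.
have pC0 : pi%:C != 0 :> R[i] by rewrite eq_complex /= (negbTE pi0).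
have cancel (K : fieldType) (p i c : K) : p != 0 -> i != 0 ->
    c = 1 / (p * i) * (p * c * i) /\ c = - (1 / (p * i)) * (- (p * c) * i).
  by move=> p_neq0 i_neq0; split; field; rewrite p_neq0 i_neq0.
have [e1 e2] := cancel _ _ _ (f x)%:C pC0 i0.
by split=> //; rewrite ?m2 ?p2 iE ?rmorphN ?rmorphM /=; [exact: e1|exact: e2].
Qed.

End EquilibriumBranch.

(** * Finite unions of intervals and their distribution functions *)

Section IntervalUnion.
Context {R : realType} (b : nat -> R).
Implicit Types (l i j k : nat) (x y : R).

Lemma interval_unionP l x : interval_union l b x <->
  exists2 j, (1 <= j <= l)%N & b (2 * j - 1)%N <= x <= b (2 * j)%N.
Proof.
split=> [[j /= jl]|[j jl jx]]; first by rewrite in_itv /=; exists j.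
by exists j => //=; rewrite in_itv.
Qed.

Lemma closed_interval_union l : closed (interval_union l b).
Proof.
elim: l => [|l IH].
  rewrite (_ : interval_union 0 b = set0); first exact: closed0.
  by apply/seteqP; split=> // x /interval_unionP [j /andP[j1 /(leq_trans j1)]].
rewrite (_ : interval_union l.+1 b =
  interval_union l b `|` `[b (2 * l.+1 - 1)%N, b (2 * l.+1)%N]%classic).
  by apply: closedU => //; exact: itv_closed.
apply/seteqP; split=> x.
  move=> /interval_unionP [j /andP[j1 jl] jx]; move: jl; rewrite leq_eqVlt => /orP[/eqP jE|jl].
    by right; rewrite /= in_itv /= -jE.
  by left; apply/interval_unionP; exists j; rewrite ?j1.
move=> [/interval_unionP [j /andP[j1 jl] jx]|].
  by apply/interval_unionP; exists j => //; rewrite j1 leqW.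
by rewrite /= in_itv /= => lx; apply/interval_unionP; exists l.+1; rewrite ?leqnn.
Qed.

Context (l : nat) (hb : forall i, (1 <= i < 2 * l)%N -> b i < b i.+1).

Lemma endpoints_le i j : (1 <= i)%N -> (i <= j)%N -> (j <= 2 * l)%N -> b i <= b j.
Proof.
move=> i1; elim: j => [|j IH]; first by rewrite leqn0 => /eqP i0; rewrite i0 in i1.
rewrite leq_eqVlt => /orP[/eqP -> //|]; rewrite ltnS => ij jl.
apply: le_trans (IH ij (ltnW jl)) _; apply: ltW; apply: hb.
by rewrite (leq_trans i1 ij).
Qed.

Lemma interval_union_bounded x : interval_union l b x -> b 1%N <= x <= b (2 * l)%N.
Proof.
move=> /interval_unionP [j /andP[j1 jl] /andP[x1 x2]]; apply/andP; split.
  by apply: le_trans x1; apply: endpoints_le; lia.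
by apply: (le_trans x2); apply: endpoints_le; lia.
Qed.

(** The [2 * l] endpoints serve as the exceptional list [s]. *)
Lemma interval_union_interior x : x \notin [seq b i | i <- iota 1 (2 * l)] ->
  ~ interval_union l b x \/ interior (interval_union l b) x.
Proof.
move=> xs; have [Ex|] := pselect (interval_union l b x); [right|by left].
have [j jl /andP[x1 x2]] := (interval_unionP _ _).1 Ex.
have ends i : (1 <= i <= 2 * l)%N -> b i != x.
  move=> il; apply: contraNneq xs => <-; apply: map_f; rewrite mem_iota; lia.
have xI : `]b (2 * j - 1)%N, b (2 * j)%N[%classic x.
  by rewrite /= in_itv /= !lt_neqAle x1 x2 ends 1?eq_sym ?ends //; lia.
have : nbhs x (`]b (2 * j - 1)%N, b (2 * j)%N[%classic : set R).
  by apply: open_nbhs_nbhs; split => //; exact: interval_open.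
apply: filterS => y; rewrite /= in_itv /= => /andP[y1 y2].
by apply/interval_unionP; exists j => //; rewrite !ltW.
Qed.

Lemma interval_union_gap j y : (1 <= j < l)%N -> b (2 * j)%N < y < b (2 * j).+1 ->
  ~ interval_union l b y.
Proof.
move=> jl /andP[y1 y2] /interval_unionP [k /andP[k1 kl] /andP[x1 x2]].
have [kj|jk] := leqP k j.
  have : b (2 * k)%N <= b (2 * j)%N by apply: endpoints_le; lia.
  by move=> /(le_trans x2); rewrite leNgt y1.
have : b (2 * j).+1 <= b (2 * k - 1)%N by apply: endpoints_le; lia.
by move=> /le_trans /(_ x1); rewrite leNgt y2.
Qed.

Context (mu : probability (measurableTypeR R) R).
Hypotheses (mu1 : mu (interval_union l b) = 1%E) (mu0 : forall x, mu [set x] = 0%E).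
Local Notation TR := (measurableTypeR R).
Local Notation F := (dist_fun mu).

Let mE : measurable (interval_union l b : set TR).
Proof. by apply: closed_measurable; exact: closed_interval_union. Qed.

Lemma measure_segment x y : x <= y -> mu `[x, y]%classic = (F y - F x)%:E.
Proof.
move=> xy; rewrite -dist_fun_window //.
have mx : measurable ([set x] : set TR) by exact: measurable_set1.
have mI : measurable (`]x, y]%classic : set TR) by exact: measurable_itv.
rewrite (_ : `[x, y]%classic = [set x] `|` `]x, y]%classic); last first.
  by rewrite setU1itv // bnd_simp.
rewrite measureU //; first by rewrite [X in (X + _)%E]mu0 add0e.
by rewrite -subset0 => z /= [->]; rewrite in_itv /= ltxx.
Qed.

Lemma dist_fun_endpoint1 : (1 <= l)%N -> F (b 1%N) = 0.
Proof.
move=> l1; rewrite /dist_fun; suff -> : mu `]-oo, b 1%N]%classic = 0%E by [].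
have mx : measurable ([set b 1%N] : set TR) by exact: measurable_set1.
have mI : measurable (`]-oo, b 1%N[%classic : set TR) by exact: measurable_itv.
rewrite (_ : `]-oo, b 1%N]%classic = `]-oo, b 1%N[%classic `|` [set b 1%N]); last first.
  by rewrite setUitv1 // bnd_simp.
rewrite measureU //; first rewrite [X in (_ + X)%E]mu0 adde0.
  apply: (null_disjoint mE mu1 mI) => y /=; rewrite in_itv /= => yb /interval_union_bounded.
  by rewrite leNgt yb.
by rewrite -subset0 => z /= [+ zE]; rewrite zE in_itv /= ltxx.
Qed.

Lemma dist_fun_gap j : (1 <= j < l)%N -> F (b (2 * j).+1) = F (b (2 * j)%N).
Proof.
move=> jl; have bj : b (2 * j)%N < b (2 * j).+1 by apply: hb; lia.
apply/eqP; rewrite -subr_eq0; apply/eqP; suff : mu `]b (2 * j)%N, b (2 * j).+1]%classic = 0%E.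
  by rewrite (dist_fun_window mu (ltW bj)) => -[].
have mx : measurable ([set b (2 * j).+1] : set TR) by exact: measurable_set1.
have mI : measurable (`]b (2 * j)%N, b (2 * j).+1[%classic : set TR) by exact: measurable_itv.
rewrite (_ : `]b (2 * j)%N, b (2 * j).+1]%classic =
  `]b (2 * j)%N, b (2 * j).+1[%classic `|` [set b (2 * j).+1]); last first.
  by rewrite setUitv1 // bnd_simp.
rewrite measureU //; first rewrite [X in (_ + X)%E]mu0 adde0.
  apply: (null_disjoint mE mu1 mI) => y /=; rewrite in_itv /=; exact: interval_union_gap.
by rewrite -subset0 => z /= [+ zE]; rewrite zE in_itv /= ltxx andbF.
Qed.

(** The distribution function is constant across each gap, so the value at the right end of one
    interval cancels against that at the left end of the next; at [b 1] it is 0 because there is no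
    atom. *)
Lemma dist_fun_telescope j : (1 <= j <= l)%N ->
  \sum_(1 <= k < j) (F (b (2 * k)%N) - F (b (2 * k - 1)%N)) = F (b (2 * j - 1)%N).
Proof.
case: j => // j; elim: j => [|j IH] jl.
  by rewrite big_geq // dist_fun_endpoint1.
rewrite big_nat_recr //= IH; last lia.
rewrite addrC subrK -dist_fun_gap; last lia.
by congr (F (b _)); lia.
Qed.

End IntervalUnion.

Theorem corollary2p2 (R : realType) (l : nat) (b : nat -> R)
    (g : R[i] -> R) (G : R[i] -> R[i])
    (mu : probability (measurableTypeR R) R)
    (E := interval_union l b)
    (Gp := boundary_value upper_half_plane G)
    (Gm := boundary_value lower_half_plane G)
    (hl : (1 <= l)%N)
    (hb : forall i : nat, (1 <= i < 2 * l)%N -> b i < b i.+1)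
    (hg : is_green_function (real_set E) g)
    (hG : is_complex_green_branch (b 1%N) g G)
    (hmu : is_equilibrium_measure E mu) :
  [/\ forall x : R, E x ->
        G z @[z --> within upper_half_plane (nbhs x%:C)] -->
          - ('i%C * pi%:C * (fine (mu `[b 1%N, x]%classic))%:C) /\
        G z @[z --> within lower_half_plane (nbhs x%:C)] -->
          'i%C * pi%:C * (fine (mu `[b 1%N, x]%classic))%:C,
      forall (j : nat) (x : R), (1 <= j <= l)%N ->
        x \in `[b (2 * j - 1)%N, b (2 * j)%N] ->
        G z @[z --> within upper_half_plane (nbhs x%:C)] -->
          - ('i%C * pi%:C * \sum_(1 <= k < j)
              (fine (mu `[b (2 * k - 1)%N, b (2 * k)%N]%classic))%:C)
          - 'i%C * pi%:C * (fine (mu `[b (2 * j - 1)%N, x]%classic))%:C /\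
        G z @[z --> within lower_half_plane (nbhs x%:C)] -->
          'i%C * pi%:C * \sum_(1 <= k < j)
              (fine (mu `[b (2 * k - 1)%N, b (2 * k)%N]%classic))%:C
          + 'i%C * pi%:C * (fine (mu `[b (2 * j - 1)%N, x]%classic))%:C
    & exists2 f : R -> R, is_density f mu &
        forall x : R, interior E x ->
          [/\ real_derivable Gm x, real_derivable Gp x,
              (f x)%:C = 1 / (pi%:C * 'i%C) * real_derive Gm x
            & (f x)%:C = - (1 / (pi%:C * 'i%C)) * real_derive Gp x]].
Proof.
have cE : closed E := closed_interval_union (b := b) (l := l).
have bE := interval_union_bounded hb.
have Es := interval_union_interior (b := b) (l := l).
have bb : b 1%N <= b (2 * l)%N by apply: (endpoints_le hb); lia.
have mu0 := equilibrium_no_atom cE bE bb hg hG Es hmu.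
have mu1 := hmu.1; have [_ _ _ g0] := hg.
have F1 := dist_fun_endpoint1 hb mu1 mu0 hl.
have iE (c : R) : 'i%C * pi%:C * c%:C = 0 +i* (pi * c).
  by apply/eqP; rewrite eq_complex /= !(mul0r, mulr0, mul1r, subr0, addr0, add0r, oppr0) !eqxx.
have niE (c : R) : - ('i%C * pi%:C * c%:C) = 0 +i* (- (pi * c)).
  by rewrite iE; apply/eqP; rewrite eq_complex /= oppr0 !eqxx.
have lims x c : E x -> c = dist_fun mu x ->
    G z @[z --> within upper_half_plane (nbhs x%:C)] --> - ('i%C * pi%:C * c%:C) /\
    G z @[z --> within lower_half_plane (nbhs x%:C)] --> 'i%C * pi%:C * c%:C.
  move=> Ex ->; rewrite niE iE.
  have gx : g x%:C = 0 by apply: g0; exists x.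
  by have := branch_limits cE bE bb hg hG Es hmu x; rewrite gx.
split=> [x Ex|j x jl xj|].
- apply: lims => //; have /andP[b1x _] := bE x Ex.
  by rewrite (measure_segment mu0 b1x) /= F1 subr0.
- have /andP[x1 x2] : b (2 * j - 1)%N <= x <= b (2 * j)%N by rewrite in_itv in xj.
  have Ex : E x by apply/interval_unionP; exists j; rewrite ?x1.
  set S := (\sum_(1 <= k < j) _ : R[i]); set m := fine _.
  have mE : m = dist_fun mu x - dist_fun mu (b (2 * j - 1)%N).
    by rewrite /m (measure_segment mu0 x1).
  have SE : S = (dist_fun mu (b (2 * j - 1)%N))%:C.
    rewrite -(dist_fun_telescope hb mu1 mu0 jl) rmorph_sum; apply: eq_big_nat => k /andP[k1 kj].
    by rewrite (measure_segment mu0) //; apply: (endpoints_le hb); lia.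
  have sumE : (dist_fun mu x)%:C = S + m%:C by rewrite SE mE -rmorphD addrC subrK.
  by have := lims x _ Ex erefl; rewrite sumE mulrDr opprD.
- exact: (equilibrium_density cE bE bb hg hG Es hmu).
Qed.
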